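(* Let $\alpha>0$, let $D\subset\mathbb{R}^d$ be a bounded $C^2$ domain, and suppose $\alpha>d/2-1$. Let $\theta=\alpha-d/2+1$. Then the mild solution $\{u(t,x)\}_{t\ge0,\,x\in D}$ has a version that is locally Hölder continuous of order $\beta_0$ in $t$ and of order $\beta_1$ in $x$ for any $\beta_0\in\left(0,\frac{\theta\wedge1}{2}\right)$ and $\beta_1\in(0,\theta\wedge1)$.
   Context: A domain is a nonempty open connected set. Let $0<\lambda_1<\lambda_2\le\lambda_3\le\cdots$ be the eigenvalues (with multiplicity) of the Dirichlet Laplacian $-\Delta$ on $D$ and $\{f_n\}_{n\ge1}$ an orthonormal basis of $L^2(D)$ of eigenfunctions: $-\Delta f_n=\lambda_n f_n$ in $D$, $f_n=0$ on $\partial D$. The Dirichlet heat kernel is $P_t(x,y)=\sum_{n\ge1}e^{-\lambda_n t}f_n(x)f_n(y)$. Let $\mathcal{S}(D)=\{\phi\in C_0(D):\ \forall k\ge0,\ \lim_{n\to\infty}n^k|\langle\phi,f_n\rangle_{L^2(D)}|=0\}$. Let $\mathcal{H}^\alpha(D)$ be the completion of $\mathcal{S}(D)$ under $\langle\phi,\psi\rangle_\alpha=\sum_{n\ge1}\lambda_n^{-\alpha}\langle\phi,f_n\rangle_{L^2(D)}\langle\psi,f_n\rangle_{L^2(D)}$, and $\mathcal{H}_\alpha(D)=L^2((0,\infty);\mathcal{H}^\alpha(D))$. The noise $W_\alpha=\{W_\alpha(f)\}_{f\in\mathcal{H}_\alpha(D)}$ is a centered isonormal Gaussian process on a complete probability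 space with $\mathbb{E}[W_\alpha(f)W_\alpha(g)]=\int_0^\infty\langle f(s,\cdot),g(s,\cdot)\rangle_\alpha\,\mathrm{d}s$. The mild solution of $\partial_tu=\Delta u+\dot W_\alpha$ on $D$ with zero Dirichlet boundary and zero initial condition is the centered Gaussian field $u(t,x)=\int_0^t\int_DP_{t-r}(x,y)W_\alpha(\mathrm{d}r,\mathrm{d}y):=W_\alpha(p_{t,x})$ for $t>0$, where $p_{t,x}(s,y)=P_{t-s}(x,y)\mathbf{1}_{(0,t)}(s)$, and $u(0,x)=0$; it is well defined when $\alpha>d/2-1$. Notation: $a\wedge b=\min\{a,b\}$. ''Locally Hölder continuous of order $\beta_0$ in $t$ and $\beta_1$ in $x$'' means that almost surely, on each compact subset of $[0,\infty)\times D$, $|u(t,x)-u(s,y)|\le C(|t-s|^{\beta_0}+|x-y|^{\beta_1})$ with a finite (random) constant $C$. *)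

(* Defs.v *)
From HB Require Import structures.
From mathcomp Require Import all_boot all_order all_algebra.
From mathcomp Require Import all_classical all_reals all_analysis.

Set Implicit Arguments.
Unset Strict Implicit.
Unset Printing Implicit Defensive.
Import Order.TTheory GRing.Theory Num.Theory.
Import numFieldNormedType.Exports.
Local Open Scope classical_set_scope.
Local Open Scope ring_scope.

(* Lebesgue measure on R^n, carried by n-tuples, whose sigma-algebra is the one
   generated by the coordinates (the Borel sets). It is built by induction on n
   as the image of lebesgue_measure \x lebesgue_tuple n under (x, z) |-> x :: z. *)
Section lebesgue_cons.
Context {R : realType} (n : nat).
Local Notation T := (measurableTypeR R).

Definition tuple_cons (p : T * n.-tuple T) : n.+1.-tuple T :=
  [the n.+1.-tuple T of p.1 :: p.2].

Lemma measurable_tuple_cons : measurable_fun setT tuple_cons.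
Proof. exact: (measurable_cons measurable_fst measurable_snd). Qed.

Variable m : {sigma_finite_measure set (n.-tuple T) -> \bar R}.

Definition lebesgue_cons : set (n.+1.-tuple T) -> \bar R :=
  pushforward (@lebesgue_measure R \x m)%E tuple_cons.

Let lebesgue_cons0 : lebesgue_cons set0 = 0%E.
Proof. by rewrite /lebesgue_cons /pushforward preimage_set0 measure0. Qed.

Let lebesgue_cons_ge0 A : (0 <= lebesgue_cons A)%E.
Proof. by rewrite /lebesgue_cons /pushforward measure_ge0. Qed.

Let lebesgue_cons_sigma_additive : semi_sigma_additive lebesgue_cons.
Proof.
move=> F mF tF mUF; rewrite /lebesgue_cons /pushforward preimage_bigcup.
have mC A : measurable A -> measurable (tuple_cons @^-1` A).
  by move=> mA; rewrite -[X in measurable X]setTI; exact: measurable_tuple_cons.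
apply: measure_semi_sigma_additive.
- by move=> k; exact: mC.
- apply/trivIsetP => i j _ _ ij; rewrite -preimage_setI.
  by move/trivIsetP : tF => /(_ _ _ _ _ ij) ->//; rewrite preimage_set0.
- by rewrite -preimage_bigcup; exact: mC.
Qed.

HB.instance Definition _ := isMeasure.Build _ _ _ lebesgue_cons
  lebesgue_cons0 lebesgue_cons_ge0 lebesgue_cons_sigma_additive.

Let lebesgue_cons_sigma_finite : sigma_finite setT lebesgue_cons.
Proof.
have /sigma_finiteP[F [TF ndF Foo]] := sigma_finiteT (@lebesgue_measure R).
have /sigma_finiteP[G [TG ndG Goo]] := sigma_finiteT m.
pose g (z : n.+1.-tuple T) : (T * n.-tuple T)%type :=
  (thead z, [tuple of behead z]).
have mg : measurable_fun setT g.
  apply: measurable_fun_pair; first exact: measurable_tnth.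
  exact: measurable_behead.
exists (fun i => g @^-1` (F i `*` G i)).
  apply/esym; rewrite -subTset => z _.
  have [i _ Fi] : (\bigcup_i F i) (thead z) by rewrite -TF.
  have [j _ Gj] : (\bigcup_i G i) [tuple of behead z] by rewrite -TG.
  exists (maxn i j) => //; split.
  - by move: Fi; exact/subsetPset/ndF/leq_maxl.
  - by move: Gj; exact/subsetPset/ndG/leq_maxr.
move=> i; have [mFi Fi] := Foo i; have [mGi Gi] := Goo i; split.
  rewrite -[X in measurable X]setTI; apply: mg => //; exact: measurableX.
rewrite /lebesgue_cons /pushforward -comp_preimage (_ : g \o tuple_cons = id).
  by rewrite preimage_id product_measure1E// lte_mul_pinfty// ge0_fin_numE.
by apply/funext => -[x z]; rewrite /g/=; congr (_, _); exact: val_inj.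
Qed.

HB.instance Definition _ := Measure_isSigmaFinite.Build _ _ _ lebesgue_cons
  lebesgue_cons_sigma_finite.

End lebesgue_cons.

Fixpoint lebesgue_tuple {R : realType} (n : nat) :
    {sigma_finite_measure set (n.-tuple (measurableTypeR R)) -> \bar R} :=
  match n with
  | 0 => @dirac _ (0.-tuple (measurableTypeR R)) [tuple] R
  | n'.+1 => lebesgue_cons (@lebesgue_tuple R n')
  end.

Section euclidean_space.
Context {R : realType}.

Definition rv_of_tuple n (z : n.-tuple (measurableTypeR R)) : 'rV[R]_n :=
  \row_i (tnth z i : R).

(* The norm `|x| of 'rV[R]_n is the sup norm; it has the same open, compact and
   bounded sets as the Euclidean one. *)
Definition enorm n (x : 'rV[R]_n) : R := Num.sqrt (\sum_i (x ord0 i) ^+ 2).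

Definition partial n (i : 'I_n) (g : 'rV[R]_n -> R) (x : 'rV[R]_n) : R :=
  'D_(delta_mx ord0 i : 'rV[R]_n) g x.

Definition laplacian n (g : 'rV[R]_n -> R) (x : 'rV[R]_n) : R :=
  \sum_(i < n) partial i (partial i g) x.

(* g is of class C^2 on the open set U. *)
Definition C2_on n (U : set 'rV[R]_n) (g : 'rV[R]_n -> R) : Prop :=
  forall x, U x ->
    [/\ {for x, continuous g},
        (forall i : 'I_n, derivable g x (delta_mx ord0 i : 'rV[R]_n) /\
                          {for x, continuous (partial i g)}) &
        (forall i j : 'I_n,
           derivable (partial i g) x (delta_mx ord0 j : 'rV[R]_n) /\
           {for x, continuous (partial j (partial i g))})].

Definition is_domain n (D : set 'rV[R]_n) : Prop :=
  [/\ D !=set0, open D & connected D].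

(* Near each boundary point, and up to relabelling and reorienting the axes, D
   is the region above the graph of a C^2 function of the other n - 1
   coordinates; col' i x is x with its i-th coordinate removed. *)
Definition C2_boundary n (D : set 'rV[R]_n) : Prop :=
  forall x0, (closure D `\` D) x0 ->
    exists (r : R) (i : 'I_n) (b : bool) (g : 'rV[R]_n.-1 -> R),
      [/\ 0 < r, C2_on setT g &
          forall x, enorm (x - x0) < r ->
            (D x <-> g (col' i x) < (-1) ^+ b * x ord0 i)].

Definition square_integrable n (D : set 'rV[R]_n) (g : 'rV[R]_n -> R) : Prop :=
  measurable_fun (@rv_of_tuple n @^-1` D) (g \o @rv_of_tuple n) /\
  (\int[lebesgue_tuple n]_(z in @rv_of_tuple n @^-1` D)
     ((g (rv_of_tuple z)) ^+ 2)%:E < +oo)%E.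

Definition L2_inner n (D : set 'rV[R]_n) (g h : 'rV[R]_n -> R) : R :=
  \int[lebesgue_tuple n]_(z in @rv_of_tuple n @^-1` D)
    (g (rv_of_tuple z) * h (rv_of_tuple z)).

(* Functions on a bounded domain D that vanish on its boundary are represented
   by their extension by 0 outside D, so that C_0(D) consists of the continuous
   functions on R^n that vanish off D. *)
Definition C0 n (D : set 'rV[R]_n) (g : 'rV[R]_n -> R) : Prop :=
  continuous g /\ forall x, ~ D x -> g x = 0.

End euclidean_space.

Section dirichlet_laplacian.
Context {R : realType} (d : nat) (D : set 'rV[R]_d).
Implicit Types (lam : nat -> R) (f : nat -> 'rV[R]_d -> R).

Definition orthonormal_basis f : Prop :=
  [/\ (forall n, square_integrable D (f n)),
      (forall m n, L2_inner D (f m) (f n) = (m == n)%:R) &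
      (forall g, square_integrable D g ->
         (fun n => let h x := g x - \sum_(k < n) L2_inner D g (f k) * f k x in
                   L2_inner D h h) @ \oo --> (0 : R))].

Definition dirichlet_eigenfunction (l : R) (g : 'rV[R]_d -> R) : Prop :=
  [/\ C0 D g, C2_on D g & forall x, D x -> - laplacian g x = l * g x].

(* lam n and f n stand for lambda_(n+1) and f_(n+1). *)
Definition dirichlet_eigensystem lam f : Prop :=
  [/\ 0 < lam 0%N /\ lam 0%N < lam 1%N,
      (forall m n, (m <= n)%N -> lam m <= lam n),
      (forall n, dirichlet_eigenfunction (lam n) (f n)) &
      orthonormal_basis f].

Definition heat_kernel lam f (t : R) (x y : 'rV[R]_d) : R :=
  limn (series (fun n => expR (- lam n * t) * f n x * f n y)).

Definition test_function f (phi : 'rV[R]_d -> R) : Prop :=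
  C0 D phi /\
  forall k : nat,
    (fun n : nat => n.+1%:R ^+ k * `|L2_inner D phi (f n)|) @ \oo --> (0 : R).

Definition inner_alpha (alpha : R) lam f (phi psi : 'rV[R]_d -> R) : R :=
  limn (series (fun n =>
    lam n `^ (- alpha) * L2_inner D phi (f n) * L2_inner D psi (f n))).

(* The complete space H, with inner product ip, is the completion of S(D) under
   inner_alpha, the canonical map being J; only the values of J on S(D)
   matter. *)
Record alpha_completion (alpha : R) lam f (H : completeNormedModType R)
    (ip : H -> H -> R) (J : ('rV[R]_d -> R) -> H) : Prop := AlphaCompletion {
  ip_sym : forall u v, ip u v = ip v u;
  ip_linear : forall a u v w, ip (a *: u + v) w = a * ip u w + ip v w;
  ip_norm : forall u, ip u u = `|u| ^+ 2;
  embedding_linear : forall a phi psi,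
    test_function f phi -> test_function f psi ->
    J (fun x => a * phi x + psi x) = a *: J phi + J psi;
  embedding_isometry : forall phi psi,
    test_function f phi -> test_function f psi ->
    ip (J phi) (J psi) = inner_alpha alpha lam f phi psi;
  embedding_dense : closure (J @` [set phi | test_function f phi]) = setT }.

End dirichlet_laplacian.

(* L^2((0, oo); H), with Bochner (strong) measurability. An element is
   represented by a function on R, whose values outside (0, oo) are
   irrelevant. *)
Section bochner_L2.
Context {R : realType} (H : completeNormedModType R).

Definition simple_map (s : R -> H) : Prop :=
  finite_set (range s) /\
  forall y, measurable (s @^-1` [set y] : set (measurableTypeR R)).

Definition strongly_measurable (A : set R) (h : R -> H) : Prop :=
  exists s : nat -> R -> H, (forall n, simple_map (s n)) /\
    {ae (@lebesgue_measure R), forall t, A t -> s n t @[n --> \oo] --> h t}.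

Definition bochner_L2 (h : R -> H) : Prop :=
  strongly_measurable `]0, +oo[ h /\
  (\int[lebesgue_measure]_(t in `]0%R, +oo[) (`|h t| ^+ 2)%:E < +oo)%E.

End bochner_L2.

Section gaussian.
Context {R : realType} (dO : measure_display) (Omega : measurableType dO)
  (P : probability Omega R).

(* Law N(0, s ^ 2); normal_prob is not the Dirac mass when s = 0. *)
Definition centered_gaussian (X : Omega -> R) : Prop :=
  exists s : R, forall A : set (measurableTypeR R), measurable A ->
    P (X @^-1` A) = if s == 0 then \d_(0 : R) A else normal_prob 0 s A.

Definition isonormal (H : completeNormedModType R) (ip : H -> H -> R)
    (W : (R -> H) -> {RV P >-> R}) : Prop :=
  (forall (n : nat) (h : 'I_n -> R -> H) (c : 'I_n -> R),
     (forall i, bochner_L2 (h i)) ->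
     centered_gaussian (fun w => \sum_(i < n) c i * W (h i) w)) /\
  (forall g h, bochner_L2 g -> bochner_L2 h ->
     ('E_P[W g \* W h] =
      \int[lebesgue_measure]_(s in `]0%R, +oo[) (ip (g s) (h s))%:E)%E).

Definition is_version (d : nat) (D : set 'rV[R]_d)
    (u : R -> 'rV[R]_d -> Omega -> R) (v : R -> 'rV[R]_d -> {RV P >-> R}) :=
  forall t x, 0 <= t -> D x -> {ae P, forall w, v t x w = u t x w}.

Definition locally_holder (d : nat) (D : set 'rV[R]_d)
    (v : R -> 'rV[R]_d -> {RV P >-> R}) (b0 b1 : R) : Prop :=
  {ae P, forall w, forall K : set (R * 'rV[R]_d),
    compact K -> K `<=` [set p | 0 <= p.1 /\ D p.2] ->
    exists C : R, forall t x s y, K (t, x) -> K (s, y) ->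
      `|v t x w - v s y w| <= C * (`|t - s| `^ b0 + enorm (x - y) `^ b1)}.

End gaussian.

Section mild_solution.
Context {R : realType} (d : nat) (lam : nat -> R) (f : nat -> 'rV[R]_d -> R)
  (H : completeNormedModType R) (J : ('rV[R]_d -> R) -> H).

Definition mild_integrand (t : R) (x : 'rV[R]_d) (s : R) : H :=
  if 0 < s < t then J (heat_kernel lam f (t - s) x) else 0.

Definition mild_solution (Omega : Type) (W : (R -> H) -> Omega -> R)
    (t : R) (x : 'rV[R]_d) : Omega -> R :=
  if 0 < t then W (mild_integrand t x) else fun=> 0.

End mild_solution.

(* Main.v *)
(* The variance of a spatial or temporal increment of u is a sum over eigenvalues,
   and everything rests on two spectral bounds obtained with the maximum principle
   only. Let S_L(x) be the sum of f_n(x)^2 over lam_n <= L. A point where S_L is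
   maximal up to a constant factor, deep enough in D, forces the combination
   g = sum f_n(x) f_n to be large on a cube of side L^(-1/2), and comparing with
   |g|^2 in L^2 gives S_L <= C L^(d/2) on compact subsets of D; barriers near the
   C^2 boundary keep the global maximum of S_L at distance c/(1 + L) from the
   boundary, whence S_L <= C (1 + L)^d on D. The same duality combined with the
   interior gradient estimate bounds the spectral sums of (f_n(x) - f_n(y))^2 by
   C L^(d/2+1) |x - y|^2. Summing over dyadic blocks of eigenvalues yields
   E|u(t,x) - u(s,y)|^2 <= C (|t - s|^g + |x - y|^(2g)) for every g < theta /\ 1,
   locally in D. Kolmogorov's chaining along dyadic grids (mesh 4^-n in time, 2^-n
   in space), with Gaussian tails and the Borel-Cantelli lemma, then produces the
   version as the almost sure limit of u along the grids. *)

From HB Require Import structures.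
Require Import Defs.
From mathcomp Require Import all_boot all_order all_algebra.
From mathcomp Require Import ring lra zify.
From mathcomp Require Import all_classical all_reals all_analysis.
From mathcomp Require Import measurable_realfun.

Set Implicit Arguments.
Unset Strict Implicit.
Unset Printing Implicit Defensive.
Import Order.TTheory GRing.Theory Num.Theory.
Import numFieldNormedType.Exports.
Local Open Scope classical_set_scope.
Local Open Scope ring_scope.

(** * Functions of class C^2 *)

(** The eigenfunctions are only known to be continuous, and C^2 inside D, so one duality stands in
    for Sobolev and heat kernel theory. For g = sum f_n(x) f_n, orthonormality makes the squared
    norm of g equal to g(x) = S_L(x), and Cauchy-Schwarz bounds g and its Laplacian by multiples of
    S_L(x) near a maximum of S_L; since g stays comparable to g(x) on a whole cube, its norm caps
    S_L(x). The crude bound (1 + L)^d up to the boundary serves to make lam_n grow at least like a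
    power of n and f_n at most polynomially in lam_n: then the heat kernel lies in S(D), the only
    place where the map J is controlled. The exponents come from the local bounds alone: the noise
    contributes lam_n^(-alpha), time integration 1/lam_n, and the sum of lam_n^(-p) f_n(x)^2 is
    locally bounded for p > d/2, so spending g powers of lam_n on an increment requires g < theta.
    Since the version precedes the choice of exponents, a sequence of exponents increasing to theta
    /\ 1 shares one null set. *)

Lemma derivable_line (R : realType) (V : normedModType R) (g : V -> R) (x v : V)
    (s : R) :
  derivable g (x + s *: v) v ->
  is_derive s 1 (fun r : R => g (x + r *: v)) ('D_v g (x + s *: v)).
Proof.
have E : (fun h : R => h^-1 *: (((fun r : R => g (x + r *: v)) \o shift s) (h *: (1:R)) -
      g (x + s *: v))) =
    (fun h => h^-1 *: ((g \o shift (x + s *: v)) (h *: v) - g (x + s *: v))).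
  apply/funext => h /=; congr (_ *: (g _ - _)).
  by rewrite /GRing.scale/= mulr1 -/(GRing.scale _ _) scalerDl addrCA addrA.
move=> dg; apply: DeriveDef; first by rewrite /derivable E.
by rewrite /derive E.
Qed.

Lemma cvg_sumr (R : realType) (T I : Type) (F : set_system T) (r : seq I)
    (P : pred I) (f : I -> T -> R) (a : I -> R) : Filter F ->
  (forall i, P i -> f i x @[x --> F] --> a i) ->
  \sum_(i <- r | P i) f i x @[x --> F] --> \sum_(i <- r | P i) a i.
Proof. by move=> FF; apply: cvg_big; exact: add_continuous. Qed.

Section second_differences.
Context {R : realType}.

Lemma coord_le_norm n (x : 'rV[R]_n) i : `|x ord0 i| <= `|x|.
Proof.
rewrite [leRHS]/Num.norm/= mx_normrE; apply/bigmax_geP; right => /=.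
by exists (ord0, i).
Qed.

Lemma row_norm_le n (x : 'rV[R]_n) (c : R) :
  0 <= c -> (forall i, `|x ord0 i| <= c) -> `|x| <= c.
Proof.
move=> c0 xc; rewrite [leLHS]/Num.norm/= mx_normrE; apply/bigmax_leP; split => //.
by case=> i j _ /=; rewrite ord1.
Qed.

Definition unit_row n (j : 'I_n) : 'rV[R]_n := delta_mx ord0 j.

Lemma unit_rowE n (j k : 'I_n) : unit_row j ord0 k = (k == j)%:R.
Proof. by rewrite mxE eqxx. Qed.

Lemma norm_unit_row n (j : 'I_n) : `|unit_row j| = 1.
Proof.
apply/eqP; rewrite eq_le; apply/andP; split.
  by apply: row_norm_le => // i; rewrite unit_rowE; case: eqP; rewrite ?normr1 ?normr0.
by have := coord_le_norm (unit_row j) j; rewrite unit_rowE eqxx normr1.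
Qed.

Lemma norm_scale_unit_row n (j : 'I_n) (t : R) : `|t *: unit_row j| = `|t|.
Proof. by rewrite normrZ norm_unit_row mulr1. Qed.

Lemma nbhs_row_cube n (U : set 'rV[R]_n) (x : 'rV[R]_n) :
  nbhs x U -> exists2 r : R, 0 < r & forall y : 'rV[R]_n, `|y - x| < r -> U y.
Proof.
move=> /nbhs_ballP[r /= r0 rU]; exists r => // y yx; apply: rU.
by rewrite -ball_normE /ball_/= distrC.
Qed.

(* Two applications of the mean value theorem to
   s |-> g(x + s e_j) + g(x - s e_j) - 2 g(x) - s^2 c. *)
Lemma second_difference n (U : set 'rV[R]_n) (g : 'rV[R]_n -> R) (x0 : 'rV[R]_n)
    (j : 'I_n) (eps : R) :
  open U -> C2_on U g -> U x0 -> 0 < eps ->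
  exists2 rho : R, 0 < rho & forall (x : 'rV[R]_n) (t : R), `|x - x0| < rho -> `|t| < rho ->
    `|g (x + t *: unit_row j) + g (x - t *: unit_row j) - 2 * g x -
      t ^+ 2 * partial j (partial j g) x0| <= eps * t ^+ 2.
Proof.
move=> oU gU Ux0 eps0; set c := partial j (partial j g) x0.
have [r1 r10 r1U] : exists2 r : R, 0 < r & forall y : 'rV[R]_n, `|y - x0| < r -> U y.
  by apply: nbhs_row_cube; exact: open_nbhs_nbhs.
have [r2 r20 r2c] : exists2 r : R, 0 < r & forall y : 'rV[R]_n, `|y - x0| < r ->
    `|partial j (partial j g) y - c| < eps / 2.
  have eps20 : 0 < eps / 2 by rewrite divr_gt0.
  have [_ _ /(_ j j)[_ /cvgrPdist_lt/(_ _ eps20) H]] := gU _ Ux0.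
  have [r r0 rH] := nbhs_row_cube H; exists r; first exact: r0.
  by move=> y yr; rewrite distrC; exact: (rH y yr).
(* Halved because x + r e_j, with x within rho of x0 and |r| < rho, may be almost 2 rho away from
   x0. *)
pose rho := Num.min r1 r2 / 2.
have rho0 : 0 < rho by rewrite divr_gt0// lt_min r10.
have rr1 : rho + rho <= r1 by rewrite -mulr2n -[_ *+ 2]mulr_natr divfK// ge_min lexx.
have rr2 : rho + rho <= r2 by rewrite -mulr2n -[_ *+ 2]mulr_natr divfK// ge_min lexx orbT.
exists rho => // x t xx0.
pose F (s : R) := g (x + s *: unit_row j) + g (x - s *: unit_row j) - 2 * g x - s ^+ 2 * c.
rewrite -/(F t).
(* F is even and vanishes at 0, so positive increments suffice. *)
suff key (s : R) : 0 < s -> s < rho -> `|F s| <= eps * s ^+ 2.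
  have [t0|t0|->] := ltgtP t 0.
  - rewrite ltr0_norm// => trho; have := key (- t); rewrite oppr_gt0 => /(_ t0 trho).
    rewrite sqrrN /F scaleNr sqrrN opprK [X in X - _ - _]addrC.
    exact.
  - by rewrite gtr0_norm//; exact: key.
  - move=> _; rewrite /F scale0r addr0 subr0 expr0n/= mul0r mulr0 subr0.
    by rewrite -mulr2n mulr_natl subrr normr0.
move=> s0 srho.
have near_x0 (r : R) : `|r| <= s -> `|x + r *: unit_row j - x0| < rho + rho.
  move=> rs; rewrite addrAC (le_lt_trans (ler_normD _ _))// ltrD//.
  by rewrite norm_scale_unit_row (le_lt_trans rs).
have Ux (r : R) : `|r| <= s -> U (x + r *: unit_row j).
  by move=> /near_x0 rs; apply: r1U; exact: lt_le_trans rr1.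
pose k1 (r : R) := partial j g (x + r *: unit_row j).
pose k2 (r : R) := partial j (partial j g) (x + r *: unit_row j).
have dk (r : R) : `|r| <= s -> is_derive r 1 (fun r : R => g (x + r *: unit_row j)) (k1 r).
  by move=> rs; apply: derivable_line; have [_ /(_ j)[]] := gU _ (Ux _ rs).
have dk1 (r : R) : `|r| <= s -> is_derive r 1 k1 (k2 r).
  move=> rs; apply: derivable_line.
  by have [_ _ /(_ j j)[]] := gU _ (Ux _ rs).
have dopp (h : R -> R) (dh : R) (r : R) : is_derive (- r) 1 h dh -> is_derive r 1 (h \o -%R) (- dh).
  by move=> H; rewrite -mulrN1; exact: is_derive1_comp H (is_deriveNid _ _).
have dF (r : R) : `|r| <= s -> is_derive r 1 F (k1 r - k1 (- r) - 2 * r * c).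
  move=> rs; have rs' : `|- r| <= s by rewrite normrN.
  have H1 := dk _ rs; have H2 := dopp _ _ _ (dk _ rs').
  have -> : F = (fun r : R => g (x + r *: unit_row j)) +
      ((fun r : R => g (x + r *: unit_row j)) \o -%R) - cst (2 * g x) - c \*: (@id R) ^+ 2.
    apply/funext => y; rewrite /F !fctE/= scaleNr; congr (_ - _).
    by rewrite mulrC.
  apply: is_derive_eq.
  by rewrite subr0 expr1 /GRing.scale/= mulr1; ring.
have [||tau tau0s FE] := @MVT R F (fun r => k1 r - k1 (- r) - 2 * r * c) 0 s s0.
- by move=> y; rewrite in_itv/= => /andP[y0 ys]; apply: dF; rewrite ger0_norm ltW.
- apply: derivable_within_continuous => y; rewrite in_itv/= => /andP[y0 ys].
  by have [] := dF y _; rewrite ?ger0_norm.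
move: tau0s; rewrite in_itv/= => /andP[tau0 taus].
have F0 : F 0 = 0.
  rewrite /F scale0r addr0 subr0 expr0n/= mul0r subr0.
  by rewrite -mulr2n mulr_natl subrr.
have tau2 : - tau < tau by rewrite gtrN.
(* The derivative of F at tau contains k1 tau - k1 (- tau), hence the symmetric interval, which
   produces the factor 2 tau. *)
have [||xi xitau kE] := @MVT R k1 k2 (- tau) tau tau2.
- move=> y; rewrite in_itv/= => /andP[y0 ys]; apply: dk1.
  by rewrite (le_trans _ (ltW taus))// ler_norml !ltW.
- apply: derivable_within_continuous => y; rewrite in_itv/= => /andP[y0 ys].
  have ys' : `|y| <= s by rewrite (le_trans _ (ltW taus))// ler_norml y0.
  by have [] := dk1 y ys'.
move: xitau; rewrite in_itv/= => /andP[xi0 xis].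
have xin : `|xi| <= s by rewrite (le_trans _ (ltW taus))// ler_norml !ltW.
move: FE; rewrite F0 !subr0 => ->; rewrite kE.
have -> : (k2 xi * (tau - - tau) - 2 * tau * c) * s = 2 * tau * s * (k2 xi - c) by ring.
have ts0 : 0 <= 2 * tau * s by rewrite !mulr_ge0// ltW.
rewrite normrM (ger0_norm ts0).
have /ltW H := r2c _ (lt_le_trans (near_x0 _ xin) rr2).
apply: (le_trans (ler_wpM2l ts0 H)).
have -> : 2 * tau * s * (eps / 2) = eps * (tau * s) by field.
by rewrite ler_wpM2l ?(ltW eps0)// expr2 ler_wpM2r// ltW.
Qed.

End second_differences.

Section C2_functions.
Context {R : realType} {n : nat}.
Implicit Types (U : set 'rV[R]_n) (g h : 'rV[R]_n -> R).

Lemma partial_lin U g h (a : R) (i : 'I_n) x :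
  C2_on U g -> C2_on U h -> U x ->
  derivable (fun y => a * g y + h y) x (unit_row i : 'rV[R]_n) /\
  partial i (fun y => a * g y + h y) x = a * partial i g x + partial i h x.
Proof.
move=> gU hU Ux.
have [_ /(_ i)[dg _] _] := gU x Ux; have [_ /(_ i)[dh _] _] := hU x Ux.
have -> : (fun y => a * g y + h y) = a \*: g + h by [].
have dag := derivableZ (k := a) dg.
split; first exact: derivableD dag dh.
by rewrite /partial (deriveD dag dh) (deriveZ a dg).
Qed.

(** The formula for the first partial holds on U only, so the second one goes through equality near
    x. *)
Lemma partial2_lin U g h (a : R) (i j : 'I_n) x : open U ->
  C2_on U g -> C2_on U h -> U x ->
  derivable (partial i (fun y => a * g y + h y)) x (unit_row j : 'rV[R]_n) /\
  partial j (partial i (fun y => a * g y + h y)) x =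
    a * partial j (partial i g) x + partial j (partial i h) x.
Proof.
move=> oU gU hU Ux.
have [_ _ /(_ i j)[dg _]] := gU x Ux; have [_ _ /(_ i j)[dh _]] := hU x Ux.
have E : {near x, a \*: partial i g + partial i h =1
    partial i (fun y => a * g y + h y)}.
  near=> y; rewrite (partial_lin a i gU hU _).2//.
  by near: y; exact: open_nbhs_nbhs.
have dag := derivableZ (k := a) dg.
have d : derivable (a \*: partial i g + partial i h) x (unit_row j : 'rV[R]_n).
  exact: derivableD dag dh.
split; first exact: near_eq_derivable E d.
by rewrite [LHS]/partial -(near_eq_derive _ E) (deriveD dag dh) (deriveZ a dg).
Unshelve. all: by end_near. Qed.

Lemma C2_on_lin U g h (a : R) : open U ->
  C2_on U g -> C2_on U h -> C2_on U (fun y => a * g y + h y).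
Proof.
move=> oU gU hU x Ux; have [cg dg ddg] := gU x Ux; have [ch dh ddh] := hU x Ux.
have UN : \forall y \near x, U y by exact: open_nbhs_nbhs.
split.
- exact: cvgD (cvgM (cvg_cst a) cg) ch.
- move=> i; split; first exact: (partial_lin a i gU hU Ux).1.
  rewrite /prop_for /continuous_at (partial_lin a i gU hU Ux).2.
  have E : {near x, (fun y => a * partial i g y + partial i h y) =1
      partial i (fun y => a * g y + h y)}.
    by near=> y; rewrite (partial_lin a i gU hU _).2//; near: y.
  apply: cvg_trans (near_eq_cvg E) _.
  exact: cvgD (cvgM (cvg_cst a) (dg i).2) (dh i).2.
- move=> i j; split; first exact: (partial2_lin a i j oU gU hU Ux).1.
  rewrite /prop_for /continuous_at (partial2_lin a i j oU gU hU Ux).2.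
  have E : {near x, (fun y => a * partial j (partial i g) y + partial j (partial i h) y) =1
      partial j (partial i (fun y => a * g y + h y))}.
    by near=> y; rewrite (partial2_lin a i j oU gU hU _).2//; near: y.
  apply: cvg_trans (near_eq_cvg E) _.
  exact: cvgD (cvgM (cvg_cst a) (ddg i j).2) (ddh i j).2.
Unshelve. all: by end_near. Qed.

Lemma laplacian_lin U g h (a : R) x : open U ->
  C2_on U g -> C2_on U h -> U x ->
  laplacian (fun y => a * g y + h y) x = a * laplacian g x + laplacian h x.
Proof.
move=> oU gU hU Ux; rewrite /laplacian mulr_sumr -big_split/=.
by apply: eq_bigr => i _; rewrite (partial2_lin a i i oU gU hU Ux).2.
Qed.

Lemma partial_cst (i : 'I_n) (b : R) :
  partial i (fun _ : 'rV[R]_n => b) = (fun=> 0).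
Proof. by apply/funext => y; rewrite /partial derive_cst. Qed.

Lemma C2_on_cst U (c : R) : C2_on U (fun=> c).
Proof.
move=> x _; split; first exact: cst_continuous.
  by move=> i; rewrite partial_cst; split; [exact: derivable_cst|exact: cst_continuous].
move=> i j; rewrite !partial_cst.
by split; [exact: derivable_cst|exact: cst_continuous].
Qed.

Lemma laplacian_cst (c : R) x : laplacian (fun _ : 'rV[R]_n => c) x = 0.
Proof. by rewrite /laplacian big1// => i _; rewrite !partial_cst. Qed.

Lemma C2_on_sum U (I : Type) (r : seq I) (c : I -> R) (g : I -> 'rV[R]_n -> R) :
  open U -> (forall i, C2_on U (g i)) ->
  C2_on U (fun x => \sum_(i <- r) c i * g i x) /\
  forall x, U x -> laplacian (fun x => \sum_(i <- r) c i * g i x) x =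
    \sum_(i <- r) c i * laplacian (g i) x.
Proof.
move=> oU gU; elim: r => [|i r [IH1 IH2]].
  have -> : (fun x => \sum_(i <- [::]) c i * g i x) = fun=> 0.
    by apply/funext => x; rewrite big_nil.
  by split; [exact: C2_on_cst|move=> x _; rewrite laplacian_cst big_nil].
have -> : (fun x => \sum_(i <- i :: r) c i * g i x) =
    (fun x => c i * g i x + \sum_(i <- r) c i * g i x).
  by apply/funext => x; rewrite big_cons.
split; first exact: (@C2_on_lin U (g i) _ (c i) oU (gU i) IH1).
move=> x Ux.
by rewrite (@laplacian_lin U (g i) _ (c i) x oU (gU i) IH1 Ux) big_cons IH2.
Qed.

(** The form in which C^2 regularity enters each maximum principle below: at an interior maximum the
    sum of second differences is nonpositive for small t, and the barriers, whose second differences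
    are computed by hand, never have to be differentiated. *)
Lemma laplacian_expansion U g x (eps : R) : open U -> C2_on U g -> U x ->
  0 < eps -> \forall t \near (0 : R)^'+,
  `|\sum_(j < n) (g (x + t *: unit_row j) + g (x - t *: unit_row j) - 2 * g x) -
    t ^+ 2 * laplacian g x| <= eps * t ^+ 2.
Proof.
(* Dividing by n + 1 makes n errors add up to at most eps, also for n = 0. *)
move=> oU gU Ux eps0; pose e := eps / n.+1%:R.
have e0 : 0 < e by rewrite divr_gt0.
have : \forall t \near (0 : R)^'+, forall j : 'I_n,
    `|g (x + t *: unit_row j) + g (x - t *: unit_row j) - 2 * g x -
      t ^+ 2 * partial j (partial j g) x| <= e * t ^+ 2.
  apply: filter_forall => j.
  have [rho rho0 H] := second_difference j oU gU Ux e0.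
  near=> t; apply: H; first by rewrite subrr normr0.
  by rewrite gtr0_norm.
apply: filterS => t tH; rewrite /laplacian mulr_sumr -sumrB.
apply: le_trans (ler_norm_sum _ _ _) _.
apply: le_trans (ler_sum _ (fun i _ => tH i)) _.
rewrite sumr_const card_ord -mulrnAl ler_wpM2r ?sqr_ge0// /e -mulr_natr.
by rewrite -mulrA ger_pMr// ler_pdivrMl// mulr1 ler_nat.
Unshelve. all: by end_near. Qed.

End C2_functions.

Section cube_estimate.
Context {R : realType} {n : nat}.
Implicit Types (U : set 'rV[R]_n) (g : 'rV[R]_n -> R).

Lemma move_coordE (x : 'rV[R]_n) (j k : 'I_n) (t : R) :
  (x + t *: unit_row j) ord0 k = x ord0 k + t * (k == j)%:R.
Proof. by rewrite !mxE eqxx. Qed.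

Lemma separable_second_difference (p : 'I_n -> R -> R) (x : 'rV[R]_n) (j : 'I_n) (t : R) :
  let psi (y : 'rV[R]_n) := \sum_k p k (y ord0 k) in
  psi (x + t *: unit_row j) + psi (x - t *: unit_row j) - 2 * psi x =
  p j (x ord0 j + t) + p j (x ord0 j - t) - 2 * p j (x ord0 j).
Proof.
move=> psi.
have key r : psi (x + r *: unit_row j) = p j (x ord0 j + r) +
    \sum_(k < n | k != j) p k (x ord0 k).
  rewrite /psi (bigD1 j)//= move_coordE eqxx mulr1; congr (_ + _).
  by apply: eq_bigr => k kj; rewrite move_coordE (negPf kj) mulr0 addr0.
rewrite -scaleNr !key [psi x](bigD1 j)//=; ring.
Qed.

End cube_estimate.

(** * Interior gradient estimate *)

Section cube_estimate.
Context {R : realType} {n : nat}.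
Implicit Types (U : set 'rV[R]_n) (g : 'rV[R]_n -> R).

Lemma ord_natr_ge1 (i : 'I_n) : 1 <= n%:R :> R.
Proof. by rewrite ler1n; case: n i => // -[]. Qed.

Lemma compact_row_box (lo hi : 'I_n -> R) :
  compact [set x : 'rV[R]_n | forall k, lo k <= x ord0 k <= hi k].
Proof.
have := @rV_compact R n (fun k => `[lo k, hi k]%classic)
  (fun k => @segment_compact _ _ _).
congr compact; apply/seteqP; split => x /= H k; have := H k; by rewrite in_itv.
Qed.

Lemma row_cubeP (x y : 'rV[R]_n) (r : R) : 0 <= r ->
  `|y - x| <= r <-> forall k, `|y ord0 k - x ord0 k| <= r.
Proof.
have E k : (y - x) ord0 k = y ord0 k - x ord0 k by rewrite !mxE.
move=> r0; split=> [yx k|H].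
  by have := coord_le_norm (y - x) k; rewrite E => /le_trans; apply.
by apply: row_norm_le => // k; rewrite E.
Qed.

Lemma compact_row_cube (x : 'rV[R]_n) (r : R) : 0 <= r ->
  compact [set y : 'rV[R]_n | `|y - x| <= r].
Proof.
move=> r0; have := @compact_row_box (fun k => x ord0 k - r) (fun k => x ord0 k + r).
congr compact; apply/seteqP; split => y /=.
  by move=> H; apply/row_cubeP => // k; rewrite ler_distl.
by move=> /(row_cubeP _ _ r0) H k; have := H k; rewrite ler_distl.
Qed.

Section barrier.
Variables (a M N : R) (i : 'I_n) (x0 : 'rV[R]_n).
Hypotheses (a0 : 0 < a) (M0 : 0 <= M) (N0 : 0 <= N).

(** In the variable w = y - x0 the concave part in w_i has coefficient n - 1, which cancels the n -
    1 convex squares, so the whole has Laplacian -N. It is at least M on the faces |w_k| = a and w_i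
    = a, nonnegative on w_i = 0, and its slope there along the i-th axis through x0 is n M / a + N a
    / 2, the gradient bound to be proved. *)
Definition cube_barrier1 (k : 'I_n) (v : R) : R := let w := v - x0 ord0 k in
  if k == i then M / a ^+ 2 * (w * (n%:R * a - (n%:R - 1) * w)) + N * (w * (a - w)) / 2
  else M / a ^+ 2 * w ^+ 2.

Definition cube_barrier (y : 'rV[R]_n) := \sum_k cube_barrier1 k (y ord0 k).


Lemma continuous_cube_barrier : continuous cube_barrier.
Proof.
have cp k : continuous (cube_barrier1 k).
  have cw : continuous (fun v : R => v - x0 ord0 k).
    by move=> v; apply: cvgB; [exact: cvg_id|exact: cvg_cst].
  move=> v; rewrite /cube_barrier1; case: (boolP (k == i)) => _ /=.
    have c1 : (fun v => n%:R * a - (n%:R - 1) * (v - x0 ord0 k)) y @[y --> v] -->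
        n%:R * a - (n%:R - 1) * (v - x0 ord0 k).
      exact: cvgB (cvg_cst _) (cvgM (cvg_cst _) (cw v)).
    have c2 : (fun v => a - (v - x0 ord0 k)) y @[y --> v] --> a - (v - x0 ord0 k).
      exact: cvgB (cvg_cst _) (cw v).
    exact: cvgD (cvgM (cvg_cst _) (cvgM (cw v) c1))
      (cvgM (cvgM (cvg_cst _) (cvgM (cw v) c2)) (cvg_cst _)).
  exact: cvgM (cvg_cst _) (cvgM (cw v) (cw v)).
move=> y; apply: (@cvg_sumr R _ _ (nbhs y)) => k _.
apply: (@continuous_comp _ _ _ (fun z : 'rV[R]_n => z ord0 k) (cube_barrier1 k)).
  exact: coord_continuous.
exact: cp.
Qed.

Lemma cube_barrier1_ge0 k v : `|v - x0 ord0 k| <= a ->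
  (k = i -> x0 ord0 i <= v) -> 0 <= cube_barrier1 k v.
Proof.
rewrite /cube_barrier1 ler_norml => /andP[_ wa] wi; case: eqP => [ki|_].
  have w0 : 0 <= v - x0 ord0 k by rewrite ki subr_ge0 wi.
  have n1 := ord_natr_ge1 i.
  have H : (n%:R - 1) * (v - x0 ord0 k) <= n%:R * a.
    apply: (@le_trans _ _ ((n%:R - 1) * a)); first by rewrite ler_wpM2l ?subr_ge0.
    by rewrite ler_wpM2r ?(ltW a0)// gerBl.
  have a2 : 0 <= M / a ^+ 2 by rewrite divr_ge0 ?exprn_ge0 ?(ltW a0).
  apply: addr_ge0; first by rewrite mulr_ge0// mulr_ge0// subr_ge0.
  by rewrite divr_ge0// mulr_ge0// mulr_ge0// subr_ge0.
apply: mulr_ge0; last exact: sqr_ge0.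
by rewrite divr_ge0// exprn_ge0// ltW.
Qed.

Lemma cube_barrier_ge1 (y : 'rV[R]_n) k : `|y - x0| <= a -> x0 ord0 i <= y ord0 i ->
  cube_barrier1 k (y ord0 k) <= cube_barrier y.
Proof.
move=> /(row_cubeP _ _ (ltW a0)) ya yi; rewrite /cube_barrier (bigD1 k)//= lerDl.
apply: sumr_ge0 => j _; apply: cube_barrier1_ge0 => [|->//]; exact: ya.
Qed.

(** The barrier is quadratic, so its second differences carry no error term. *)
Lemma cube_barrier_laplacian (y : 'rV[R]_n) (t : R) :
  \sum_(j < n) (cube_barrier (y + t *: unit_row j) +
    cube_barrier (y - t *: unit_row j) - 2 * cube_barrier y) = - N * t ^+ 2.
Proof.
under eq_bigr do rewrite separable_second_difference.
rewrite (bigD1 i)//= (eq_bigr (fun=> M / a ^+ 2 * 2 * t ^+ 2)); last first.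
  by move=> j ji; rewrite /cube_barrier1 (negPf ji); ring.
have nE : n.-1%:R = n%:R - 1 :> R.
  by case: n i => [[]//|m _]; rewrite -natr1 addrK.
rewrite sumr_const cardC1 card_ord -[_ *+ n.-1]mulr_natr nE.
by rewrite /cube_barrier1 eqxx; field; rewrite gt_eqF.
Qed.

End barrier.

Definition reflect (x0 : 'rV[R]_n) (i : 'I_n) (y : 'rV[R]_n) : 'rV[R]_n :=
  y - (2 * (y ord0 i - x0 ord0 i)) *: unit_row i.

Lemma reflect_coordE x0 i y k : reflect x0 i y ord0 k =
  if k == i then 2 * x0 ord0 i - y ord0 i else y ord0 k.
Proof.
rewrite /reflect -scaleNr move_coordE; case: eqP => [->|_]; first by rewrite mulr1; ring.
by rewrite mulr0 addr0.
Qed.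

Lemma reflect_move x0 i y j (t : R) : reflect x0 i (y + t *: unit_row j) =
  reflect x0 i y + (if j == i then - t else t) *: unit_row j.
Proof.
apply/rowP => k; rewrite move_coordE !reflect_coordE !move_coordE.
case: (eqVneq k i) => [->|ki].
  by rewrite (eq_sym i j); case: (eqVneq j i) => _; rewrite ?mulr1 ?mulr0; ring.
by case: (eqVneq j i) => [->|//]; rewrite (negPf ki) !mulr0.
Qed.

Lemma continuous_reflect x0 i : continuous (reflect x0 i).
Proof.
have c0 : continuous (fun y : 'rV[R]_n => y ord0 i) by exact: coord_continuous.
move=> y; have c1 : (fun y : 'rV[R]_n => 2 * (y ord0 i - x0 ord0 i)) z @[z --> y] -->
    2 * (y ord0 i - x0 ord0 i).
  exact: cvgM (cvg_cst _) (cvgB (c0 y) (cvg_cst _)).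
apply: (@cvgB _ _ _ (nbhs y)); first exact: cvg_id.
exact: cvgZr_tmp.
Qed.

Lemma barrier_gap (u v N : R) :
  `|u| < N -> `|v| < N -> 0 < (u - v + 2 * N) / 4.
Proof. by rewrite !ltr_norml => /andP[? ?] /andP[? ?]; lra. Qed.

(** Here (A - B) / 2 is the second difference of the odd part of g. By the choice of eps, T (l1 -
    l2) / 2 = 2 eps T - N T, and the two expansion errors cost eps T together, so eps T is left;
    [barrier_gap] is where the strict bounds by N enter. *)
Lemma barrier_contradiction (A B l1 l2 N T : R) :
  let eps := (l1 - l2 + 2 * N) / 4 in 0 < eps -> 0 < T ->
  `|A - T * l1| <= eps * T -> `|B - T * l2| <= eps * T ->
  0 < (A - B) / 2 - - N * T.
Proof.
move=> eps eps0 T0; have : 0 < eps * T by rewrite mulr_gt0.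
have -> : eps * T = (T * l1 - T * l2 + 2 * (N * T)) / 4 by rewrite /eps; field.
rewrite mulNr !ler_norml => h /andP[h1 h2] /andP[h3 h4]; lra.
Qed.

(* Gilbarg-Trudinger, section 3.4: the odd part of g in the i-th variable is
   compared on a half cube with an explicit quadratic supersolution. *)
Lemma cube_difference U g (x0 : 'rV[R]_n) (i : 'I_n) (a M N s : R) :
  open U -> C2_on U g -> continuous g -> 0 < a ->
  (forall y, `|y - x0| <= a -> [/\ U y, `|g y| <= M & `|laplacian g y| < N]) ->
  0 <= s <= a ->
  g (x0 + s *: unit_row i) - g (x0 - s *: unit_row i) <=
    2 * (s * (n%:R * M / a + N * a / 2)).
Proof.
move=> oU gU cg a0 Ha /andP[s0 sa].
have Hx0 : `|x0 - x0| <= a by rewrite subrr normr0 ltW.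
have M0 : 0 <= M by have [_ + _] := Ha _ Hx0; exact: le_trans.
have N0 : 0 < N by have [_ _] := Ha _ Hx0; exact: le_lt_trans.
pose psi := cube_barrier a M N i x0.
pose F y := (g y - g (reflect x0 i y)) / 2 - psi y.
have cF : continuous F.
  have cgr : continuous (g \o reflect x0 i).
    by move=> y; apply: continuous_comp; [exact: continuous_reflect|exact: cg].
  have cpsi : continuous psi by exact: continuous_cube_barrier.
  move=> y; exact: cvgB (cvgM (cvgB (cg y) (cgr y)) (cvg_cst _)) (cpsi y).
(* The half cube on the side y_i >= x0_i; the reflection sends it to the other half. *)
pose Q := [set y : 'rV[R]_n | forall k,
  (if k == i then x0 ord0 i else x0 ord0 k - a) <= y ord0 k <= x0 ord0 k + a].
have QE y : Q y <-> `|y - x0| <= a /\ x0 ord0 i <= y ord0 i.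
  split => [Qy|[/(row_cubeP _ _ (ltW a0)) H H'] k].
    split; last by have /andP[] := Qy i; rewrite eqxx.
    apply/row_cubeP => [|k]; first exact: ltW.
    rewrite ler_distl; have := Qy k; case: (eqVneq k i) => [->|_]//.
    by move=> /andP[+ ->]; rewrite andbT; apply: le_trans; rewrite gerBl ltW.
  have := H k; rewrite ler_distl; case: (eqVneq k i) => [->|_]//.
  by rewrite H' => /andP[].
have Qsg y : Q y -> `|reflect x0 i y - x0| <= a.
  move=> /QE[/(row_cubeP _ _ (ltW a0)) H _]; apply/row_cubeP => [|k]; first exact: ltW.
  rewrite reflect_coordE; case: (eqVneq k i) => [->|_//].
  by have := H i; rewrite -normrN; congr (`|_| <= a); ring.
have cQ : compact Q by exact: compact_row_box.
have Qx0 : Q x0 by apply/QE.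
have [c] : exists2 c, c \in Q & forall y, y \in Q -> F y <= F c.
  by apply: compact_EVT_max => //; [exists x0|exact: continuous_subspaceT].
rewrite inE => Qc Fc; have {}Fc y : Q y -> F y <= F c by move=> ?; apply: Fc; rewrite inE.
(* At x0 + s e_i, whose reflection is x0 - s e_i, F <= 0 is the claim once the quadratic terms of
   the barrier in s are dropped. *)
suff Fc0 : F c <= 0.
  have Qs : Q (x0 + s *: unit_row i).
    apply/QE; split; last by rewrite move_coordE eqxx mulr1 lerDl.
    by rewrite addrC addKr norm_scale_unit_row ger0_norm.
  have := le_trans (Fc _ Qs) Fc0.
  have sgE : reflect x0 i (x0 + s *: unit_row i) = x0 - s *: unit_row i.
    by rewrite reflect_move eqxx /reflect subrr mulr0 scale0r subr0 scaleNr.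
  rewrite /F sgE subr_le0 ler_pdivrMr// => /le_trans; apply.
  rewrite mulrC ler_pM2l// /psi /cube_barrier (bigD1 i)//= big1 ?addr0; last first.
    move=> k ki; rewrite /cube_barrier1 move_coordE (negPf ki) mulr0 addr0 subrr.
    by rewrite expr0n mulr0.
  rewrite /cube_barrier1 move_coordE !eqxx mulr1.
  have -> : x0 ord0 i + s - x0 ord0 i = s by ring.
  have n1 := ord_natr_ge1 i.
  rewrite -subr_ge0; have -> : s * (n%:R * M / a + N * a / 2) -
    (M / a ^+ 2 * (s * (n%:R * a - (n%:R - 1) * s)) + N * (s * (a - s)) / 2) =
    M / a ^+ 2 * ((n%:R - 1) * s ^+ 2) + N * s ^+ 2 / 2.
    by field; rewrite gt_eqF.
  have a2 : 0 <= M / a ^+ 2 by rewrite divr_ge0 ?exprn_ge0 ?(ltW a0).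
  apply: addr_ge0; first by rewrite mulr_ge0// mulr_ge0 ?subr_ge0// sqr_ge0.
  by rewrite divr_ge0// mulr_ge0 ?(ltW N0)// sqr_ge0.
rewrite leNgt; apply/negP => Fc0.
(* A positive maximum is interior: psi c < M excludes the outer faces, and on the face fixed by the
   reflection the odd part vanishes, so that F <= 0 there. *)
have [ca ci] := (QE c).1 Qc.
have [Uc gcM lc] := Ha _ ca; have [Us gsM ls] := Ha _ (Qsg _ Qc).
have FM : F c <= M - psi c.
  rewrite /F lerB// ler_pdivrMr// mulr_natr mulr2n lerD//.
    exact: le_trans (ler_norm _) gcM.
  by rewrite -normrN in gsM; exact: le_trans (ler_norm _) gsM.
have psiltM k : cube_barrier1 a M N i x0 k (c ord0 k) < M.
  have := cube_barrier_ge1 a0 M0 (ltW N0) k ca ci; rewrite -/psi => /le_lt_trans; apply.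
  by rewrite -subr_gt0; exact: lt_le_trans FM.
have ci0 : x0 ord0 i < c ord0 i.
  rewrite lt_neqAle ci andbT; apply/negP => /eqP E; move: Fc0.
  rewrite /F /reflect -E subrr mulr0 scale0r subr0 subrr mul0r sub0r oppr_gt0.
  rewrite ltNge => /negP; apply.
  apply: le_trans (cube_barrier_ge1 a0 M0 (ltW N0) i ca ci).
  apply: (cube_barrier1_ge0 a0 M0 (ltW N0)) => //.
  exact: (row_cubeP x0 c (ltW a0)).1 ca i.
have cin k : `|c ord0 k - x0 ord0 k| < a.
  have := (row_cubeP x0 c (ltW a0)).1 ca k.
  rewrite le_eqVlt => /orP[/eqP E|//]; exfalso.
  have := psiltM k; rewrite ltNge => /negP; apply; rewrite /cube_barrier1.
  case: (eqVneq k i) => [ki|_].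
    move: E; rewrite ki ger0_norm ?subr_ge0// => ->.
    rewrite subrr !mulr0 mul0r addr0 -mulrBl opprB addrC subrK mul1r.
    by rewrite -expr2 divfK// gt_eqF// exprn_gt0.
  by rewrite -(real_normK (num_real (c ord0 k - x0 ord0 k))) E divfK// gt_eqF// exprn_gt0.
set l1 := laplacian g c in lc; set l2 := laplacian g (reflect x0 i c) in ls.
pose eps := (l1 - l2 + 2 * N) / 4.
have eps0 : 0 < eps.
  exact: barrier_gap lc ls.
have e1 := laplacian_expansion oU gU Uc eps0.
have e2 := laplacian_expansion oU gU Us eps0.
have Qmove : \forall t \near (0 : R)^'+, forall j : 'I_n,
    Q (c + t *: unit_row j) /\ Q (c - t *: unit_row j).
  apply: filter_forall => j.
  have r0 : 0 < a - `|c ord0 j - x0 ord0 j| by rewrite subr_gt0.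
  have r1 : 0 < c ord0 i - x0 ord0 i by rewrite subr_gt0.
  near=> t.
  have t0 : 0 < t by [].
  have ta : t < a - `|c ord0 j - x0 ord0 j| by near: t; exact: nbhs_right_lt.
  have ti : t < c ord0 i - x0 ord0 i by near: t; exact: nbhs_right_lt.
  suff key r : `|r| <= t -> Q (c + r *: unit_row j).
    by split; [|rewrite -scaleNr]; apply: key; rewrite ?normrN gtr0_norm.
  move=> rt; apply/QE; split.
    apply/row_cubeP => [|k]; first exact: ltW.
    rewrite move_coordE; case: (eqVneq k j) => [->|_].
      rewrite mulr1 addrAC (le_trans (ler_normD _ _))// -lerBrDl.
      exact: le_trans rt (ltW ta).
    by rewrite mulr0 addr0 ltW.
  rewrite move_coordE; case: (eqVneq i j) => _; rewrite ?mulr1 ?mulr0 ?addr0//.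
  rewrite -lerBlDl -opprB lerNl.
  apply: le_trans (le_trans rt (ltW ti)).
  by rewrite -normrN; exact: ler_norm.
have [t [[[t0 {}e1] {}e2] {}Qmove]] :=
  filter_ex (filterI (filterI (filterI (nbhs_right_gt 0) e1) e2) Qmove).
have : \sum_(j < n) (F (c + t *: unit_row j) + F (c - t *: unit_row j) - 2 * F c) <= 0.
  apply: sumr_le0 => j _; have [/Fc h1 /Fc h2] := Qmove j.
  by rewrite subr_le0 mulr_natl mulr2n lerD.
have -> : \sum_(j < n) (F (c + t *: unit_row j) + F (c - t *: unit_row j) - 2 * F c) =
  (\sum_(j < n) (g (c + t *: unit_row j) + g (c - t *: unit_row j) - 2 * g c) -
   \sum_(j < n) (g (reflect x0 i c + t *: unit_row j) +
    g (reflect x0 i c - t *: unit_row j) - 2 * g (reflect x0 i c))) / 2 -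
  \sum_(j < n) (psi (c + t *: unit_row j) + psi (c - t *: unit_row j) - 2 * psi c).
  rewrite -sumrB mulr_suml -sumrB; apply: eq_bigr => j _.
  rewrite /F -!(scaleNr t) !reflect_move; case: ifP => _; rewrite ?opprK; ring.
rewrite cube_barrier_laplacian//.
have t2 : 0 < t ^+ 2 by rewrite exprn_gt0.
rewrite leNgt => /negP; apply; exact: barrier_contradiction e1 e2.
Unshelve. all: by end_near. Qed.

End cube_estimate.

(** * The Lebesgue measure of cubes *)

Section tuple_measure.
Context {R : realType}.
Local Notation T := (measurableTypeR R).

Lemma measurable_tuple_box n (lo hi : 'I_n -> R) :
  measurable [set z : n.-tuple T | forall i, lo i <= (tnth z i : R) <= hi i].
Proof.
have -> : [set z : n.-tuple T | forall i, lo i <= (tnth z i : R) <= hi i] =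
    \bigcap_(i in [set: 'I_n]) ((fun z : n.-tuple T => tnth z i) @^-1` `[lo i, hi i]).
  apply/seteqP; split => z /= H i; first by move=> _; rewrite /= in_itv/= H.
  by have := H i I; rewrite /= in_itv.
apply: fin_bigcap_measurable; first exact: finite_finset.
move=> i _; rewrite -[X in measurable X]setTI.
by apply: (@measurable_tnth _ T n i) => //; exact: measurable_itv.
Qed.

Lemma lebesgue_tuple_cube n (c : 'I_n -> R) (r : R) : 0 <= r ->
  lebesgue_tuple n [set z : n.-tuple T | forall i, c i - r <= (tnth z i : R) <= c i + r] =
  ((2 * r) ^+ n)%:E.
Proof.
move=> r0; elim: n c => [|n IH] c.
  rewrite /= expr0 diracE mem_set// => i; by case: i.
rewrite /= /lebesgue_cons /pushforward.
have -> : @tuple_cons R n @^-1` [set z : n.+1.-tuple T |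
    forall i, c i - r <= (tnth z i : R) <= c i + r] =
  `[c ord0 - r, c ord0 + r] `*` [set z : n.-tuple T |
    forall i, c (lift ord0 i) - r <= (tnth z i : R) <= c (lift ord0 i) + r].
  apply/seteqP; split => -[x z] /=.
    move=> H; split => [|i]; first by have := H ord0; rewrite in_itv.
    by have := H (lift ord0 i); rewrite (tnth_nth 0)/= -tnth_nth.
  move=> [+ H] i; rewrite in_itv/= => xc.
  case: (unliftP ord0 i) => [j|] ->; last by [].
  by rewrite (tnth_nth 0)/= -tnth_nth; exact: H.
rewrite product_measure1E; [|exact: measurable_itv|exact: measurable_tuple_box].
rewrite (IH (fun i => c (lift ord0 i))).
have E : @lebesgue_measure R `[c ord0 - r, c ord0 + r]%classic = (2 * r)%:E.
  rewrite lebesgue_measure_itv/= lte_fin.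
  move: r0; rewrite le_eqVlt => /orP[/eqP <-|r0].
    by rewrite subr0 addr0 ltxx mulr0.
  rewrite ifT; last by rewrite ltrBlDr -addrA ltrDl -mulr2n pmulrn_lgt0.
  by rewrite -EFinD; congr (_%:E); ring.
by rewrite exprS EFinM; congr (_ * _)%E; exact: E.
Qed.

Lemma row_cube_preimage n (x : 'rV[R]_n) (r : R) : 0 <= r ->
  @rv_of_tuple R n @^-1` [set y | `|y - x| <= r] =
  [set z : n.-tuple T | forall i, x ord0 i - r <= (tnth z i : R) <= x ord0 i + r].
Proof.
move=> r0; apply/seteqP; split => z /=.
  move=> /(row_cubeP _ _ r0) H i; have := H i.
  by rewrite mxE ler_distl.
by move=> H; apply/(row_cubeP _ _ r0) => i; rewrite mxE ler_distl.
Qed.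

Lemma measurable_row_cube n (x : 'rV[R]_n) (r : R) : 0 <= r ->
  measurable (@rv_of_tuple R n @^-1` [set y | `|y - x| <= r]).
Proof. by move=> r0; rewrite row_cube_preimage//; exact: measurable_tuple_box. Qed.

Lemma measure_row_cube n (x : 'rV[R]_n) (r : R) : 0 <= r ->
  lebesgue_tuple n (@rv_of_tuple R n @^-1` [set y | `|y - x| <= r]) = ((2 * r) ^+ n)%:E.
Proof. by move=> r0; rewrite row_cube_preimage// lebesgue_tuple_cube. Qed.

(** The sigma-algebra on tuples comes from the coordinates. An open set is the union of the cubes it
    contains with rational centre and radius 1/(k+1), of which there are countably many. *)
Lemma measurable_row_open n (U : set 'rV[R]_n) : open U ->
  measurable (@rv_of_tuple R n @^-1` U).
Proof.
move=> oU; pose q (p : 'rV[rat]_n * nat) : 'rV[R]_n := map_mx ratr p.1.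
pose F (p : 'rV[rat]_n * nat) := [set y : 'rV[R]_n | `|y - q p| <= p.2.+1%:R^-1].
pose G p := if `[< F p `<=` U >] then F p else set0.
have -> : @rv_of_tuple R n @^-1` U = \bigcup_p (@rv_of_tuple R n @^-1` (G p)).
  apply/seteqP; split => [z Uz|z [p _]]; last first.
    by rewrite /G; case: asboolP => // FU /FU.
  set y := rv_of_tuple z in Uz.
  have [r r0 rU] := nbhs_row_cube (open_nbhs_nbhs (conj oU Uz)).
  have [k kr] : exists k : nat, k.+1%:R^-1 < r / 2.
    have r20 : 0 < r / 2 by rewrite divr_gt0.
    exists (Num.bound (r / 2)^-1); rewrite invf_plt ?posrE//.
    apply: lt_trans (_ : (Num.bound (r / 2)^-1)%:R < _); last by rewrite ltr_nat.
    by apply: archi_boundP; rewrite invr_ge0 ltW.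
  have ky : 0 < k.+1%:R^-1 :> R by rewrite invr_gt0.
  have /fin_all_exists[p pP] : forall i : 'I_n, exists p : rat,
      `|y ord0 i - ratr p| <= k.+1%:R^-1.
    move=> i; have [|p] := @rat_in_itvoo R (y ord0 i - k.+1%:R^-1) (y ord0 i + k.+1%:R^-1).
      by rewrite ltrD2l gtrN.
    by rewrite in_itv/= => /andP[h1 h2]; exists p; rewrite distrC ler_distl !ltW.
  exists (\row_i p i, k) => //; rewrite /G ifT; last first.
    apply/asboolP => w Fw; apply: rU.
    rewrite -(subrKA (q (\row_i p i, k))) (le_lt_trans (ler_normD _ _))//.
    rewrite (splitr r) ltrD//; first exact: le_lt_trans kr.
    apply: le_lt_trans kr; rewrite -opprB normrN; apply/row_cubeP => [|i]; first exact: ltW.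
    by rewrite !mxE; have := pP i; rewrite mxE.
  rewrite /F/=; apply/row_cubeP => [|i]; first exact: ltW.
  by rewrite !mxE; have := pP i; rewrite mxE.
apply: countable_bigcupT_measurable; first exact: countableP.
move=> p; rewrite /G; case: ifP => _; last by rewrite preimage_set0; exact: measurable0.
by apply: measurable_row_cube.
Qed.

Lemma measurable_row_continuous n (D : set 'rV[R]_n) (g : 'rV[R]_n -> R) :
  continuous g ->
  measurable_fun (@rv_of_tuple R n @^-1` D) (g \o @rv_of_tuple R n).
Proof.
move=> cg mD; apply: (measurability _ (measurable_realfun.RGenOpens.measurableE R)) => //.
move=> _ [_ [a [b ->] <-]]; apply: measurableI => //.
rewrite comp_preimage; apply: measurable_row_open.
by apply: open_comp; [move=> x _; exact: cg|exact: interval_open].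
Qed.

End tuple_measure.

(** * The inner product of L^2(D) on continuous functions *)

Section L2_continuous.
Context {R : realType} {n : nat} (D : set 'rV[R]_n).
Hypotheses (oD : open D) (bD : bounded_set D).
Local Notation T := (measurableTypeR R).
Local Notation mu := (@lebesgue_tuple R n).
Local Notation D' := (@rv_of_tuple R n @^-1` D).
Implicit Types g h : 'rV[R]_n -> R.

Let mD : measurable D'. Proof. exact: measurable_row_open. Qed.

Lemma bounded_cube : exists2 A : R, 0 < A & forall x, D x -> `|x - 0| <= A.
Proof.
have [M [Mreal HM]] := bD; exists (`|M| + 1); first exact: ltr_wpDl.
by move=> x Dx; rewrite subr0; apply: HM => //; rewrite ltr_pwDr// ler_norm.
Qed.

Lemma domain_measure_fin : (mu D' < +oo)%E.
Proof.
have [A A0 DA] := bounded_cube.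
apply: (@le_lt_trans _ _ (mu (@rv_of_tuple R n @^-1` [set y | `|y - 0| <= A]))).
  apply: le_measure; rewrite ?inE//; last by move=> z; exact: DA.
  by apply: measurable_row_cube; exact: ltW.
by rewrite measure_row_cube ?ltW// ltry.
Qed.

Lemma continuous_bounded g : continuous g ->
  exists2 B : R, 0 < B & forall x, D x -> `|g x| <= B.
Proof.
move=> cg; have [A A0 DA] := bounded_cube.
have cK := @compact_row_cube R n 0 A (ltW A0).
have : compact (g @` [set y : 'rV[R]_n | `|y - 0| <= A]).
  by apply: continuous_compact => //; exact: continuous_subspaceT.
move=> /compact_bounded[M [Mreal HM]]; exists (`|M| + 1); first exact: ltr_wpDl.
move=> x Dx; apply: HM; first by rewrite ltr_pwDr// ler_norm.
by exists x => //; exact: DA.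
Qed.

Lemma continuous_integrable g : continuous g ->
  mu.-integrable D' (EFin \o (g \o @rv_of_tuple R n)).
Proof.
move=> cg; apply: measurable_bounded_integrable => //.
- exact: domain_measure_fin.
- exact: measurable_row_continuous.
- have [B B0 HB] := continuous_bounded cg.
  exists B; split; first exact: num_real.
  by move=> b Bb z Dz; apply: le_trans (ltW Bb); exact: HB.
Qed.

Lemma L2_innerC g h : L2_inner D g h = L2_inner D h g.
Proof. by apply: eq_Rintegral => z _; rewrite mulrC. Qed.

Lemma L2_inner_lin g h k (a : R) : continuous g -> continuous h -> continuous k ->
  L2_inner D (fun x => a * g x + h x) k = a * L2_inner D g k + L2_inner D h k.
Proof.
move=> cg ch ck.
have cgk : continuous (fun x => g x * k x) by move=> x; exact: cvgM (cg x) (ck x).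
have chk : continuous (fun x => h x * k x) by move=> x; exact: cvgM (ch x) (ck x).
have cagk : continuous (fun x => a * (g x * k x)) by move=> x; exact: cvgM (cvg_cst _) (cgk x).
rewrite /L2_inner -(RintegralZl _ mD (continuous_integrable cgk)).
rewrite -(RintegralD mD (continuous_integrable cagk) (continuous_integrable chk)).
by apply: eq_Rintegral => z _ /=; rewrite mulrDl mulrA.
Qed.

Lemma continuous_comb (I : Type) (r : seq I) (c : I -> R) (f : I -> 'rV[R]_n -> R) :
  (forall i, continuous (f i)) ->
  continuous (fun x => \sum_(i <- r) c i * f i x).
Proof.
move=> cf x; apply: (@cvg_sumr R _ _ (nbhs x)) => i _.
exact: cvgM (cvg_cst _) (cf i x).
Qed.

Lemma L2_inner_sum (I : Type) (r : seq I) (c : I -> R) (f : I -> 'rV[R]_n -> R) k :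
  (forall i, continuous (f i)) -> continuous k ->
  L2_inner D (fun x => \sum_(i <- r) c i * f i x) k =
  \sum_(i <- r) c i * L2_inner D (f i) k.
Proof.
move=> cf ck; elim: r => [|i r IH].
  rewrite big_nil /L2_inner -[RHS](mul0r (fine (mu D'))) -Rintegral_cst//.
  by apply: eq_Rintegral => z _ /=; rewrite big_nil mul0r.
rewrite big_cons -IH.
rewrite -(@L2_inner_lin (f i) (fun x => \sum_(i <- r) c i * f i x) k (c i) (cf i) _ ck).
  by apply: eq_Rintegral => z _ /=; rewrite big_cons.
exact: continuous_comb.
Qed.

(** Continuity of the inner product for uniform convergence in g: it lets the coefficients of the
    heat kernel be read off its partial sums. *)
Lemma L2_inner_bound g h (b : R) : continuous g -> continuous h ->
  (forall x, D x -> `|g x| <= b) ->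
  `|L2_inner D g h| <= b * L2_inner D (fun x => `|h x|) (fun=> 1).
Proof.
move=> cg ch gb.
have cgh : continuous (fun x => g x * h x) by move=> x; exact: cvgM (cg x) (ch x).
have cnh : continuous (fun x => `|h x| * 1).
  move=> x; apply: (@cvgM _ _ (nbhs x)); last exact: cvg_cst.
  exact: (cvg_norm (ch x)).
have cbh : continuous (fun x => b * (`|h x| * 1)) by move=> x; exact: cvgM (cvg_cst _) (cnh x).
have cngh : continuous (fun x => `|g x * h x|) by move=> x; exact: (cvg_norm (cgh x)).
apply: le_trans (le_normr_Rintegral mD (continuous_integrable cgh)) _.
rewrite /L2_inner -(RintegralZl _ mD (continuous_integrable cnh)).
apply: le_Rintegral; [exact: mD|exact: (continuous_integrable cngh)| |].
  exact: (continuous_integrable cbh).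
by move=> z Dz /=; rewrite mulr1 normrM ler_wpM2r// gb.
Qed.

(** A Chebyshev bound: largeness of g on a cube is paid for in its L^2 norm, the last link of the
    duality. *)
Lemma L2_norm_cube g (x : 'rV[R]_n) (r m : R) : continuous g -> 0 <= r -> 0 <= m ->
  (forall y, `|y - x| <= r -> D y /\ m <= `|g y|) ->
  m ^+ 2 * (2 * r) ^+ n <= L2_inner D g g.
Proof.
move=> cg r0 m0 H.
have cgg : continuous (fun x => g x * g x) by move=> y; exact: cvgM (cg y) (cg y).
set Q := @rv_of_tuple R n @^-1` [set y | `|y - x| <= r].
have mQ : measurable Q by exact: measurable_row_cube.
have QD : Q `<=` D' by move=> z /H[].
have -> : m ^+ 2 * (2 * r) ^+ n = \int[mu]_(z in Q) (m ^+ 2).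
  rewrite Rintegral_cst//; congr (_ * _).
  exact: (esym (congr1 fine (measure_row_cube x r0))).
have iQ := integrableS mD mQ QD (continuous_integrable cgg).
apply: (@le_trans _ _ (\int[mu]_(z in Q) (g (rv_of_tuple z) * g (rv_of_tuple z)))).
  apply: le_Rintegral => //.
    have ccst : continuous (fun _ : 'rV[R]_n => m ^+ 2) by exact: cst_continuous.
    exact: (integrableS mD mQ QD (continuous_integrable ccst)).
  by move=> z /H[_ mg]; rewrite -expr2 -[leRHS]real_normK ?num_real// lerXn2r ?nnegrE.
rewrite -lee_fin /L2_inner /Rintegral !fineK; last 2 first.
- exact: integrable_fin_num (continuous_integrable cgg).
- exact: integrable_fin_num iQ.
- apply: ge0_subset_integral => //.
  + by have /measurable_int := continuous_integrable cgg.
  + by move=> z _; rewrite lee_fin -expr2 sqr_ge0.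
Qed.

End L2_continuous.

Lemma sum_sqr_ge0 (R : realType) (I : Type) (r : seq I) (a : I -> R) :
  0 <= \sum_(i <- r) a i ^+ 2.
Proof. by apply: sumr_ge0 => i _; exact: sqr_ge0. Qed.

Lemma finite_cauchy_schwarz (R : realType) (I : eqType) (r : seq I) (a b : I -> R) :
  (\sum_(i <- r) a i * b i) ^+ 2 <=
  (\sum_(i <- r) a i ^+ 2) * (\sum_(i <- r) b i ^+ 2).
Proof.
set p := \sum_(i <- r) a i * b i; set A := \sum_(i <- r) a i ^+ 2.
set B := \sum_(i <- r) b i ^+ 2.
have : 0 <= B by exact: sum_sqr_ge0.
rewrite le_eqVlt => /orP[/eqP B0|B0].
  suff -> : p = 0 by rewrite expr0n/= -B0 mulr0.
  rewrite /p big_seq big1// => i ir; suff -> : b i = 0 by rewrite mulr0.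
  apply/eqP; rewrite -sqrf_eq0; move/esym/eqP : B0.
  rewrite psumr_eq0; last by move=> ? _; exact: sqr_ge0.
  by move/allP/(_ _ ir).
(* This sum of squares expands to B (A B - p^2). *)
have : 0 <= \sum_(i <- r) (a i * B - b i * p) ^+ 2 by exact: sum_sqr_ge0.
have -> : \sum_(i <- r) (a i * B - b i * p) ^+ 2 =
    B ^+ 2 * A - 2 * B * p * p + p ^+ 2 * B.
  have -> : B ^+ 2 * A - 2 * B * p * p + p ^+ 2 * B = \sum_(i <- r)
      (B ^+ 2 * a i ^+ 2 - 2 * B * p * (a i * b i) + p ^+ 2 * b i ^+ 2).
    by rewrite big_split/= sumrB -!mulr_sumr.
  by apply: eq_bigr => i _; ring.
rewrite (_ : _ + _ = B * (A * B - p ^+ 2)); last by ring.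
by rewrite pmulr_rge0// subr_ge0.
Qed.

(** * Gradient estimate along coordinate paths *)

Section coordinate_path.
Context {R : realType} {n : nat}.
Implicit Types (U : set 'rV[R]_n) (g : 'rV[R]_n -> R).

Lemma cube_difference_norm U g (x0 : 'rV[R]_n) (i : 'I_n) (a M N s : R) :
  open U -> C2_on U g -> continuous g -> 0 < a ->
  (forall y, `|y - x0| <= a -> [/\ U y, `|g y| <= M & `|laplacian g y| < N]) ->
  0 <= s <= a ->
  `|g (x0 + s *: unit_row i) - g (x0 - s *: unit_row i)| <=
    2 * (s * (n%:R * M / a + N * a / 2)).
Proof.
move=> oU gU cg a0 Ha sa; rewrite ler_norml (cube_difference i oU gU cg a0 Ha sa) andbT.
(* This is -g, in the shape a * g + h that [C2_on_lin] and [laplacian_lin] expect. *)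
pose h (y : 'rV[R]_n) := -1 * g y + 0.
have hU : C2_on U h := C2_on_lin (-1) oU gU (@C2_on_cst _ _ U 0).
have ch : continuous h.
  by move=> y; exact: cvgD (cvgM (cvg_cst _) (cg y)) (cvg_cst _).
have Hh y : `|y - x0| <= a -> [/\ U y, `|h y| <= M & `|laplacian h y| < N].
  move=> /Ha[Uy gM gN]; split; [exact: Uy|by rewrite /h mulN1r addr0 normrN|].
  rewrite (@laplacian_lin _ _ U g (fun=> 0) (-1) y oU gU (C2_on_cst _) Uy).
  by rewrite laplacian_cst addr0 mulN1r normrN.
have := cube_difference i oU hU ch a0 Hh sa.
by rewrite /h !addr0 !mulN1r opprK addrC lerNl opprB.
Qed.

(** The path from x to y replaces the coordinates one at a time; in the sup norm each intermediate
    point is no farther from x than y is. *)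
Lemma coordinate_path_bound g (x y : 'rV[R]_n) (B : R) :
  (forall i w t, `|w - x| <= `|y - x| -> `|w + t *: unit_row i - x| <= `|y - x| ->
    `|t| <= `|y - x| -> `|g (w + t *: unit_row i) - g w| <= B * `|t|) ->
  0 <= B -> `|g y - g x| <= n%:R * (B * `|y - x|).
Proof.
move=> H B0.
pose p (m : nat) : 'rV[R]_n := \row_k (if (k < m)%N then y ord0 k else x ord0 k).
have p0 : p 0%N = x by apply/rowP => k; rewrite mxE.
have pn : p n = y by apply/rowP => k; rewrite mxE ltn_ord.
have px m : `|p m - x| <= `|y - x|.
  apply/row_cubeP => // k; rewrite mxE; case: ifP => _; last by rewrite subrr normr0.
  by have := coord_le_norm (y - x) k; rewrite !mxE.
have -> : g y - g x = \sum_(i < n) (g (p i.+1) - g (p i)).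
  have := telescope_sumr (fun m => g (p m)) (leq0n n).
  by rewrite big_mkord pn p0.
apply: le_trans (ler_norm_sum _ _ _) _.
have -> : n%:R * (B * `|y - x|) = \sum_(i < n) (B * `|y - x|).
  by rewrite sumr_const card_ord mulr_natl.
apply: ler_sum => i _; pose dl := y ord0 i - x ord0 i.
have dlB : `|dl| <= `|y - x| by have := coord_le_norm (y - x) i; rewrite !mxE.
have pE : p i.+1 = p i + dl *: unit_row i.
  apply/rowP => k; rewrite move_coordE !mxE ltnS leq_eqVlt.
  case: (ltngtP k i) => ki.
  - by rewrite -val_eqE (ltn_eqF ki) !mulr0 !addr0.
  - by rewrite -val_eqE (gtn_eqF ki) !mulr0 !addr0.
  - have -> : k = i by exact: val_inj.
    by rewrite eqxx mulr1 /dl addrC subrK.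
rewrite pE; apply: le_trans (H i (p i) dl (px i) _ dlB) _; first by rewrite -pE px.
by rewrite ler_wpM2l.
Qed.

Lemma coordinate_path_difference U g (x y : 'rV[R]_n) (rho M N : R) :
  open U -> C2_on U g -> continuous g -> 0 < rho ->
  (forall z, `|z - x| <= 2 * rho -> [/\ U z, `|g z| <= M & `|laplacian g z| < N]) ->
  `|y - x| <= rho ->
  `|g y - g x| <= n%:R * (`|y - x| * (n%:R * M / rho + N * rho / 2)).
Proof.
move=> oU gU cg rho0 H yx; rewrite [`|y - x| * _]mulrC.
have := H x; rewrite subrr normr0 => /(_ (mulr_ge0 (ler0n _ 2) (ltW rho0)))[_ M0 N0].
have {}M0 : 0 <= M by exact: le_trans M0.
have {}N0 : 0 <= N by exact: le_trans (ltW N0).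
apply: coordinate_path_bound; last first.
  by rewrite addr_ge0// ?divr_ge0 ?mulr_ge0// ltW.
(* The estimate on cubes compares points symmetric about the centre, so it is applied at the
   midpoint of each segment; a cube of radius rho about it stays within 2 rho of x. *)
move=> i w t wx wtx tx; pose c := w + (t / 2) *: unit_row i.
have wE : w = c + (- (t / 2)) *: unit_row i by rewrite /c scaleNr addrK.
have wtE : w + t *: unit_row i = c + (t / 2) *: unit_row i.
  by rewrite /c -addrA -scalerDl -splitr.
have cx : `|c - x| <= rho.
  have -> : c - x = 2^-1 *: ((w - x) + (w + t *: unit_row i - x)).
    by apply/rowP => k; rewrite /c !mxE; field.
  rewrite normrZ ger0_norm// ler_pdivrMl// mulr_natl mulr2n.
  by rewrite (le_trans (ler_normD _ _))// lerD// (le_trans _ yx).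
have Hc z : `|z - c| <= rho -> [/\ U z, `|g z| <= M & `|laplacian g z| < N].
  move=> zc; apply: H; rewrite -(subrKA c) (le_trans (ler_normD _ _))//.
  by rewrite mulr_natl mulr2n lerD.
have st : 0 <= `|t| / 2 <= rho.
  rewrite divr_ge0//= ler_pdivrMr// (le_trans tx)// (le_trans yx)//.
  by rewrite ler_peMr ?ler1n// ltW.
have := cube_difference_norm i oU gU cg rho0 Hc st.
have -> : `|g (c + (`|t| / 2) *: unit_row i) - g (c - (`|t| / 2) *: unit_row i)| =
    `|g (w + t *: unit_row i) - g w|.
  rewrite wtE [in RHS]wE -scaleNr; have [t0|t0] := leP 0 t.
    by rewrite (ger0_norm t0).
  by rewrite (ltr0_norm t0) mulNr opprK distrC.
move=> /le_trans; apply; rewrite le_eqVlt; apply/orP; left; apply/eqP.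
by field; rewrite gt_eqF.
Qed.

End coordinate_path.

(** * Spectral sums *)

Section spectral_sums.
Context {R : realType} {d : nat} {D : set 'rV[R]_d} {lam : nat -> R}
  {f : nat -> 'rV[R]_d -> R}.
Hypotheses (d0 : (0 < d)%N) (oD : open D) (bD : bounded_set D)
  (E : dirichlet_eigensystem D lam f).
Implicit Types (r : seq nat) (c : nat -> R) (x y : 'rV[R]_d).

Lemma eigenfun_continuous n : continuous (f n).
Proof. by have [_ _ /(_ n)[[]]] := E. Qed.

Lemma eigenfun_out n x : ~ D x -> f n x = 0.
Proof. by have [_ _ /(_ n)[[_ H]] _ _ _] := E => /H. Qed.

Lemma eigenfun_C2 n : C2_on D (f n).
Proof. by have [_ _ /(_ n)[]] := E. Qed.

Lemma eigenfun_laplacian n x : D x -> laplacian (f n) x = - (lam n * f n x).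
Proof. by have [_ _ /(_ n)[_ _ H] _ Dx] := E; rewrite -H// opprK. Qed.

Lemma eigenvalue_gt0 n : 0 < lam n.
Proof. by have [[l0 _] H _ _] := E; exact: lt_le_trans l0 (H _ _ (leq0n n)). Qed.

Lemma eigenvalue_le m n : (m <= n)%N -> lam m <= lam n.
Proof. by have [_ H _ _] := E; exact: H. Qed.

Lemma eigenfun_orthonormal m n : L2_inner D (f m) (f n) = (m == n)%:R.
Proof. by have [_ _ _ [_ H _]] := E. Qed.

Definition comb r c (x : 'rV[R]_d) : R := \sum_(k <- r) c k * f k x.

(** The indices form an arbitrary finite list, with lam <= L as a separate hypothesis; later r is a
    truncation of {n : lam n <= L}, with bounds independent of the truncation. *)
Definition spectral_sum r x : R := \sum_(k <- r) f k x ^+ 2.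

Lemma comb_continuous r c : continuous (comb r c).
Proof. by apply: continuous_comb => k; exact: eigenfun_continuous. Qed.

Lemma comb_C2 r c : C2_on D (comb r c).
Proof. by have [] := @C2_on_sum R d D nat r c f oD eigenfun_C2. Qed.

Lemma spectral_sum_continuous r : continuous (spectral_sum r).
Proof.
move=> x; apply: (@cvg_sumr R _ _ (nbhs x)) => i _.
have ci := @eigenfun_continuous i x.
under eq_fun do rewrite expr2.
rewrite expr2; exact: (cvgM ci ci).
Qed.

Lemma spectral_sum_ge0 r x : 0 <= spectral_sum r x.
Proof. exact: sum_sqr_ge0. Qed.

Lemma comb_norm r c : uniq r -> L2_inner D (comb r c) (comb r c) = \sum_(k <- r) c k ^+ 2.
Proof.
move=> ur; rewrite (L2_inner_sum oD bD r c eigenfun_continuous (@comb_continuous r c)).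
rewrite !big_seq; apply: eq_bigr => k kr; rewrite L2_innerC.
rewrite (L2_inner_sum oD bD r c eigenfun_continuous (@eigenfun_continuous k)).
rewrite (bigD1_seq k)//= big1 ?addr0; first by rewrite eigenfun_orthonormal eqxx mulr1 expr2.
by move=> j jk; rewrite eigenfun_orthonormal (negPf jk) mulr0.
Qed.

Lemma comb_bound r c x : comb r c x ^+ 2 <= (\sum_(k <- r) c k ^+ 2) * spectral_sum r x.
Proof. exact: finite_cauchy_schwarz. Qed.

Lemma comb_laplacian_bound r c x (L : R) : D x ->
  (forall k, k \in r -> lam k <= L) ->
  laplacian (comb r c) x ^+ 2 <= L ^+ 2 * ((\sum_(k <- r) c k ^+ 2) * spectral_sum r x).
Proof.
move=> Dx rL.
have [_ ->] := @C2_on_sum R d D nat r c f oD eigenfun_C2; last exact: Dx.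
have -> : \sum_(k <- r) c k * laplacian (f k) x = \sum_(k <- r) (- (c k * lam k)) * f k x.
  by apply: eq_bigr => k _; rewrite eigenfun_laplacian// mulrN mulrA mulNr.
apply: le_trans (finite_cauchy_schwarz _ _ _) _; rewrite mulrA ler_wpM2r ?sum_sqr_ge0//.
rewrite mulr_sumr !big_seq; apply: ler_sum => k kr; rewrite sqrrN exprMn mulrC.
rewrite ler_wpM2r ?sqr_ge0// lerXn2r ?rL// nnegrE ?(ltW (eigenvalue_gt0 k))//.
exact: le_trans (ltW (eigenvalue_gt0 k)) (rL _ kr).
Qed.

Lemma norm_le_of_sqr (a b : R) : 0 <= b -> a ^+ 2 <= b ^+ 2 -> `|a| <= b.
Proof. by move=> b0; rewrite -ler_sqrt ?sqr_ge0// !sqrtr_sqr (ger0_norm b0). Qed.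

(* If x maximises (up to a factor A) the sum S over the cube, the combination
   sum_k f_k(x) f_k, whose square norm is S(x), is at least S(x)/2 on a fixed
   fraction of the cube. *)
Lemma spectral_mass_bound r x (rho L A : R) : uniq r ->
  (forall k, k \in r -> lam k <= L) -> 0 <= L ->
  0 < rho -> L * rho ^+ 2 <= 1 -> 1 <= A ->
  (forall y, `|y - x| <= 2 * rho -> D y /\ spectral_sum r y <= A * spectral_sum r x) ->
  spectral_sum r x * (rho / (d%:R * (d%:R + 1) * A)) ^+ d <= 4.
Proof.
move=> ur rL L0 rho0 Lrho A1 H.
set M := spectral_sum r x; have M0 : 0 <= M by exact: spectral_sum_ge0.
move: M0; rewrite le_eqVlt => /orP[/eqP <-|M0]; first by rewrite mul0r.
have A0 : 0 < A by exact: lt_le_trans A1.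
have dR : 1 <= d%:R :> R by rewrite ler1n.
have dR0 : 0 < d%:R :> R by exact: lt_le_trans dR.
(* The reproducing function at x: its value at x and its squared L^2 norm are both M. *)
pose g := comb r (f^~ x).
have gx : g x = M by apply: eq_bigr => k _; rewrite expr2.
have AM (y : 'rV[R]_d) : `|y - x| <= 2 * rho -> M * spectral_sum r y <= (A * M) ^+ 2.
  move=> /H[_ Sy]; apply: (@le_trans _ _ (M * (A * M))); first by rewrite ler_wpM2l ?(ltW M0).
  have -> : M * (A * M) = A * M ^+ 2 by ring.
  by rewrite exprMn ler_wpM2r ?sqr_ge0// expr2 ler_peMr// ltW.
(* The Laplacian of g is at most L A M; the added term makes the bound strict and, since L rho^2 <=
   1, keeps N rho / 2 below A M / rho. *)
pose N := A * M * (L + (rho ^+ 2)^-1).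
have r20 : 0 < rho ^+ 2 by rewrite exprn_gt0.
have gH : forall y : 'rV[R]_d, `|y - x| <= 2 * rho ->
    [/\ D y, `|g y| <= A * M & `|laplacian g y| < N].
  move=> y yx; have [Dy Sy] := H _ yx; split; first exact: Dy.
    apply: norm_le_of_sqr; first by rewrite mulr_ge0// ltW.
    exact: le_trans (comb_bound _ _ _) (AM _ yx).
  apply: (@le_lt_trans _ _ (L * (A * M))); last first.
    by rewrite /N mulrC ltr_pM2l ?mulr_gt0// ltrDl invr_gt0.
  apply: norm_le_of_sqr; first by rewrite !mulr_ge0// ltW.
  rewrite exprMn; apply: le_trans (comb_laplacian_bound _ Dy rL) _.
  by rewrite ler_wpM2l ?sqr_ge0// AM.
(* The radius at which the gradient bound, of size d (d + 1) A M / rho, lets g drop by at most M /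
   2. *)
pose eta := rho / (2 * (d%:R * (d%:R + 1) * A)).
have dd0 : 0 < d%:R * (d%:R + 1) * A by rewrite !mulr_gt0// addr_gt0.
have eta0 : 0 < eta by rewrite divr_gt0// mulr_gt0.
have eta_rho : eta <= rho.
  rewrite ler_pdivrMr ?mulr_gt0// ler_peMr ?(ltW rho0)//.
  have : 1 <= d%:R * (d%:R + 1) * A.
    by rewrite mulr_ege1// mulr_ege1// (le_trans dR)// lerDl.
  by move=> h; rewrite (le_trans h)// ler_peMl// ?(ltW dd0)// ler1n.
have key : forall y : 'rV[R]_d, `|y - x| <= eta -> D y /\ M / 2 <= `|g y|.
  move=> y yx; have yrho : `|y - x| <= rho by exact: le_trans eta_rho.
  have [Dy _ _] : [/\ D y, `|g y| <= A * M & `|laplacian g y| < N].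
    by apply: gH; rewrite (le_trans yrho)// ler_peMl ?ler1n// ltW.
  split; first exact: Dy.
  have := coordinate_path_difference oD (@comb_C2 r (f^~ x)) (@comb_continuous _ _) rho0 gH yrho.
  rewrite -/g gx => gyM.
  have : `|g y - M| <= M / 2.
    apply: le_trans gyM _.
    have N2 : N * rho / 2 <= A * M / rho.
      rewrite /N ler_pdivrMr// -!mulrA ler_wpM2l ?(ltW A0)// ler_wpM2l ?(ltW M0)//.
      rewrite ler_pdivlMl//.
      have -> : rho * ((L + (rho ^+ 2)^-1) * rho) = L * rho ^+ 2 + 1.
        by field; rewrite gt_eqF.
      by rewrite -[leRHS]/(1 + 1) lerD2r.
    have B : d%:R * (A * M) / rho + N * rho / 2 <= (d%:R + 1) * (A * M) / rho.
      by rewrite mulrDl mulrDl mul1r lerD2l.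
    apply: (@le_trans _ _ (d%:R * (eta * ((d%:R + 1) * (A * M) / rho)))).
      have M0' := ltW M0; have A0' := ltW A0; have rho0' := ltW rho0.
      have h1 : 0 <= d%:R * (A * M) / rho by rewrite divr_ge0// mulr_ge0// mulr_ge0.
      have h2 : 0 <= N * rho / 2.
        rewrite divr_ge0// mulr_ge0// mulr_ge0//; first by rewrite mulr_ge0.
        by rewrite addr_ge0// invr_ge0 sqr_ge0.
      rewrite ler_wpM2l//; apply: ler_pM => //; exact: addr_ge0.
    have -> : d%:R * (eta * ((d%:R + 1) * (A * M) / rho)) = M / 2.
      rewrite /eta; field; rewrite !gt_eqF// addr_gt0//.
    by [].
  rewrite ler_distl => /andP[+ _]; have -> : M - M / 2 = M / 2 by field.
  by move=> /le_trans; apply; exact: ler_norm.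
(* This reads (M / 2)^2 (2 eta)^d <= M, and one factor M cancels. *)
have := L2_norm_cube oD bD (@comb_continuous r (f^~ x)) (ltW eta0) (_ : 0 <= M / 2) key.
rewrite divr_ge0 ?(ltW M0)// => /(_ isT); rewrite comb_norm// -/M.
have -> : 2 * eta = rho / (d%:R * (d%:R + 1) * A).
  by rewrite /eta; field; rewrite !gt_eqF// addr_gt0.
have -> : (M / 2) ^+ 2 = M * (M / 4) by field.
rewrite -mulrA -[leRHS]mulr1 ler_pM2l// mulrAC ler_pdivrMr// mul1r.
done.
Qed.

End spectral_sums.

(** * Interior bounds for spectral sums and their increments *)

Section interior_estimates.
Context {R : realType} {d : nat} {D : set 'rV[R]_d} {lam : nat -> R}
  {f : nat -> 'rV[R]_d -> R}.
Hypotheses (d0 : (0 < d)%N) (oD : open D) (bD : bounded_set D)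
  (E : dirichlet_eigensystem D lam f).
Implicit Types (r : seq nat) (c : nat -> R) (x y : 'rV[R]_d).
Local Notation S := (@spectral_sum R d f).

(** The constant that [spectral_mass_bound] yields for A = 2 ^ d. *)
Definition interior_constant : R := 4 * (d%:R * (d%:R + 1) * 2 ^+ d) ^+ d.

Lemma interior_constant_gt0 : 0 < interior_constant.
Proof.
have dR0 : 0 < d%:R :> R by rewrite ltr0n.
by rewrite mulr_gt0// exprn_gt0// !mulr_gt0 ?addr_gt0 ?exprn_gt0.
Qed.

(** The point x0 need not be near a maximum of S, so S(y) (dl - |y - x0|)^d is maximised instead. At
    the maximiser x the weight at most halves within half the distance to the edge, whence S(y) <=
    2^d S(x) there; the weight then transfers the bound from x back to x0. *)
Lemma spectral_sum_interior r x0 (dl L : R) : uniq r ->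
  (forall k, k \in r -> lam k <= L) -> 0 <= L -> 0 < dl ->
  (forall y, `|y - x0| <= dl -> D y) ->
  S r x0 <= interior_constant * (4 / dl + Num.sqrt L) ^+ d.
Proof.
move=> ur rL L0 dl0 QD; set q := Num.sqrt L; have q0 : 0 <= q by exact: sqrtr_ge0.
have K0 := interior_constant_gt0.
have : 0 <= S r x0 by exact: spectral_sum_ge0.
rewrite le_eqVlt => /orP[/eqP <-|Sx0].
  by rewrite mulr_ge0 ?(ltW K0)// exprn_ge0// addr_ge0// divr_ge0// ltW.
pose w y : R := dl - `|y - x0|.
have cw : continuous w.
  move=> y; apply: (@cvgB _ _ _ (nbhs y)); first exact: cvg_cst.
  apply: cvg_norm; apply: (@cvgB _ _ _ (nbhs y)); [exact: cvg_id|exact: cvg_cst].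
have cS := @spectral_sum_continuous _ _ _ _ _ E r.
pose F y := S r y * w y ^+ d.
have cF : continuous F.
  move=> y; apply: (@cvgM _ _ (nbhs y)); first exact: cS.
  exact: (@continuous_comp _ _ _ w (fun v : R => v ^+ d) y (cw y) (@exprn_continuous _ _ _)).
pose Q := [set y : 'rV[R]_d | `|y - x0| <= dl].
have cQ : compact Q by apply: compact_row_cube; exact: ltW.
have Qx0 : Q x0 by rewrite /Q/= subrr normr0 ltW.
have [x] : exists2 x, x \in Q & forall y, y \in Q -> F y <= F x.
  by apply: compact_EVT_max => //; [exists x0|exact: continuous_subspaceT].
rewrite inE => Qx Fx; have {}Fx y : Q y -> F y <= F x by move=> ?; apply: Fx; rewrite inE.
have Fx0 : F x0 = S r x0 * dl ^+ d by rewrite /F /w subrr normr0 subr0.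
have Fxpos : 0 < F x by apply: lt_le_trans (Fx _ Qx0); rewrite Fx0 mulr_gt0 ?exprn_gt0.
have wx : 0 < w x.
  rewrite lt_neqAle [w x]/w subr_ge0 [`|_| <= _]Qx andbT; apply/eqP => wx0.
  by move: Fxpos; rewrite /F /w -wx0 expr0n gtn_eqF// mulr0 ltxx.
(* The two terms ensure 2 rho <= w x / 2 and L rho^2 <= 1. *)
pose rho := (4 / w x + q)^-1.
have i0 : 0 < 4 / w x + q by rewrite ltr_wpDr// divr_gt0.
have rho0 : 0 < rho by rewrite invr_gt0.
have rhow : 2 * rho <= w x / 2.
  rewrite /rho ler_pdivrMr// -ler_pdivrMl ?divr_gt0//.
  have -> : (w x / 2)^-1 * 2 = 4 / w x by field; rewrite gt_eqF.
  by rewrite lerDl.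
have Lrho : L * rho ^+ 2 <= 1.
  have -> : L = q ^+ 2 by rewrite sqr_sqrtr.
  rewrite -exprMn exprn_ile1 ?mulr_ge0 ?(ltW rho0)// ler_pdivrMr// mul1r lerDr.
  by rewrite divr_ge0// ltW.
have A1 : 1 <= 2 ^+ d :> R by rewrite exprn_ege1// ler1n.
have H y : `|y - x| <= 2 * rho -> D y /\ S r y <= 2 ^+ d * S r x.
  move=> yx.
  have wy : w x / 2 <= w y.
    rewrite /w lerBrDr -lerBrDl.
    have -> : dl - (dl - `|x - x0|) / 2 = `|x - x0| + w x / 2 by rewrite /w; field.
    rewrite -(subrKA x) addrC (le_trans (ler_normD _ _))// lerD2l.
    exact: le_trans rhow.
  have Qy : Q y.
    by rewrite /Q/= -subr_ge0 -/(w y) (le_trans _ wy)// divr_ge0// ltW.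
  split; first exact: QD.
  have wx2 : 0 < (w x / 2) ^+ d by rewrite exprn_gt0// divr_gt0.
  rewrite -(ler_pM2r wx2); apply: (@le_trans _ _ (F y)).
    rewrite /F ler_wpM2l ?spectral_sum_ge0// lerXn2r ?nnegrE//.
      by rewrite divr_ge0// ltW.
    by rewrite (le_trans _ wy)// divr_ge0// ltW.
  apply: le_trans (Fx _ Qy) _; rewrite /F mulrAC -exprMn.
  by rewrite [2 * _]mulrC divfK// mulrC.
have := spectral_mass_bound d0 oD bD E ur rL L0 rho0 Lrho A1 H.
have dR0 : 0 < d%:R :> R by rewrite ltr0n.
have c0 : 0 < d%:R * (d%:R + 1) * 2 ^+ d :> R by rewrite !mulr_gt0 ?addr_gt0 ?exprn_gt0.
rewrite expr_div_n mulrA ler_pdivrMr ?exprn_gt0// -/interior_constant => mass.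
have Sx : S r x <= interior_constant * (4 / w x + q) ^+ d.
  by move: mass; rewrite /rho exprVn ler_pdivrMr ?exprn_gt0.
have dld : 0 < dl ^+ d by rewrite exprn_gt0.
rewrite -(ler_pM2r dld) -Fx0; apply: le_trans (Fx _ Qx0) _.
rewrite /F; apply: (@le_trans _ _ (interior_constant * (4 / w x + q) ^+ d * w x ^+ d)).
  by rewrite ler_wpM2r// exprn_ge0// ltW.
(* Multiplied by v^d, the bound becomes (4 + q v)^d, which is increasing in v, and w x <= dl. *)
have e (v : R) : 0 < v -> (4 / v + q) ^+ d * v ^+ d = (4 + q * v) ^+ d.
  by move=> v0; rewrite -exprMn mulrDl divfK// gt_eqF.
rewrite -[leLHS]mulrA -[leRHS]mulrA (e _ wx) (e _ dl0); apply: (ler_wpM2l (ltW K0)).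
have wdl : w x <= dl by rewrite /w gerBl.
have h1 : 0 <= 4 + q * w x by rewrite addr_ge0// mulr_ge0// ltW.
have h2 : 4 + q * w x <= 4 + q * dl by rewrite lerD2l ler_wpM2l.
by apply: lerXn2r; rewrite ?nnegrE//; exact: le_trans h2.
Qed.

Definition spectral_difference r x y : R := \sum_(k <- r) (f k x - f k y) ^+ 2.

Lemma spectral_difference_ge0 r x y : 0 <= spectral_difference r x y.
Proof. exact: sum_sqr_ge0. Qed.

Lemma spectral_difference_le r x y :
  spectral_difference r x y <= 2 * (S r x + S r y).
Proof.
rewrite /spectral_difference /spectral_sum -big_split/= mulr_sumr.
apply: ler_sum => k _; rewrite -subr_ge0.
have -> : 2 * (f k x ^+ 2 + f k y ^+ 2) - (f k x - f k y) ^+ 2 = (f k x + f k y) ^+ 2 by ring.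
exact: sqr_ge0.
Qed.

(** For g = sum (f_k(x) - f_k(y)) f_k, the sum T equals g(x) - g(y), and Cauchy-Schwarz bounds |g|
    by sqrt(T B). The gradient estimate therefore has only T^(1/2) on the right, and this can be
    divided out. *)
Lemma spectral_difference_interior r x y (dl L : R) : uniq r ->
  (forall k, k \in r -> lam k <= L) -> 0 <= L -> 0 < dl ->
  (forall z, `|z - x| <= dl -> D z) -> `|y - x| <= dl / 8 ->
  spectral_difference r x y <= 4 * interior_constant * (8 / dl + Num.sqrt L) ^+ d /\
  spectral_difference r x y <= 4 * interior_constant * (8 / dl + Num.sqrt L) ^+ d *
     (d%:R * (d%:R + 1) * `|x - y| * (8 / dl + Num.sqrt L)) ^+ 2.
Proof.
move=> ur rL L0 dl0 QD yx.
set q := Num.sqrt L; have q0 : 0 <= q by exact: sqrtr_ge0.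
set B := interior_constant * (8 / dl + q) ^+ d.
have i0 : 0 < 8 / dl + q by rewrite ltr_wpDr// divr_gt0.
have B0 : 0 < B by rewrite mulr_gt0 ?interior_constant_gt0 ?exprn_gt0.
have SB (z : 'rV[R]_d) : `|z - x| <= dl / 4 -> S r z <= B.
  move=> zx; have := @spectral_sum_interior r z (dl / 2) L ur rL L0.
  have -> : 4 / (dl / 2) = 8 / dl by field; rewrite gt_eqF.
  apply; first by rewrite divr_gt0.
  move=> z' z'z; apply: QD; rewrite -(subrKA z) (le_trans (ler_normD _ _))//.
  apply: (le_trans (lerD z'z zx)); rewrite -subr_ge0.
  have -> : dl - (dl / 2 + dl / 4) = dl / 4 by field.
  by rewrite divr_ge0// ltW.
have dl48 : dl / 8 <= dl / 4 by rewrite ler_wpM2l ?(ltW dl0)// lef_pV2 ?posrE// ler_nat.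
have Sx : S r x <= B by apply: SB; rewrite subrr normr0 divr_ge0// ltW.
have Sy : S r y <= B by apply: SB; exact: le_trans dl48.
set T := spectral_difference r x y.
have T4 : T <= 4 * B.
  apply: le_trans (spectral_difference_le _ _ _) _.
  have -> : 4 * B = 2 * (B + B) by ring.
  by rewrite ler_wpM2l// lerD.
have -> : 4 * interior_constant * (8 / dl + q) ^+ d = 4 * B by rewrite /B mulrA.
split; first exact: T4.
have dR1 : 1 <= d%:R :> R by rewrite ler1n.
have dR0 : 0 < d%:R :> R by exact: lt_le_trans dR1.
have dd1 : 1 <= d%:R * (d%:R + 1) :> R by rewrite mulr_ege1// (le_trans dR1)// lerDl.
pose rho := (8 / dl + q)^-1.
have rho0 : 0 < rho by rewrite invr_gt0.
(* Beyond distance rho the squared factor of the second bound is at least 1, so the first bound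
   implies it. *)
have [yrho|rhoy] := leP `|y - x| rho; last first.
  apply: le_trans T4 _; rewrite -[leLHS]mulr1; apply: ler_wpM2l.
    by rewrite mulr_ge0// ltW.
  rewrite exprn_ege1// -mulrA mulr_ege1// distrC.
  by rewrite -ler_pdivrMr// mul1r ltW.
have : 0 <= T by exact: spectral_difference_ge0.
rewrite le_eqVlt => /orP[/eqP <-|T0].
  by rewrite mulr_ge0 ?sqr_ge0// mulr_ge0// ltW.
pose c k := f k x - f k y.
pose g := comb r c (f := f).
have gT : T = g x - g y.
  rewrite /T /spectral_difference /g /comb -sumrB; apply: eq_bigr => k _.
  by rewrite -mulrBr expr2.
pose s := Num.sqrt (T * B).
have TB0 : 0 < T * B by rewrite mulr_gt0.
have s0 : 0 < s by rewrite sqrtr_gt0.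
have s2 : s ^+ 2 = T * B by rewrite sqr_sqrtr// ltW.
have r20 : 0 < rho ^+ 2 by rewrite exprn_gt0.
pose N := s * (L + (rho ^+ 2)^-1).
have rhodl : 2 * rho <= dl / 4.
  rewrite /rho ler_pdivrMr// -ler_pdivrMl ?divr_gt0//.
  have -> : (dl / 4)^-1 * 2 = 8 / dl by field; rewrite gt_eqF.
  by rewrite lerDl.
have gH : forall z : 'rV[R]_d, `|z - x| <= 2 * rho ->
    [/\ D z, `|g z| <= s & `|laplacian g z| < N].
  move=> z zx; have zdl := le_trans zx rhodl.
  have Dz : D z.
    by apply: QD; rewrite (le_trans zdl)// ler_pdivrMr// ler_peMr ?ler1n// ltW.
  have TS : (\sum_(k <- r) c k ^+ 2) * S r z <= s ^+ 2.
    by rewrite s2 ler_wpM2l ?(ltW T0)// SB.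
  split; first exact: Dz.
    apply: norm_le_of_sqr; first exact: ltW.
    by apply: le_trans TS; exact: comb_bound.
  apply: (@le_lt_trans _ _ (L * s)); last first.
    by rewrite /N mulrC ltr_pM2l// ltrDl invr_gt0.
  apply: norm_le_of_sqr; first by rewrite mulr_ge0// ltW.
  rewrite exprMn; apply: le_trans (comb_laplacian_bound oD E c Dz rL) _.
  by rewrite ler_wpM2l ?sqr_ge0.
have := coordinate_path_difference oD (@comb_C2 _ _ _ _ _ oD E r c)
  (@comb_continuous _ _ _ _ _ E r c) rho0 gH yrho.
rewrite -/g distrC -gT (gtr0_norm T0) => TN.
have q2 : L = q ^+ 2 by rewrite sqr_sqrtr.
have Lrho : L * rho ^+ 2 <= 1.
  rewrite q2 -exprMn exprn_ile1 ?mulr_ge0 ?(ltW rho0)// ler_pdivrMr// mul1r lerDr.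
  by rewrite divr_ge0// ltW.
have N2 : N * rho / 2 <= s / rho.
  rewrite /N ler_pdivrMr// -!mulrA ler_wpM2l ?(ltW s0)// ler_pdivlMl//.
  have -> : rho * ((L + (rho ^+ 2)^-1) * rho) = L * rho ^+ 2 + 1.
    by field; rewrite gt_eqF.
  by rewrite -[leRHS]/(1 + 1) lerD2r.
have {TN}TN : T <= d%:R * (d%:R + 1) * `|x - y| / rho * s.
  apply: le_trans TN _; rewrite [X in _ <= X](_ : _ =
    d%:R * (`|y - x| * (d%:R * s / rho + s / rho))); last first.
    by rewrite (distrC x y); field; rewrite gt_eqF.
  by rewrite ler_wpM2l// ler_wpM2l// lerD2l.
(* Multiplying by T replaces the division: s^2 = T B. *)
rewrite -(ler_pM2l T0).
have -> : T * (4 * B * (d%:R * (d%:R + 1) * `|x - y| * (8 / dl + q)) ^+ 2) =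
  4 * (d%:R * (d%:R + 1) * `|x - y| / rho * s) ^+ 2.
  by rewrite [in RHS]exprMn s2 /rho invrK; ring.
rewrite -expr2; apply: (@le_trans _ _ ((d%:R * (d%:R + 1) * `|x - y| / rho * s) ^+ 2)).
  by rewrite lerXn2r ?nnegrE// ?(ltW T0)// (le_trans (ltW T0) TN).
by rewrite ler_peMl ?sqr_ge0// ler1n.
Qed.

End interior_estimates.

(** * The boundary barrier *)

Section enorm.
Context {R : realType} {n : nat}.
Implicit Types x : 'rV[R]_n.

Lemma norm_le_enorm x : `|x| <= enorm x.
Proof.
apply: row_norm_le => [|i]; first exact: sqrtr_ge0.
rewrite -sqrtr_sqr /enorm ler_wsqrtr// (bigD1 i)//= lerDl.
by apply: sumr_ge0 => k _; exact: sqr_ge0.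
Qed.

Lemma enorm_le_norm x : enorm x <= n%:R * `|x|.
Proof.
have nn : 0 <= n%:R * `|x| by rewrite mulr_ge0.
apply: le_trans (ler_norm _) _; apply: norm_le_of_sqr => //; rewrite /enorm.
rewrite sqr_sqrtr; last by apply: sumr_ge0 => k _; exact: sqr_ge0.
apply: (@le_trans _ _ (\sum_(i < n) `|x| ^+ 2)).
  apply: ler_sum => i _; rewrite -(real_normK (num_real (x ord0 i))).
  by rewrite lerXn2r ?nnegrE//; exact: coord_le_norm.
rewrite sumr_const card_ord exprMn -[leLHS]mulr_natl ler_wpM2r ?sqr_ge0//.
by rewrite -natrX ler_nat; case: n => // m; rewrite leq_pmulr.
Qed.

End enorm.

Section local_bounds.
Context {R : realType} {n : nat}.

Lemma common_radius (rho : 'I_n -> R) : (forall j, 0 < rho j) ->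
  exists2 r : R, 0 < r & forall j, r <= rho j.
Proof.
(* The + 1 keeps s positive for n = 0, which occurs in dimension d = 1, where the graph has no
   variables. *)
move=> rho0; pose s := \sum_j (rho j)^-1 + 1.
have s1 : 1 <= s by rewrite lerDr sumr_ge0// => j _; rewrite invr_ge0 ltW.
have s0 : 0 < s by exact: lt_le_trans s1.
exists s^-1 => [|j]; first by rewrite invr_gt0.
rewrite -[leRHS]invrK lef_pV2 ?posrE ?invr_gt0//.
rewrite /s (bigD1 j)//= -addrA lerDl addr_ge0// sumr_ge0// => k _.
by rewrite invr_ge0 ltW.
Qed.

(** Besides continuity, what the barrier argument needs from the graph: bounded second differences
    for superharmonicity, and a Lipschitz bound to turn height above the graph into distance. *)
Lemma local_difference (g : 'rV[R]_n -> R) (z0 : 'rV[R]_n) : C2_on setT g ->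
  exists K : R, exists2 rho : R, 0 < rho & 0 <= K /\ forall z t j,
    `|z - z0| < rho -> `|t| < rho ->
    `|g (z + t *: unit_row j) + g (z - t *: unit_row j) - 2 * g z| <= K * t ^+ 2 /\
    `|g (z + t *: unit_row j) - g z| <= K * `|t|.
Proof.
move=> gC.
have /fin_all_exists2[rho rho0 H] : forall j : 'I_n, exists2 rho : R, 0 < rho &
    forall z t, `|z - z0| < rho -> `|t| < rho ->
    `|g (z + t *: unit_row j) + g (z - t *: unit_row j) - 2 * g z| <=
      (`|partial j (partial j g) z0| + `|partial j g z0| + 1) * t ^+ 2 /\
    `|g (z + t *: unit_row j) - g z| <=
      (`|partial j (partial j g) z0| + `|partial j g z0| + 1) * `|t|.
  move=> j; set k2 := partial j (partial j g) z0; set k1 := partial j g z0.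
  have [r1 r10 H1] := second_difference j openT gC (I : setT z0) ltr01.
  have [r2 r20 H2] : exists2 r : R, 0 < r & forall y : 'rV[R]_n, `|y - z0| < r ->
      `|k1 - partial j g y| < 1.
    have [_ /(_ j)[_ /cvgrPdist_lt/(_ _ ltr01) cg] _] := gC z0 I.
    exact: nbhs_row_cube cg.
  pose r := Num.min r1 (r2 / 2).
  have r0 : 0 < r by rewrite lt_min r10 divr_gt0.
  have rr1 : r <= r1 by rewrite ge_min lexx.
  have rr2 : r <= r2 / 2 by rewrite ge_min lexx orbT.
  exists r => // z t zz0 tr; split.
    have := H1 z t (lt_le_trans zz0 rr1) (lt_le_trans tr rr1).
    set A := g _ + _ - _; rewrite -/k2 mul1r => AH.
    rewrite -(subrK (t ^+ 2 * k2) A) (le_trans (ler_normD _ _))//.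
    rewrite normrM (ger0_norm (sqr_ge0 t)) mulrDl mul1r addrC lerD//.
    by rewrite mulrC ler_wpM2r ?sqr_ge0// lerDl.
  have dk (s : R) : is_derive s 1 (fun s : R => g (z + s *: unit_row j))
      (partial j g (z + s *: unit_row j)).
    by apply: derivable_line; have [_ /(_ j)[]] := gC (z + s *: unit_row j) I.
  have [c ct] : exists2 c : R, `|c| <= `|t| & g (z + t *: unit_row j) - g z =
      partial j g (z + c *: unit_row j) * t.
    have cw (a b : R) : {within `[a, b], continuous (fun s : R => g (z + s *: unit_row j))}.
      by apply: derivable_within_continuous => s _; have [] := dk s.
    have [t0|t0] := leP 0 t.
      have [c] := @MVT_segment R _ _ _ _ t0 (fun x _ => dk x) (cw 0 t).
      rewrite in_itv/= => /andP[c0 ct]; rewrite scale0r addr0 subr0 => e; exists c => //.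
      by rewrite !ger0_norm.
    have [c] := @MVT_segment R _ _ _ _ (ltW t0) (fun x _ => dk x) (cw t 0).
    rewrite in_itv/= => /andP[tc c0]; rewrite scale0r addr0 sub0r => e; exists c.
      by rewrite !ler0_norm ?lerN2// ltW.
    by rewrite -opprB e mulrN opprK.
  move=> ->; rewrite normrM ler_wpM2r//.
  have : `|z + c *: unit_row j - z0| < r2.
    rewrite addrAC (le_lt_trans (ler_normD _ _))// norm_scale_unit_row (splitr r2).
    by rewrite ltrD// (lt_le_trans _ rr2)//; exact: le_lt_trans tr.
  move=> /H2 /ltW; rewrite distrC => h; rewrite -addrA ler_wpDl//.
  by rewrite addrC -[X in `|X|](subrK k1) (le_trans (ler_normD _ _))// lerD2r.
have [r r0 rrho] := common_radius rho0.
pose K := \sum_j (`|partial j (partial j g) z0| + `|partial j g z0| + 1).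
have KK j : `|partial j (partial j g) z0| + `|partial j g z0| + 1 <= K.
  by rewrite /K (bigD1 j)//= lerDl sumr_ge0// => i _; rewrite !addr_ge0.
exists K, r => //; split.
  by apply: sumr_ge0 => i _; rewrite !addr_ge0.
move=> z t j zr tr.
have [h1 h2] := H j z t (lt_le_trans zr (rrho j)) (lt_le_trans tr (rrho j)).
split; first by apply: le_trans h1 _; rewrite ler_wpM2r ?sqr_ge0.
by apply: le_trans h2 _; rewrite ler_wpM2r.
Qed.

End local_bounds.

(** * Height above the boundary graph *)

Section graph_function.
Context {R : realType} {n : nat}.
Variables (i : 'I_n) (b : bool) (g : 'rV[R]_n.-1 -> R).

Definition graph_height (x : 'rV[R]_n) : R := (-1) ^+ b * x ord0 i - g (col' i x).

Lemma col'_move_same x (t : R) : col' i (x + t *: unit_row i) = col' i x.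
Proof.
apply/rowP => k; rewrite [LHS]mxE [RHS]mxE move_coordE.
by rewrite eq_sym (negPf (neq_lift _ _)) mulr0 addr0.
Qed.

Lemma col'_move_lift x (t : R) k :
  col' i (x + t *: unit_row (lift i k)) = col' i x + t *: unit_row k.
Proof.
apply/rowP => l; rewrite move_coordE [LHS]mxE [X in _ = X + _]mxE move_coordE.
by rewrite (inj_eq lift_inj).
Qed.

Lemma norm_col' (x : 'rV[R]_n) : `|col' i x| <= `|x|.
Proof. by apply: row_norm_le => // k; rewrite mxE coord_le_norm. Qed.

Lemma graph_height_same x (t : R) :
  graph_height (x + t *: unit_row i) = graph_height x + (-1) ^+ b * t.
Proof. by rewrite /graph_height col'_move_same move_coordE eqxx mulr1; ring. Qed.

Lemma graph_height_lift x (t : R) k : graph_height (x + t *: unit_row (lift i k)) =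
  graph_height x - (g (col' i x + t *: unit_row k) - g (col' i x)).
Proof.
rewrite /graph_height col'_move_lift move_coordE (negPf (neq_lift _ _)) mulr0 addr0; ring.
Qed.

Lemma continuous_graph_height : continuous g -> continuous graph_height.
Proof.
move=> cg.
have cc : continuous (fun x : 'rV[R]_n => col' i x).
  move=> x; apply/(@cvgrPdist_lt _ _ _ (nbhs x) (nbhs_filter x)) => e e0.
  have : nbhs x (ball x e) by exact: nbhsx_ballx.
  apply: filterS => y; rewrite -ball_normE/= => yx.
  rewrite -raddfB/=; exact: le_lt_trans (norm_col' _) yx.
have ccg : continuous (g \o (fun x : 'rV[R]_n => col' i x)).
  by move=> x; apply: continuous_comp; [exact: cc|exact: cg].
have ci : continuous (fun x : 'rV[R]_n => x ord0 i) by exact: coord_continuous.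
move=> x; exact: cvgB (cvgM (cvg_cst _) (ci x)) (ccg x).
Qed.

Definition graph_barrier (B : R) (y : 'rV[R]_n) : R :=
  graph_height y - B * graph_height y ^+ 2.

(* h - B h^2 is superharmonic for large B: the term -2 B from the i-th direction
   beats the curvature of the graph. *)
Lemma graph_barrier_difference (x : 'rV[R]_n) (B K t : R) :
  0 < B -> 0 <= K -> 0 <= graph_height x <= B^-1 ->
  (forall k, `|g (col' i x + t *: unit_row k) + g (col' i x - t *: unit_row k) -
     2 * g (col' i x)| <= K * t ^+ 2) ->
  \sum_(j < n) (graph_barrier B (x + t *: unit_row j) +
    graph_barrier B (x - t *: unit_row j) - 2 * graph_barrier B x) <=
  (n%:R * K - 2 * B) * t ^+ 2.
Proof.
move=> B0 K0 /andP[h0 hB] H; pose h := graph_height x; rewrite -/h in h0 hB.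
rewrite (bigD1 i)//= mulrBl [leRHS]addrC; apply: lerD.
  rewrite /graph_barrier -!(scaleNr t) !graph_height_same -/h.
  have -> : h + (-1) ^+ b * t - B * (h + (-1) ^+ b * t) ^+ 2 +
   (h + (-1) ^+ b * - t - B * (h + (-1) ^+ b * - t) ^+ 2) - 2 * (h - B * h ^+ 2) =
   - (2 * B * t ^+ 2) * ((-1) ^+ b) ^+ 2 by ring.
  by rewrite sqrr_sign mulr1.
have nE : n%:R * K * t ^+ 2 = \sum_(j < n) K * t ^+ 2.
  by rewrite sumr_const card_ord -mulrA mulr_natl.
rewrite nE [leRHS](bigD1 i)//=; apply: ler_wpDl; first by rewrite mulr_ge0 ?sqr_ge0.
apply: ler_sum => j ji; case: (unliftP i j) => [k|] jE; last by rewrite jE eqxx in ji.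
rewrite /graph_barrier jE -!(scaleNr t) !graph_height_lift -/h !(scaleNr t).
set a := g _ - g (col' i x); set a' := g (col' i x - _) - _.
have := H k; have -> : g (col' i x + t *: unit_row k) + g (col' i x - t *: unit_row k) -
     2 * g (col' i x) = a + a' by rewrite /a /a'; ring.
move=> aa'.
have -> : h - a - B * (h - a) ^+ 2 + (h - a' - B * (h - a') ^+ 2) - 2 * (h - B * h ^+ 2) =
  - (1 - 2 * (B * h)) * (a + a') - B * (a ^+ 2 + a' ^+ 2) by ring.
apply: (@le_trans _ _ (- (1 - 2 * (B * h)) * (a + a'))).
  by rewrite gerBl mulr_ge0 ?addr_ge0 ?sqr_ge0// ltW.
apply: le_trans (ler_norm _) _; rewrite normrM normrN.
have Bh : `|1 - 2 * (B * h)| <= 1.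
  have Bh0 : 0 <= B * h by rewrite mulr_ge0// ltW.
  have Bh1 : B * h <= 1 by rewrite -ler_pdivlMl// mulr1.
  by rewrite ler_norml; apply/andP; split; lra.
by apply: le_trans (ler_wpM2r (normr_ge0 _) Bh) _; rewrite mul1r.
Qed.

End graph_function.

(** * Comparison at a global maximum of the spectral sum *)

Section boundary_estimate.
Context {R : realType} {d : nat} {D : set 'rV[R]_d} {lam : nat -> R}
  {f : nat -> 'rV[R]_d -> R}.
Hypotheses (d0 : (0 < d)%N) (oD : open D) (bD : bounded_set D)
  (E : dirichlet_eigensystem D lam f).
Implicit Types (r : seq nat) (c : nat -> R) (x y : 'rV[R]_d).
Local Notation S := (@spectral_sum R d f).

Definition spectral_max r (L : R) x :=
  [/\ uniq r, 0 <= L & forall k, k \in r -> lam k <= L] /\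
  [/\ D x, 0 < S r x & forall y, S r y <= S r x].

(** At a global maximum, u = sum f_k(x) f_k satisfies u(y)^2 <= S(x) S(y) <= S(x)^2, while u(x) =
    S(x): u attains its largest absolute value at x. *)
Lemma comb_max_bound r L x y : spectral_max r L x -> `|comb (f := f) r (f^~ x) y| <= S r x.
Proof.
move=> [_ [_ S0 Sx]]; apply: norm_le_of_sqr; first exact: ltW.
by apply: le_trans (@comb_bound R d f r _ y) _; rewrite expr2 ler_wpM2l// ltW.
Qed.

Lemma comb_max_laplacian r L x y : spectral_max r L x -> D y ->
  `|laplacian (comb (f := f) r (f^~ x)) y| <= L * S r x.
Proof.
move=> [[_ L0 rL] [_ S0 Sx]] Dy; apply: norm_le_of_sqr; first by rewrite mulr_ge0// ltW.
apply: le_trans (comb_laplacian_bound oD E _ Dy rL) _.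
by rewrite exprMn ler_wpM2l ?sqr_ge0// expr2 ler_wpM2l// ltW.
Qed.

(** Explains the constants: B = n K + 1 makes n K - 2 B <= -1, and the terms of C1 absorb the
    Laplacian of u (L M), that of the quadratic part (2 n C2), and leave M against the expansion
    error M / 2. *)
Lemma barrier_contradiction2 (T A lapl M L C1 C2 n K B eps : R) : 0 < T -> 0 < M ->
  0 <= C1 -> 1 <= B -> eps = M / 2 -> B = n * K + 1 ->
  C1 = M * L + 2 * (n * C2) + M ->
  `|A - T * lapl| <= eps * T -> `|lapl| <= L * M ->
  A <= C1 * ((n * K - 2 * B) * T) + C2 * (n * (2 * T)) -> False.
Proof.
move=> T0 M0 C10 B1 -> BE C1E; rewrite ler_norml => /andP[h1 _].
rewrite ler_norml => /andP[h2 _] h3.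
have e1 : T * - (L * M) <= T * lapl by rewrite ler_wpM2l// ltW.
have e2 : C1 * ((n * K - 2 * B) * T) <= - (C1 * T).
  have -> : n * K - 2 * B = - (B + 1) by rewrite BE; ring.
  rewrite mulNr mulrN lerN2 ler_wpM2l// ler_peMl ?(ltW T0)//; lra.
have e3 : C1 * T = T * (L * M) + C2 * (n * (2 * T)) + M * T by rewrite C1E; ring.
have e4 : 0 < M * T by rewrite mulr_gt0.
have e5 : M / 2 * T = (M * T) / 2 by field.
rewrite e5 in h1; rewrite mulrN in e1; lra.
Qed.

Section barrier_comparison.
Variables (i : 'I_d) (b : bool) (g : 'rV[R]_d.-1 -> R) (r : seq nat) (L K rho : R)
  (x : 'rV[R]_d).
Local Notation h := (graph_height i b g).
Let B := d%:R * K + 1.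
Hypotheses (rho0 : 0 < rho) (K0 : 0 <= K) (cg : continuous g) (xmax : spectral_max r L x).
Hypothesis (near_x : forall y, `|y - x| <= rho -> (D y <-> 0 < h y) /\ h y < B^-1).
Hypothesis (near_difference : forall y t j, `|y - x| <= rho -> `|t| < rho ->
  `|g (col' i y + t *: unit_row j) + g (col' i y - t *: unit_row j) -
     2 * g (col' i y)| <= K * t ^+ 2).

(** u is compared on the part of a cube above the graph with C1 (h - B h^2) + C2 |y - x|^2, the last
    norm being Euclidean. On the graph u vanishes, and C2 = M / rho^2 makes the quadratic term at
    least M >= u on the faces of the cube. At y = x the comparison reads M <= C1 h(x), and C1 / M is
    the reciprocal of the stated bound. *)
Lemma height_lower_bound : (L + 2 * d%:R / rho ^+ 2 + 1)^-1 <= h x.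
Proof.
pose u := comb (f := f) r (f^~ x); pose M := S r x.
have [[ur L0 rL] [Dx M0 SM]] := xmax; rewrite -/M in M0.
have r2 : 0 < rho ^+ 2 by rewrite exprn_gt0.
pose C2 := M / rho ^+ 2; pose C1 := M * L + 2 * (d%:R * C2) + M.
have C20 : 0 < C2 by rewrite divr_gt0.
have C10 : 0 < C1.
  have h1 : 0 <= M * L := mulr_ge0 (ltW M0) L0.
  have h2 : 0 <= 2 * (d%:R * C2) := mulr_ge0 (ler0n _ _) (mulr_ge0 (ler0n _ _) (ltW C20)).
  by rewrite ltr_wpDl// addr_ge0.
have B1 : 1 <= B by rewrite lerDr mulr_ge0.
have B0 : 0 < B by exact: lt_le_trans B1.
pose quad y := \sum_k (y ord0 k - x ord0 k) ^+ 2.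
pose psi y := C1 * graph_barrier i b g B y + C2 * quad y.
pose F y := u y - psi y.
have ch : continuous h by exact: continuous_graph_height.
have cu : continuous u by exact: comb_continuous E r (f^~ x).
have cq : continuous quad.
  move=> y; apply: (@cvg_sumr R _ _ (nbhs y)) => k _.
  have c1 : continuous (fun y : 'rV[R]_d => y ord0 k - x ord0 k).
    have ci : continuous (fun x : 'rV[R]_d => x ord0 k) by exact: coord_continuous.
    by move=> z; exact: cvgB (ci z) (cvg_cst _).
  under eq_fun do rewrite expr2.
  by rewrite expr2; exact: (cvgM (c1 y) (c1 y)).
have cb : continuous (graph_barrier i b g B).
  have -> : graph_barrier i b g B = (fun y => h y - B * (h y * h y)).
    by apply/funext => y; rewrite /graph_barrier expr2.
  by move=> y; exact: (cvgB (ch y) (cvgM (cvg_cst _) (cvgM (ch y) (ch y)))).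
have cF : continuous F.
  move=> y; exact: (cvgB (cu y) (cvgD (cvgM (cvg_cst _) (cb y)) (cvgM (cvg_cst _) (cq y)))).
pose Q := [set y : 'rV[R]_d | `|y - x| <= rho] `&` [set y | 0 <= h y].
have cQ : compact Q.
  apply: compact_closedI; first by apply: compact_row_cube; exact: ltW.
  apply: (@closed_comp _ _ h [set v : R | 0 <= v]) => [y _|]; first exact: ch.
  exact: closed_ge.
have xx : `|x - x| <= rho by rewrite subrr normr0 ltW.
have hx : 0 < h x by exact/(near_x xx).1.
have Qx : Q x by split => //; exact: ltW.
have [c] : exists2 c, c \in Q & forall y, y \in Q -> F y <= F c.
  by apply: compact_EVT_max => //; [exists x|exact: continuous_subspaceT].
rewrite inE => Qc Fc; have {}Fc y : Q y -> F y <= F c by move=> ?; apply: Fc; rewrite inE.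
have gb_ge0 y : 0 <= h y -> h y < B^-1 -> 0 <= graph_barrier i b g B y.
  move=> h1 h2; rewrite /graph_barrier.
  have -> : h y - B * h y ^+ 2 = h y * (1 - B * h y) by ring.
  by rewrite mulr_ge0// subr_ge0 -ler_pdivlMl// mulr1 ltW.
suff Fc0 : F c <= 0.
  have := le_trans (Fc _ Qx) Fc0; rewrite /F subr_le0.
  have -> : u x = M by apply: eq_bigr => k _; rewrite expr2.
  rewrite /psi /quad big1 ?mulr0 ?addr0; last by move=> k _; rewrite subrr expr0n.
  move=> Mpsi; have {}Mpsi : M <= C1 * h x.
    apply: le_trans Mpsi _; rewrite ler_wpM2l ?(ltW C10)// /graph_barrier gerBl.
    by rewrite mulr_ge0 ?sqr_ge0// ltW.
  have C1E : C1 = M * (L + 2 * d%:R / rho ^+ 2 + 1).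
    by rewrite /C1 /C2; field; rewrite gt_eqF.
  move: Mpsi; rewrite C1E -mulrA -{1}[M]mulr1 ler_pM2l// => Mpsi.
  rewrite -div1r ler_pdivrMr//; first by rewrite mulrC.
  by rewrite ltr_wpDl// addr_ge0// divr_ge0 ?mulr_ge0// ltW.
rewrite leNgt; apply/negP => Fc0; have [/= cx hc] := Qc.
have [Dc hcB] := near_x cx.
have gb0 := gb_ge0 _ hc hcB.
have q0 : 0 <= quad c by apply: sumr_ge0 => k _; exact: sqr_ge0.
have psi0 : 0 <= psi c by rewrite addr_ge0// mulr_ge0// ltW.
have uM : u c <= M by apply: le_trans (ler_norm _) (comb_max_bound _ xmax).
(* On the graph c is outside D, where the eigenfunctions vanish, so u cannot exceed the nonnegative
   barrier. *)
have hc0 : 0 < h c.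
  rewrite lt_neqAle hc andbT; apply/negP => /eqP hc0.
  have uc : u c = 0.
    rewrite /u /comb big1// => k _; rewrite (_ : f k c = 0) ?mulr0//.
    by apply: (eigenfun_out E) => /Dc; rewrite -hc0 ltxx.
  by move: Fc0; rewrite /F uc sub0r oppr_gt0 ltNge psi0.
have cin k : `|c ord0 k - x ord0 k| < rho.
  rewrite ltNge; apply/negP => ck; move: Fc0; rewrite ltNge => /negP; apply.
  rewrite /F subr_le0; apply: le_trans uM _; rewrite /psi ler_wpDl ?mulr_ge0 ?(ltW C10)//.
  have -> : M = C2 * rho ^+ 2 by rewrite /C2 divfK// gt_eqF.
  rewrite ler_wpM2l ?(ltW C20)// /quad (bigD1 k)//= ler_wpDr//.
    by apply: sumr_ge0 => j _; exact: sqr_ge0.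
  rewrite -(real_normK (num_real (c ord0 k - x ord0 k))).
  by rewrite lerXn2r ?nnegrE// ltW.
have {}Dc : D c by exact/Dc.
have [r4 r40 Hr4] : exists2 r4 : R, 0 < r4 & forall y, `|y - c| < r4 -> 0 < h y.
  apply: nbhs_row_cube; have := ch c.
  by move/(_ [set v : R | 0 < v]); apply; exact: lt_nbhsr hc0.
have Qmove : \forall t \near (0 : R)^'+, forall j : 'I_d,
    Q (c + t *: unit_row j) /\ Q (c - t *: unit_row j).
  apply: filter_forall => j.
  have r0 : 0 < rho - `|c ord0 j - x ord0 j| by rewrite subr_gt0.
  near=> t.
  have t0 : 0 < t by [].
  have ta : t < rho - `|c ord0 j - x ord0 j| by near: t; exact: nbhs_right_lt.
  have ti : t < r4 by near: t; exact: nbhs_right_lt.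
  suff key s : `|s| <= t -> Q (c + s *: unit_row j).
    by split; [|rewrite -scaleNr]; apply: key; rewrite ?normrN gtr0_norm.
  move=> st; split => /=.
    apply/row_cubeP => [|k]; first exact: ltW.
    rewrite move_coordE; case: (eqVneq k j) => [->|_].
      rewrite mulr1 addrAC (le_trans (ler_normD _ _))// -lerBrDl.
      exact: le_trans st (ltW ta).
    by rewrite mulr0 addr0 ltW.
  by apply/ltW/Hr4; rewrite addrC addKr norm_scale_unit_row (le_lt_trans st).
have eps0 : 0 < M / 2 by rewrite divr_gt0.
have uC : C2_on D u by exact: comb_C2 oD E r (f^~ x).
have e1 := laplacian_expansion oD uC Dc eps0.
have [t [[[t0 {}e1] {}Qmove] trho]] :=
  filter_ex (filterI (filterI (filterI (nbhs_right_gt 0) e1) Qmove) (nbhs_right_lt rho0)).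
have t2 : 0 < t ^+ 2 by rewrite exprn_gt0.
apply: (barrier_contradiction2 t2 M0 (ltW C10) B1 erefl erefl erefl e1
  (comb_max_laplacian xmax Dc)).
have -> : d%:R * (2 * t ^+ 2) = \sum_(j < d)
    (quad (c + t *: unit_row j) + quad (c - t *: unit_row j) - 2 * quad c).
  transitivity (\sum_(j < d) (2 * t ^+ 2)).
    by rewrite sumr_const card_ord mulr_natl.
  apply: eq_bigr => j _.
  rewrite (separable_second_difference (fun k v => (v - x ord0 k) ^+ 2)); ring.
apply: (@le_trans _ _ (\sum_(j < d)
    (psi (c + t *: unit_row j) + psi (c - t *: unit_row j) - 2 * psi c))).
  apply: ler_sum => j _; have [/Fc h1 /Fc h2] := Qmove j; rewrite -subr_le0.
  have -> : u (c + t *: unit_row j) + u (c - t *: unit_row j) - 2 * u c -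
    (psi (c + t *: unit_row j) + psi (c - t *: unit_row j) - 2 * psi c) =
    F (c + t *: unit_row j) + F (c - t *: unit_row j) - (F c + F c).
    by rewrite /F; ring.
  by rewrite subr_le0 lerD.
have -> : \sum_(j < d)
    (psi (c + t *: unit_row j) + psi (c - t *: unit_row j) - 2 * psi c) =
  C1 * (\sum_(j < d) (graph_barrier i b g B (c + t *: unit_row j) +
    graph_barrier i b g B (c - t *: unit_row j) - 2 * graph_barrier i b g B c)) +
  C2 * (\sum_(j < d) (quad (c + t *: unit_row j) + quad (c - t *: unit_row j) - 2 * quad c)).
  rewrite [X in _ = X + _]mulr_sumr [X in _ = _ + X]mulr_sumr -big_split.
  by apply: eq_bigr => j _ /=; rewrite /psi; ring.
rewrite lerD2r ler_wpM2l ?(ltW C10)//; apply: graph_barrier_difference => //.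
  by rewrite hc ltW.
by move=> k; apply: near_difference => //; rewrite gtr0_norm.
Unshelve. all: by end_near. Qed.

End barrier_comparison.

End boundary_estimate.

(** * Global bound for spectral sums *)

Section global_estimate.
Context {R : realType} {d : nat} {D : set 'rV[R]_d} {lam : nat -> R}
  {f : nat -> 'rV[R]_d -> R}.
Hypotheses (d0 : (0 < d)%N) (oD : open D) (bD : bounded_set D)
  (bdD : C2_boundary D) (E : dirichlet_eigensystem D lam f).
Implicit Types (r : seq nat) (c : nat -> R) (x y : 'rV[R]_d).
Local Notation S := (@spectral_sum R d f).
Local Notation spectral_max := (@spectral_max R d D lam f).

Lemma graph_height_lipschitz (i : 'I_d) b (g : 'rV[R]_d.-1 -> R) (x y : 'rV[R]_d) (K : R) :
  0 <= K ->
  (forall w t k, `|w - x| <= `|y - x| -> `|t| <= `|y - x| ->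
     `|g (col' i w + t *: unit_row k) - g (col' i w)| <= K * `|t|) ->
  `|graph_height i b g y - graph_height i b g x| <= d%:R * ((K + 1) * `|y - x|).
Proof.
move=> K0 H; apply: coordinate_path_bound; last by rewrite addr_ge0.
move=> j w t wx _ tx; case: (unliftP i j) => [k|] ->.
  rewrite graph_height_lift addrAC subrr add0r normrN.
  by apply: le_trans (H w t k wx tx) _; rewrite ler_wpM2r// lerDl.
rewrite graph_height_same addrAC subrr add0r normrM normrX normrN1 expr1n mul1r.
by rewrite ler_peMl// lerDr.
Qed.

(** Rests on L + a + 1 <= (1 + a) (1 + L), which separates L from the constants of the boundary
    chart. *)
Lemma gap_constant_lt (L a k q kappa : R) : 0 <= L -> 0 <= a -> 0 < q ->
  kappa * (q * (1 + a)) <= 2^-1 -> k <= kappa / (1 + L) -> 0 < kappa ->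
  q * k < (L + a + 1)^-1.
Proof.
move=> L0 a0 q0 H hk k0.
have p1 : 0 < 1 + L by rewrite ltr_pwDl.
have p2 : 0 < L + a + 1 by rewrite ltr_wpDl// addr_ge0.
rewrite -[ltRHS]div1r ltr_pdivlMr//.
apply: (@le_lt_trans _ _ (q * (kappa / (1 + L)) * ((1 + a) * (1 + L)))).
  apply: (@le_trans _ _ (q * (kappa / (1 + L)) * (L + a + 1))).
    by rewrite ler_wpM2r ?(ltW p2)// ler_wpM2l// ltW.
  rewrite ler_wpM2l//.
    by rewrite mulr_ge0 ?(ltW q0)// divr_ge0 ?(ltW k0) ?(ltW p1).
  have : 0 <= a * L by rewrite mulr_ge0.
  have -> : (1 + a) * (1 + L) = 1 + a + L + a * L by ring.
  lra.
have -> : q * (kappa / (1 + L)) * ((1 + a) * (1 + L)) = kappa * (q * (1 + a)).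
  by field; rewrite gt_eqF.
by apply: le_lt_trans H _; lra.
Qed.

(** Near a boundary point, x lies at height at least 1/(L + a + 1) by the barrier, and the height is
    Lipschitz, so a cube of side comparable to 1/(1 + L) about x remains above the graph. *)
Lemma boundary_gap (x0 : 'rV[R]_d) : closure D x0 -> exists2 kappa : R, 0 < kappa &
  \forall x \near x0, forall r L, spectral_max r L x ->
    forall y, `|y - x| <= kappa / (1 + L) -> D y.
Proof.
have div_le (kappa L : R) : 0 <= kappa -> 0 <= L -> kappa / (1 + L) <= kappa.
  by move=> k0 L0; rewrite ler_pdivrMr ?ltr_pwDl// ler_peMr// lerDl.
have near_cube (rho : R) : 0 < rho -> \forall x \near x0, `|x - x0| < rho.
  move=> rho0; have : nbhs x0 (ball x0 rho) by exact: nbhsx_ballx.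
  by apply: filterS => x; rewrite -ball_normE/= distrC.
move=> clx0; have [Dx0|nDx0] := pselect (D x0).
  have [rho rho0 H] := nbhs_row_cube (open_nbhs_nbhs (conj oD Dx0)).
  have rho20 : 0 < rho / 2 by rewrite divr_gt0.
  exists (rho / 2) => //.
  apply: filterS (near_cube _ rho20) => x xx0 r L [[_ L0 _] _] y yx; apply: H.
  rewrite -(subrKA x) (splitr rho) (le_lt_trans (ler_normD _ _))// ler_ltD//.
  by apply: le_trans yx (div_le _ _ _ L0); exact: ltW.
have [r0 [i [b [g [r00 gC HD]]]]] := bdD (conj clx0 nDx0).
pose h := graph_height i b g.
have cg : continuous g by move=> z; have [] := gC z I.
have ch : continuous h by exact: continuous_graph_height.
have Dh x : `|x - x0| < r0 / d%:R -> D x <-> 0 < h x.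
  move=> xx0; rewrite /h /graph_height subr_gt0; apply: HD.
  apply: le_lt_trans (enorm_le_norm _) _.
  by rewrite mulrC -ltr_pdivlMr// ltr0n.
have [K [r1 r10 [K0 H1]]] := local_difference (col' i x0) gC.
pose B := d%:R * K + 1.
have B0 : 0 < B by rewrite ltr_wpDl// mulr_ge0.
have rd0 : 0 < r0 / d%:R by rewrite divr_gt0// ltr0n.
have hx0 : h x0 <= 0.
  rewrite leNgt; apply/negP => hx0; apply: nDx0.
  by apply/Dh => //; rewrite subrr normr0.
have [r2 r20 H2] : exists2 r2 : R, 0 < r2 & forall y, `|y - x0| < r2 -> h y < B^-1.
  apply: nbhs_row_cube; have := ch x0.
  move/(_ [set v : R | v < B^-1]); apply; apply: lt_nbhsl.
  by apply: le_lt_trans hx0 _; rewrite invr_gt0.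
(* A third of the common radius: x lies within rho of x0 and the comparison cube has radius rho
   about x. *)
pose rho := Num.min (r0 / d%:R) (Num.min r1 r2) / 3.
have rho0 : 0 < rho by rewrite divr_gt0// !lt_min rd0 r10 r20.
have rho3 : 3 * rho = Num.min (r0 / d%:R) (Num.min r1 r2) by rewrite /rho; field.
have rhor0 : 3 * rho <= r0 / d%:R by rewrite rho3 ge_min lexx.
have rhor1 : 3 * rho <= r1 by rewrite rho3 !ge_min lexx orbT.
have rhor2 : 3 * rho <= r2 by rewrite rho3 !ge_min lexx !orbT.
pose a := 2 * d%:R / rho ^+ 2.
have a0 : 0 <= a by rewrite divr_ge0 ?sqr_ge0// mulr_ge0.
pose q := d%:R * (K + 1).
have q0 : 0 < q by rewrite mulr_gt0 ?ltr0n// ltr_wpDl.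
have qa0 : 0 < q * (1 + a) by rewrite mulr_gt0// ltr_pwDl.
pose kappa := Num.min rho (2 * (q * (1 + a)))^-1.
have kappa0 : 0 < kappa by rewrite lt_min rho0 invr_gt0 mulr_gt0.
have kapparho : kappa <= rho by rewrite ge_min lexx.
have kappaq : kappa * (q * (1 + a)) <= 2^-1.
  apply: (@le_trans _ _ ((2 * (q * (1 + a)))^-1 * (q * (1 + a)))).
    by rewrite ler_wpM2r ?(ltW qa0)// ge_min lexx orbT.
  by rewrite invfM divfK// gt_eqF.
exists kappa => //; apply: filterS (near_cube _ rho0) => x xx0 r L xmax y yx.
have [[_ L0 _] [Dx _ _]] := xmax.
have yrho : `|y - x| <= rho.
  by apply: le_trans yx (le_trans (div_le _ _ _ L0) kapparho); exact: ltW.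
have near3 (z : 'rV[R]_d) : `|z - x| <= rho -> `|z - x0| < 3 * rho.
  move=> zx; rewrite -(subrKA x) (le_lt_trans (ler_normD _ _))//.
  apply: lt_le_trans (ler_ltD zx xx0) _.
  have -> : rho + rho = 2 * rho by ring.
  by rewrite ler_wpM2r ?(ltW rho0)// ler_nat.
have rho13 : rho <= 3 * rho by rewrite ler_peMl ?(ltW rho0)// ler1n.
have ncol (z : 'rV[R]_d) : `|z - x| <= rho -> `|col' i z - col' i x0| < r1.
  move=> /near3 zx; rewrite -raddfB/=; apply: le_lt_trans (norm_col' _ _) _.
  exact: lt_le_trans rhor1.
have hx : (L + a + 1)^-1 <= h x.
  apply: (height_lower_bound oD E rho0 K0 cg xmax).
    move=> z /near3 zx; split; first by apply: Dh; exact: lt_le_trans rhor0.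
    by apply: H2; exact: lt_le_trans rhor2.
  move=> z t j zx trho; apply: (H1 _ _ j (ncol _ zx) _).1.
  exact: lt_le_trans trho (le_trans rho13 rhor1).
apply/Dh; first exact: lt_le_trans (near3 _ yrho) rhor0.
have : `|h y - h x| <= d%:R * ((K + 1) * `|y - x|).
  apply: graph_height_lipschitz => // w t k wx tx.
  apply: (H1 _ _ k (ncol _ (le_trans wx yrho)) _).2.
  apply: le_lt_trans tx (le_lt_trans yrho (lt_le_trans _ rhor1)).
  by rewrite ltr_pMl// ltr1n.
rewrite ler_distl mulrA -/q => /andP[+ _]; apply: lt_le_trans; rewrite subr_gt0.
exact: lt_le_trans (gap_constant_lt L0 a0 q0 kappaq yx kappa0) hx.
Qed.

(** The property is monotone in kappa, so compactness of the closure turns the local constants into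
    a single one. *)
Lemma uniform_boundary_gap : exists2 kappa : R, 0 < kappa &
  forall r L x, spectral_max r L x -> forall y, `|y - x| <= kappa / (1 + L) -> D y.
Proof.
have cK : compact (closure D).
  apply: bounded_closed_compact; last exact: closed_closure.
  have [A A0 DA] := bounded_cube bD.
  exists A; split; first exact: num_real.
  move=> M AM x clx /=; rewrite leNgt; apply/negP => Mx.
  have : nbhs x (ball x (`|x| - M)) by apply: nbhsx_ballx; rewrite subr_gt0.
  move=> /clx[y [Dy]]; rewrite -ball_normE/= => xy.
  have := DA _ Dy; rewrite subr0 leNgt => /negP; apply.
  have := ler_normD (x - y) y; rewrite subrK => h; apply: lt_trans AM _.
  by rewrite -subr_gt0; move: h xy; rewrite -subr_ge0 -[_ < _ - M]subr_gt0; lra.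
have /compact_near_coveringP/(_ R (0 : R)^'+
  (fun kappa x => forall r L, spectral_max r L x ->
     forall y, `|y - x| <= kappa / (1 + L) -> D y)) := cK.
case=> [x clx|].
  have [kappa kappa0 H] := boundary_gap clx.
  near=> x' k => /= r L xm y yx.
  have H' : forall r L, spectral_max r L x' ->
    forall y, `|y - x'| <= kappa / (1 + L) -> D y by near: x'.
  apply: (H' r L xm); apply: le_trans yx _.
  have [[_ L0 _] _] := xm.
  by rewrite ler_pM2r ?invr_gt0 ?ltr_pwDl//; near: k; exact: nbhs_right_le.
move=> kappa [/= kappa0] H; exists (kappa / 2); first by rewrite divr_gt0.
move=> r L x xm y yx; apply: (H (kappa / 2)) (xm) _ yx => //=.
- rewrite sub0r normrN ger0_norm ?divr_ge0 ?(ltW kappa0)//.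
  by rewrite ltr_pdivrMr// ltr_pMr// ltr1n.
- by rewrite divr_gt0.
- by apply: subset_closure; have [_ []] := xm.
Unshelve. all: by end_near. Qed.

(** S vanishes off D, so its maximum over a large cube is global and lies at depth kappa/(1 + L).
    There the mass bound applies with A = 1 and rho of order 1/(1 + L), whence the power d in place
    of d/2. *)
Lemma spectral_sum_global : exists2 C : R, 0 < C & forall r L, uniq r ->
  (forall k, k \in r -> lam k <= L) -> 0 <= L -> forall x, S r x <= C * (1 + L) ^+ d.
Proof.
have [kappa kappa0 H] := uniform_boundary_gap.
(* The half gives 2 rho <= kappa / (1 + L), and the cap at 1 gives L rho^2 <= 1. *)
pose k1 := Num.min (kappa / 2) 1.
have k10 : 0 < k1 by rewrite lt_min divr_gt0//=.
have dR0 : 0 < d%:R :> R by rewrite ltr0n.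
pose q := d%:R * (d%:R + 1) / k1.
have q0 : 0 < q by rewrite divr_gt0// mulr_gt0// addr_gt0.
exists (4 * q ^+ d); first by rewrite mulr_gt0// exprn_gt0.
move=> r L ur rL L0 x0.
have p0 : 0 < 1 + L by rewrite ltr_pwDl.
have [A A0 DA] := bounded_cube bD.
pose Q := [set y : 'rV[R]_d | `|y - 0| <= A].
have cQ : compact Q by apply: compact_row_cube; exact: ltW.
have [x] : exists2 x, x \in Q & forall y, y \in Q -> S r y <= S r x.
  apply: compact_EVT_max => //; first by exists 0; rewrite /Q/= subrr normr0 ltW.
  by apply: continuous_subspaceT; exact: spectral_sum_continuous E r.
rewrite inE => Qx Sx.
have S0 y : ~ D y -> S r y = 0.
  by move=> nD; rewrite /S big1// => k _; rewrite (eigenfun_out E)// expr0n.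
have {}Sx y : S r y <= S r x.
  have [Dy|nD] := pselect (D y); first by apply: Sx; rewrite inE; exact: DA.
  by rewrite S0// spectral_sum_ge0.
apply: le_trans (Sx x0) _.
have : 0 <= S r x by exact: spectral_sum_ge0.
rewrite le_eqVlt => /orP[/eqP <-|Sx0].
  by rewrite !mulr_ge0// exprn_ge0// ltW.
have Dx : D x by apply: contrapT => nD; rewrite S0// ltxx in Sx0.
have xm : spectral_max r L x by split; split.
pose rho := k1 / (1 + L).
have rho0 : 0 < rho by rewrite divr_gt0.
have Lrho : L * rho ^+ 2 <= 1.
  have rho1 : rho <= (1 + L)^-1.
    by rewrite /rho -[leRHS]mul1r ler_wpM2r ?invr_ge0 ?(ltW p0)// ge_min lexx orbT.
  apply: (@le_trans _ _ (L * (1 + L)^-1 ^+ 2)).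
    by rewrite ler_wpM2l// lerXn2r ?nnegrE ?(ltW rho0)// invr_ge0 ltW.
  rewrite exprVn ler_pdivrMr ?exprn_gt0// mul1r expr2.
  have : L <= 1 + L by rewrite lerDr.
  by move=> h; rewrite (le_trans h)// ler_peMl ?(ltW p0)// lerDl.
have Hx y : `|y - x| <= 2 * rho -> D y /\ S r y <= 1 * S r x.
  move=> yx; split; last by rewrite mul1r.
  apply: (H _ _ _ xm); apply: le_trans yx _.
  rewrite /rho mulrA ler_wpM2r ?invr_ge0 ?(ltW p0)// -ler_pdivlMl//.
  by rewrite mulrC ge_min lexx.
have := spectral_mass_bound d0 oD bD E ur rL L0 rho0 Lrho (lexx 1) Hx.
have -> : rho / (d%:R * (d%:R + 1) * 1) = (q * (1 + L))^-1.
  rewrite /rho /q; field; rewrite !gt_eqF// ?addr_gt0//.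
have q1 : 0 < (q * (1 + L)) ^+ d by rewrite exprn_gt0// mulr_gt0.
by rewrite exprVn ler_pdivrMr// (exprMn d q) mulrA.
Qed.

End global_estimate.

(** * Decay of the heat kernel *)

Lemma series_iota (V : zmodType) (u : nat -> V) N :
  series u N = \sum_(k <- iota 0 N) u k.
Proof. by rewrite seriesEnat /index_iota/= subn0. Qed.

Section inverse_squares.
Context {R : realType}.

Definition inv_sq (n : nat) : R := (n.+1%:R ^+ 2)^-1.

Lemma inv_sq_gt0 n : 0 < inv_sq n.
Proof. by rewrite invr_gt0 exprn_gt0. Qed.

(** Telescoping: 1/(k+1)^2 <= 1/k - 1/(k+1). *)
Lemma inv_sq_sum N : series inv_sq N.+1 <= 2 - N.+1%:R^-1.
Proof.
elim: N => [|N IH].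
  by rewrite seriesSr seriesEnat/= big_geq// add0r /inv_sq expr1n invr1; lra.
rewrite seriesSr; apply: le_trans (lerD IH (lexx _)) _; rewrite /inv_sq.
have p : 0 < N.+1%:R :> R by [].
have e : N.+2%:R = N.+1%:R + 1 :> R by rewrite -natr1.
rewrite e; set a := N.+1%:R in p *.
have a1 : 0 < a + 1 by rewrite addr_gt0.
rewrite -subr_ge0.
have -> : 2 - (a + 1)^-1 - (2 - a^-1 + ((a + 1) ^+ 2)^-1) = (a * (a + 1) ^+ 2)^-1.
  by field; rewrite !gt_eqF.
by rewrite invr_ge0 mulr_ge0 ?sqr_ge0 ?(ltW p).
Qed.

Lemma inv_sq_cvg : cvgn (series inv_sq).
Proof.
apply: nondecreasing_is_cvgn.
  by apply: nondecreasing_series => n _ _; exact/ltW/inv_sq_gt0.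
exists 2 => _ [n _ <-]; case: n => [|n]; first by rewrite seriesEnat/= big_geq.
by apply: le_trans (inv_sq_sum n) _; rewrite gerBl.
Qed.

Definition inv_sq_tail (N : nat) : R := limn (series inv_sq) - series inv_sq N.

Lemma inv_sq_tail_cvg0 : inv_sq_tail @ \oo --> (0 : R).
Proof.
rewrite -(subrr (limn (series inv_sq))).
exact: cvgB (cvg_cst _) inv_sq_cvg.
Qed.

Lemma dominated_series_cvg (u : nat -> R) (B : R) :
  (forall n, `|u n| <= B * inv_sq n) -> cvgn (series u).
Proof.
move=> uB; apply: normed_cvg.
apply: (@series_le_cvg _ (fun n => `|u n|) (fun n => B * inv_sq n)) => //.
  by move=> n; exact: le_trans (uB n).
have -> : (fun n => B * inv_sq n) = B *: inv_sq by [].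
by apply: is_cvg_seriesZ; exact: inv_sq_cvg.
Qed.

Lemma dominated_series_tail (u : nat -> R) (B : R) (N : nat) :
  (forall n, `|u n| <= B * inv_sq n) ->
  `|limn (series u) - series u N| <= B * inv_sq_tail N.
Proof.
move=> uB; have cu := dominated_series_cvg uB.
have h1 : (fun m => `|series u m - series u N|) @ \oo --> `|limn (series u) - series u N|.
  by apply: cvg_norm; exact: cvgB cu (cvg_cst _).
have h2 : (fun m => B * (series inv_sq m - series inv_sq N)) @ \oo --> B * inv_sq_tail N.
  exact: cvgM (cvg_cst _) (cvgB inv_sq_cvg (cvg_cst _)).
apply: (ler_cvg_to h1 h2); exists N => // m /= Nm.
rewrite !sub_series Nm mulr_sumr (le_trans (ler_norm_sum _ _ _))//.
exact: ler_sum.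
Qed.

Lemma bounded_weighted (u B : R) n : n.+1%:R ^+ 2 * `|u| <= B -> `|u| <= B * inv_sq n.
Proof. by rewrite /inv_sq ler_pdivlMr ?exprn_gt0// mulrC. Qed.

End inverse_squares.

(** * Eigenvalue growth and the heat kernel as a test function *)

Section spectral_growth.
Context {R : realType} {d : nat} {D : set 'rV[R]_d} {lam : nat -> R}
  {f : nat -> 'rV[R]_d -> R}.
Hypotheses (d0 : (0 < d)%N) (oD : open D) (bD : bounded_set D)
  (bdD : C2_boundary D) (E : dirichlet_eigensystem D lam f).
Implicit Types (x y : 'rV[R]_d).

Let lam0 n : 0 < lam n. Proof. exact: eigenvalue_gt0 E n. Qed.
Let lam1 n : 1 <= 1 + lam n. Proof. by rewrite lerDl ltW. Qed.
Let lamp n m : 0 < (1 + lam n) ^+ m. Proof. by rewrite exprn_gt0// ltr_pwDl// ltW. Qed.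

Let fc k : continuous (f k). Proof. exact: (@eigenfun_continuous _ _ _ _ _ E k). Qed.

(** A weak form of Weyl's law: the integral over D of the sum of the first n + 1 squares f_k^2 is n
    + 1, while the integrand is at most C (1 + lam n)^d. *)
Lemma eigenvalue_growth : exists2 C : R, 0 < C &
  forall n, n.+1%:R <= C * (1 + lam n) ^+ d.
Proof.
have [C C0 H] := spectral_sum_global d0 oD bD bdD E.
pose V := L2_inner D (fun x => `|1 : R|) (fun=> 1).
exists (C * (`|V| + 1)); first by rewrite mulr_gt0// ltr_wpDl.
move=> n; pose r := iota 0 n.+1.
have c2 k : continuous (fun x => f k x * f k x).
  by move=> x; exact: (cvgM (@fc k x) (@fc k x)).
have c1 : continuous (fun _ : 'rV[R]_d => 1 : R) by exact: cst_continuous.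
have SE : L2_inner D (fun x => \sum_(k <- r) 1 * (f k x * f k x)) (fun=> 1) = n.+1%:R.
  rewrite (L2_inner_sum oD bD r (fun=> 1) c2 c1) (eq_bigr (fun=> 1)).
    by rewrite big_const_seq count_predT size_iota iter_addr_0.
  move=> k _; rewrite mul1r; have := eigenfun_orthonormal E k k; rewrite eqxx => e.
  apply: etrans e.
  by apply: eq_Rintegral => z _ /=; rewrite mulr1.
have SB x : D x -> `|\sum_(k <- r) 1 * (f k x * f k x)| <= C * (1 + lam n) ^+ d.
  move=> _; have -> : \sum_(k <- r) 1 * (f k x * f k x) = spectral_sum (f := f) r x.
    by apply: eq_bigr => k _; rewrite mul1r expr2.
  rewrite ger0_norm ?spectral_sum_ge0//; apply: H; first exact: iota_uniq.
    by move=> k; rewrite mem_iota add0n => /andP[_ kn]; exact: (eigenvalue_le E).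
  exact: ltW.
have cS : continuous (fun x => \sum_(k <- r) 1 * (f k x * f k x)).
  exact: (@continuous_comb R d nat r (fun=> 1) _ c2).
have := L2_inner_bound oD bD cS c1 SB; rewrite SE => /(le_trans (ler_norm _)).
rewrite -/V => /le_trans; apply.
rewrite [leLHS]mulrAC ler_wpM2r ?(ltW (lamp _ _))// ler_wpM2l ?(ltW C0)//.
by rewrite (le_trans (ler_norm _))// lerDl.
Qed.

Lemma eigenfun_bound : exists2 C : R, 0 < C &
  forall n x, `|f n x| <= C * (1 + lam n) ^+ d.
Proof.
have [C C0 H] := spectral_sum_global d0 oD bD bdD E.
exists (1 + C); first by rewrite addr_gt0.
move=> n x.
have fx : `|f n x| ^+ 2 <= C * (1 + lam n) ^+ d.
  have := H [:: n] (lam n) isT _ (ltW (lam0 n)) x.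
  rewrite /spectral_sum big_seq1 real_normK ?num_real//; apply.
  by move=> k; rewrite inE => /eqP ->.
(* a <= 1 + a^2 avoids the square root; the exponent is not meant to be sharp. *)
apply: (@le_trans _ _ (1 + `|f n x| ^+ 2)).
  have := normr_ge0 (f n x); set a := `|f n x| => a0.
  have := sqr_ge0 (a - 1); have -> : (a - 1) ^+ 2 = a ^+ 2 - 2 * a + 1 by ring.
  lra.
rewrite mulrDl mul1r lerD//.
by rewrite exprn_ege1.
Qed.

Lemma exp_polynomial_decay (t : R) (m : nat) : 0 < t ->
  exists2 B : R, 0 < B & forall l : R, 0 <= l -> (1 + l) ^+ m * expR (- l * t) <= B.
Proof.
(* 1 + z <= exp z at z = (1 + l) t / N, raised to the power N; m + 1 rather than m so that N is
   nonzero. *)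
move=> t0; pose N := m.+1; pose B := (N%:R / t) ^+ N * expR t.
have N0 : 0 < N%:R :> R by [].
exists B; first by rewrite mulr_gt0 ?expR_gt0// exprn_gt0// divr_gt0.
move=> l l0; have l1 : 1 <= 1 + l by rewrite lerDl.
have p0 : 0 < 1 + l by exact: lt_le_trans l1.
have h : (1 + l) ^+ N * (t / N%:R) ^+ N <= expR ((1 + l) * t).
  rewrite -exprMn mulrA.
  have -> : expR ((1 + l) * t) = expR ((1 + l) * t / N%:R) ^+ N.
    by rewrite -expRM_natl; congr expR; field; rewrite gt_eqF.
  rewrite lerXn2r ?nnegrE ?expR_ge0 ?divr_ge0 ?mulr_ge0 ?(ltW p0) ?(ltW t0)//.
  by apply: le_trans (expR_ge1Dx _); rewrite lerDr.
apply: (@le_trans _ _ ((1 + l) ^+ N * expR (- l * t))).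
  by rewrite ler_wpM2r ?expR_ge0// ler_weXn2l.
have -> : - l * t = t - (1 + l) * t by ring.
rewrite expRD expRN mulrA ler_pdivrMr ?expR_gt0// /B [leRHS]mulrAC.
rewrite ler_wpM2r ?expR_ge0//.
have e1 : (N%:R / t) ^+ N * (t / N%:R) ^+ N = 1.
  by rewrite -exprMn mulrA divfK ?gt_eqF// divff ?gt_eqF// expr1n.
apply: (@le_trans _ _ ((N%:R / t) ^+ N * (t / N%:R) ^+ N * (1 + l) ^+ N)).
  by rewrite e1 mul1r.
rewrite -mulrA ler_wpM2l ?exprn_ge0 ?divr_ge0 ?(ltW t0)//.
by rewrite mulrC.
Qed.

Lemma spectral_decay (t : R) (j m : nat) : 0 < t ->
  exists2 B : R, 0 < B &
    forall n, n.+1%:R ^+ j * ((1 + lam n) ^+ m * expR (- lam n * t)) <= B.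
Proof.
move=> t0; have [C C0 HC] := eigenvalue_growth.
have [B B0 HB] := exp_polynomial_decay (d * j + m)%N t0.
exists (C ^+ j * B); first by rewrite mulr_gt0// exprn_gt0.
move=> n.
apply: (@le_trans _ _ ((C * (1 + lam n) ^+ d) ^+ j * ((1 + lam n) ^+ m * expR (- lam n * t)))).
  rewrite ler_wpM2r ?mulr_ge0 ?expR_ge0 ?(ltW (lamp _ _))//.
  by rewrite lerXn2r ?nnegrE// mulr_ge0 ?(ltW C0) ?(ltW (lamp _ _)).
rewrite exprMn -exprM -mulrA ler_wpM2l ?exprn_ge0 ?(ltW C0)//.
by rewrite mulrA -exprD HB// ltW.
Qed.

Lemma heat_term_decay (t : R) (j : nat) : 0 < t ->
  exists2 B : R, 0 < B & forall s n x y, t <= s ->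
    n.+1%:R ^+ j * `|expR (- lam n * s) * f n x| <= B /\
    n.+1%:R ^+ j * `|expR (- lam n * s) * f n x * f n y| <= B.
Proof.
move=> t0; have [C C0 HC] := eigenfun_bound.
have [B1 B10 HB1] := spectral_decay j d t0.
have [B2 B20 HB2] := spectral_decay j (d + d) t0.
exists (C * B1 + C ^+ 2 * B2).
  by rewrite addr_gt0// mulr_gt0// exprn_gt0.
move=> s n x y ts.
have es : expR (- lam n * s) <= expR (- lam n * t).
  by rewrite ler_expR !mulNr lerN2 ler_wpM2l// ltW.
have h1 : n.+1%:R ^+ j * `|expR (- lam n * s) * f n x| <= C * B1.
  rewrite normrM (ger0_norm (expR_ge0 _)).
  apply: (@le_trans _ _ (n.+1%:R ^+ j * (expR (- lam n * t) * (C * (1 + lam n) ^+ d)))).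
    by rewrite ler_wpM2l ?exprn_ge0// ler_pM ?expR_ge0.
  have -> : n.+1%:R ^+ j * (expR (- lam n * t) * (C * (1 + lam n) ^+ d)) =
    C * (n.+1%:R ^+ j * ((1 + lam n) ^+ d * expR (- lam n * t))) by ring.
  by rewrite ler_wpM2l ?(ltW C0).
have h2 : n.+1%:R ^+ j * `|expR (- lam n * s) * f n x * f n y| <= C ^+ 2 * B2.
  rewrite !normrM (ger0_norm (expR_ge0 _)).
  apply: (@le_trans _ _ (n.+1%:R ^+ j * (expR (- lam n * t) * (C * (1 + lam n) ^+ d) *
      (C * (1 + lam n) ^+ d)))).
    rewrite ler_wpM2l ?exprn_ge0// ler_pM ?mulr_ge0 ?expR_ge0//.
    by rewrite ler_pM ?expR_ge0.
  have -> : n.+1%:R ^+ j * (expR (- lam n * t) * (C * (1 + lam n) ^+ d) *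
      (C * (1 + lam n) ^+ d)) =
    C ^+ 2 * (n.+1%:R ^+ j * ((1 + lam n) ^+ (d + d) * expR (- lam n * t))).
    by rewrite exprD; ring.
  by rewrite ler_wpM2l ?exprn_ge0 ?(ltW C0).
have p1 : 0 <= C * B1 by rewrite mulr_ge0 ?(ltW C0) ?(ltW B10).
have p2 : 0 <= C ^+ 2 * B2 by rewrite mulr_ge0 ?(ltW B20)// sqr_ge0.
by split; [apply: le_trans h1 _; rewrite lerDl|apply: le_trans h2 _; rewrite lerDr].
Qed.

Definition heat_partial (t : R) x N : 'rV[R]_d -> R :=
  comb (f := f) (iota 0 N) (fun n => expR (- lam n * t) * f n x).

Lemma heat_kernel_uniform (t : R) x : 0 < t -> exists2 B : R, 0 < B &
  forall N y, `|heat_kernel lam f t x y - heat_partial t x N y| <= B * inv_sq_tail N.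
Proof.
move=> t0; have [B B0 HB] := heat_term_decay 2 t0; exists B => // N y.
have := @dominated_series_tail _ (fun n => expR (- lam n * t) * f n x * f n y) B N.
rewrite series_iota -/(heat_kernel lam f t x y) /heat_partial /comb.
by apply=> n; apply: bounded_weighted; exact: (HB t n x y (lexx _)).2.
Qed.

Lemma heat_kernel_continuous (t : R) x : 0 < t -> continuous (heat_kernel lam f t x).
Proof.
move=> t0; have [B B0 HB] := heat_kernel_uniform x t0 => y.
apply/(@cvgrPdist_lt _ _ _ (nbhs y) (nbhs_filter y)) => e e0.
have e30 : 0 < e / 3 by rewrite divr_gt0.
have : (fun N => B * inv_sq_tail N) @ \oo --> (0 : R).
  by rewrite -(mulr0 B); exact: cvgM (cvg_cst _) inv_sq_tail_cvg0.
move=> /cvgrPdist_lt/(_ _ e30)[N _ /(_ N (leqnn N))]; rewrite sub0r normrN => /=.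
move=> /(le_lt_trans (ler_norm _)) NB.
have cp : continuous (heat_partial t x N) by exact: comb_continuous E _ _.
have /cvgrPdist_lt/(_ _ e30) := cp y.
apply: filterS => z /= yz.
have h1 := le_lt_trans (HB N y) NB; have h2 := le_lt_trans (HB N z) NB.
have -> : heat_kernel lam f t x y - heat_kernel lam f t x z =
  (heat_kernel lam f t x y - heat_partial t x N y) +
  (heat_partial t x N y - heat_partial t x N z) -
  (heat_kernel lam f t x z - heat_partial t x N z) by ring.
apply: le_lt_trans (ler_normB _ _) _.
apply: le_lt_trans (lerD (ler_normD _ _) (lexx _)) _.
have -> : e = e / 3 + e / 3 + e / 3 by field.
by rewrite !ltrD.
Qed.

Lemma heat_kernel_out (t : R) x y : ~ D y -> heat_kernel lam f t x y = 0.
Proof.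
move=> nD; rewrite /heat_kernel (_ : (fun n => _) = fun=> 0); last first.
  by apply/funext => n; rewrite (eigenfun_out E n nD) mulr0.
have -> : series (fun _ : nat => 0 : R) = fun=> 0.
  by apply/funext => n; rewrite seriesEnat/= big1.
exact: lim_cst.
Qed.

(** The partial sums have this coefficient exactly once N > k, and they converge uniformly. *)
Lemma heat_kernel_coef (t : R) x k : 0 < t ->
  L2_inner D (heat_kernel lam f t x) (f k) = expR (- lam k * t) * f k x.
Proof.
move=> t0; have [B B0 HB] := heat_kernel_uniform x t0.
have ck := @heat_kernel_continuous t x t0; have cfk := @fc k.
set V := L2_inner D (fun x => `|f k x|) (fun=> 1).
set a := L2_inner D _ _; set b := expR _ * _.
have H N : (k < N)%N -> `|a - b| <= B * V * inv_sq_tail N.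
  move=> kN; have cp : continuous (heat_partial t x N) by exact: comb_continuous E _ _.
  have pE : L2_inner D (heat_partial t x N) (f k) = b.
    rewrite /heat_partial /comb (L2_inner_sum oD bD _ _ fc cfk).
    rewrite (bigD1_seq k) ?iota_uniq ?mem_iota//= big1 ?addr0.
      by rewrite (eigenfun_orthonormal E) eqxx mulr1.
    by move=> j jk; rewrite (eigenfun_orthonormal E) (negPf jk) mulr0.
  have : a - b = L2_inner D (fun y => -1 * heat_partial t x N y + heat_kernel lam f t x y) (f k).
    by rewrite (L2_inner_lin oD bD _ cp ck cfk) pE /a mulN1r addrC.
  move=> ->; rewrite mulrAC; apply: (L2_inner_bound oD bD).
  - by move=> y; exact: (cvgD (cvgM (cvg_cst _) (cp y)) (ck y)).
  - exact: cfk.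
  - by move=> y _; rewrite mulN1r addrC; exact: HB.
apply/eqP; rewrite -subr_eq0 -normr_eq0 eq_le normr_ge0 andbT.
have c0 : (fun N => B * V * inv_sq_tail N) @ \oo --> (0 : R).
  by rewrite -(mulr0 (B * V)); exact: cvgM (cvg_cst _) inv_sq_tail_cvg0.
by apply: (cvgr_to_ge c0); exists k.+1 => // N /= kN; exact: H.
Qed.

(** Where the bounds up to the boundary pay off: [alpha_completion] constrains [J] on test functions
    only, so this membership gives the mild integrand its meaning. *)
Lemma heat_kernel_test (t : R) x : 0 < t -> test_function D f (heat_kernel lam f t x).
Proof.
move=> t0; split.
  by split; [exact: heat_kernel_continuous|move=> y; exact: heat_kernel_out].
(* One power of n more than required turns boundedness into convergence to 0. *)
move=> k; have [B B0 HB] := heat_term_decay k.+1 t0.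
apply: (@squeeze_cvgr _ _ _ _ (fun=> 0) (fun n => B * (@harmonic R n))).
- near=> n; rewrite mulr_ge0//= heat_kernel_coef// /harmonic/= ler_pdivlMr// mulrAC -exprSr.
  exact: (HB t n x x (lexx _)).1.
- exact: cvg_cst.
- by rewrite -(mulr0 B); exact: cvgM (cvg_cst _) cvg_harmonic.
Unshelve. all: by end_near. Qed.

End spectral_growth.

(** * Dyadic summation *)

Section dyadic_sums.
Context {R : realType} {d : nat} {D : set 'rV[R]_d} {lam : nat -> R}
  {f : nat -> 'rV[R]_d -> R}.
Hypotheses (d0 : (0 < d)%N) (oD : open D) (bD : bounded_set D)
  (E : dirichlet_eigensystem D lam f).
Implicit Types (x y : 'rV[R]_d).

Let lam0 n : 0 < lam n. Proof. exact: eigenvalue_gt0 E n. Qed.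

Lemma powR_exprn (a k : R) (j : nat) : 0 <= a -> (a ^+ j) `^ k = (a `^ k) ^+ j.
Proof.
move=> a0; have -> : a ^+ j = a `^ j%:R by rewrite powR_mulrn.
by rewrite -powRrM mulrC powRrM powR_mulrn// powR_ge0.
Qed.

Lemma geometric_sum_le (rho : R) J : 0 <= rho < 1 ->
  \sum_(j <- iota 0 J) rho ^+ j <= (1 - rho)^-1.
Proof.
move=> /andP[r0 r1]; have p : 0 < 1 - rho by rewrite subr_gt0.
rewrite -[leRHS]div1r ler_pdivlMr// mulrC.
have -> : (1 - rho) * (\sum_(j <- iota 0 J) rho ^+ j) = 1 - rho ^+ J.
  elim: J => [|J IH]; first by rewrite big_nil mulr0 expr0 subrr.
  by rewrite -[in iota 0 _]addn1 iotaD big_cat/= big_seq1 mulrDr IH exprS; ring.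
by rewrite gerBl exprn_ge0.
Qed.

Lemma eigenvalue_dyadic k : exists j : nat, lam k <= lam 0%N * 4 ^+ j.
Proof.
exists (Num.bound (lam k / lam 0%N)); rewrite -ler_pdivrMl// mulrC.
have h : lam k / lam 0%N < (Num.bound (lam k / lam 0%N))%:R.
  by apply: archi_boundP; rewrite divr_ge0 ?ltW.
apply: le_trans (ltW h) _; rewrite -natrX ler_nat.
by apply: ltnW; exact: ltn_expl.
Qed.

(** Only cumulative sums up to lam_1 4^j are controlled. Each lam_k^(-p) is dominated by the sum of
    A 4^(-p j) over all j with lam_k <= lam_1 4^j, and exchanging the sums leaves a geometric series
    of ratio 4^(-p) 2^kappa < 1. *)
Lemma dyadic_sum (p kappa : R) : 0 < p -> kappa < 2 * p -> exists2 C : R, 0 < C &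
  forall N (q : nat -> R) (B : R), (forall k, 0 <= q k) -> 0 <= B ->
  (forall j : nat, \sum_(k <- iota 0 N | lam k <= lam 0%N * 4 ^+ j) q k <=
     B * (2 ^+ j) `^ kappa) ->
  \sum_(k <- iota 0 N) lam k `^ (- p) * q k <= C * B.
Proof.
move=> p0 kp.
have two0 : 0 < 2 :> R by []. have four0 : 0 < 4 :> R by [].
pose rho : R := 4 `^ (- p) * 2 `^ kappa.
have fourE : 4 `^ (- p) = 2 `^ (- (2 * p)) :> R.
  have -> : 4 = 2 `^ 2%:R :> R by rewrite powR_mulrn// expr2 -natrM.
  by rewrite -powRrM mulrN.
have rho0 : 0 <= rho by rewrite mulr_ge0 ?powR_ge0.
have rho1 : rho < 1.
  rewrite /rho fourE powRN mulrC ltr_pdivrMr ?powR_gt0// mul1r.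
  rewrite -ltr_ln ?posrE ?powR_gt0// !ln_powR ltr_pM2r// ln_gt0//.
  by rewrite ltr1n.
(* For the least admissible j, lam k is at least (lam 0 / 4) 4^j. *)
pose A := (lam 0%N / 4) `^ (- p).
have A0 : 0 < A by rewrite powR_gt0// divr_gt0.
exists (A * (1 - rho)^-1); first by rewrite mulr_gt0// invr_gt0 subr_gt0.
move=> N q B q0 B0 H; have [J HJ] := eigenvalue_dyadic N.
have key k : (k < N)%N -> lam k `^ (- p) <=
    \sum_(j <- iota 0 J.+1 | lam k <= lam 0%N * 4 ^+ j) A * (4 `^ (- p)) ^+ j.
  move=> kN; have ex : exists j, lam k <= lam 0%N * 4 ^+ j.
    by exists J; apply: le_trans HJ; apply: (eigenvalue_le E); exact: ltnW.
  case: (ex_minnP ex) => j kj jmin.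
  have jJ : (j <= J)%N.
    by apply: jmin; apply: le_trans HJ; apply: (eigenvalue_le E); exact: ltnW.
  have jin : j \in iota 0 J.+1 by rewrite mem_iota add0n.
  rewrite -big_filter (bigD1_seq j) ?filter_uniq ?iota_uniq ?mem_filter ?kj//=.
  rewrite ler_wpDr//.
    by apply: sumr_ge0 => i _; rewrite mulr_ge0 ?(ltW A0)// exprn_ge0// powR_ge0.
  have lk : lam 0%N / 4 * 4 ^+ j <= lam k.
    case: j kj jmin {jJ jin} => [|j] kj jmin.
      rewrite expr0 mulr1 ler_pdivrMr//.
      by apply: le_trans (eigenvalue_le E (leq0n k)) _; rewrite ler_peMr ?(ltW (lam0 k))// ler1n.
    rewrite leNgt exprS mulrA divfK ?gt_eqF//; apply/negP => h.
    by have := jmin j (ltW h); rewrite ltnn.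
  have l4 : 0 < lam 0%N / 4 by rewrite divr_gt0.
  have fj0 : 0 < 4 ^+ j :> R by rewrite exprn_gt0.
  have l40 : 0 < lam 0%N / 4 * 4 ^+ j by rewrite mulr_gt0.
  rewrite -powR_exprn ?(ltW four0)// -powRM ?(ltW l4) ?(ltW fj0)//.
  rewrite !powRN lef_pV2 ?posrE ?powR_gt0//.
  by rewrite ge0_ler_powR ?nnegrE ?(ltW p0) ?(ltW l40) ?(ltW (lam0 k)).
apply: (@le_trans _ _ (\sum_(k <- iota 0 N) \sum_(j <- iota 0 J.+1 | lam k <= lam 0%N * 4 ^+ j)
    A * (4 `^ (- p)) ^+ j * q k)).
  rewrite !big_seq; apply: ler_sum => k; rewrite mem_iota add0n => /andP[_ kN].
  by rewrite -mulr_suml ler_wpM2r ?key.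
under eq_bigr do rewrite big_mkcond/=.
rewrite exchange_big/=.
apply: (@le_trans _ _ (\sum_(j <- iota 0 J.+1) A * B * rho ^+ j)).
  apply: ler_sum => j _; rewrite -big_mkcond/= -mulr_sumr.
  rewrite /rho exprMn -(powR_exprn kappa j (ltW two0)).
  have -> : A * B * ((4 `^ (- p)) ^+ j * (2 ^+ j) `^ kappa) =
    A * (4 `^ (- p)) ^+ j * (B * (2 ^+ j) `^ kappa) by ring.
  by rewrite ler_wpM2l// mulr_ge0 ?(ltW A0)// exprn_ge0// powR_ge0.
rewrite -mulr_sumr [leLHS]mulrAC ler_wpM2r// ler_wpM2l ?(ltW A0)//.
by apply: geometric_sum_le; rewrite rho0.
Qed.

Lemma filter_spectral_sum N (L : R) (q : nat -> R) :
  \sum_(k <- iota 0 N | lam k <= L) q k =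
  \sum_(k <- [seq k <- iota 0 N | lam k <= L]) q k.
Proof. by rewrite big_filter. Qed.

Lemma sqrt_dyadic (j : nat) : Num.sqrt (lam 0%N * 4 ^+ j) = Num.sqrt (lam 0%N) * 2 ^+ j.
Proof.
rewrite sqrtrM ?(ltW (lam0 0))//; congr (_ * _).
have -> : 4 = 2 ^+ 2 :> R by rewrite expr2 -natrM.
by rewrite exprAC sqrtr_sqr ger0_norm// exprn_ge0.
Qed.

Lemma dyadic_weight (b s : R) (j : nat) : 0 <= b -> 0 <= s ->
  b + s * 2 ^+ j <= (b + s) * 2 ^+ j.
Proof.
move=> b0 s0; rewrite mulrDl lerD2r ler_peMr//.
by rewrite exprn_ege1// ler1n.
Qed.

(* The bound S(x) <= C L^(d/2) on spectral sums, summed over dyadic blocks. *)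
Lemma potential_bound (dl p : R) : 0 < dl -> d%:R < 2 * p -> exists2 C : R, 0 < C &
  forall N x, (forall y, `|y - x| <= dl -> D y) ->
  \sum_(k <- iota 0 N) lam k `^ (- p) * f k x ^+ 2 <= C.
Proof.
move=> dl0 dp; have p0 : 0 < p.
  by have := le_lt_trans (ler0n R d) dp; rewrite pmulr_rgt0.
have [C C0 H] := dyadic_sum p0 dp.
pose W := 4 / dl + Num.sqrt (lam 0%N).
have W0 : 0 < W by rewrite ltr_pwDl ?divr_gt0// sqrtr_ge0.
have K0 := @interior_constant_gt0 R d d0.
exists (C * (interior_constant (R := R) (d := d) * W ^+ d)).
  by rewrite mulr_gt0// mulr_gt0// exprn_gt0.
move=> N x QD; apply: H => [k||j]; first exact: sqr_ge0.
  by rewrite mulr_ge0 ?(ltW K0)// exprn_ge0// ltW.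
rewrite filter_spectral_sum.
have L0 : 0 <= lam 0%N * 4 ^+ j by rewrite mulr_ge0 ?(ltW (lam0 0))// exprn_ge0.
have rL k : k \in [seq k <- iota 0 N | lam k <= lam 0%N * 4 ^+ j] -> lam k <= lam 0%N * 4 ^+ j.
  by rewrite mem_filter => /andP[].
have := @spectral_sum_interior R d D lam f d0 oD bD E _ x dl _
  (filter_uniq (fun k => lam k <= lam 0%N * 4 ^+ j) (iota_uniq 0 N)) rL L0 dl0 QD.
move=> /le_trans; apply.
rewrite -mulrA ler_wpM2l ?(ltW K0)// sqrt_dyadic powR_mulrn ?exprn_ge0// -exprMn.
rewrite lerXn2r ?nnegrE ?mulr_ge0 ?addr_ge0 ?divr_ge0 ?mulr_ge0
    ?sqrtr_ge0 ?exprn_ge0 ?(ltW dl0) ?(ltW W0)//.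
by rewrite dyadic_weight ?sqrtr_ge0// divr_ge0// ltW.
Qed.

(** Interpolation: min(1, z^2) <= z^r. *)
Lemma min1_sqr_le_powR (z r T B : R) : 0 <= z -> 0 <= r <= 2 -> 0 <= B ->
  T <= B -> T <= B * z ^+ 2 -> T <= B * z `^ r.
Proof.
move=> z0 /andP[r0 r2] B0 T1 T2; have [z1|z1] := leP 1 z.
  apply: le_trans T1 _; rewrite -[leLHS]mulr1 ler_wpM2l//.
  by rewrite -(powRr0 z) ler_powR.
apply: le_trans T2 _; rewrite ler_wpM2l//.
move: z0; rewrite le_eqVlt => /orP[/eqP <-|z0]; first by rewrite expr0n powR_ge0.
by rewrite -powR_mulrn ?(ltW z0)// ger_powR// z0 ltW.
Qed.

(** Interpolating the two bounds of [spectral_difference_interior] at the power 2 gm costs the extra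
    growth (2^j)^(2 gm), hence kappa = d + 2 gm in [dyadic_sum]. *)
Lemma potential_difference (dl p gm : R) : 0 < dl -> 0 < gm <= 1 ->
  d%:R + 2 * gm < 2 * p -> exists2 C : R, 0 < C &
  forall N x y, (forall z, `|z - x| <= dl -> D z) -> `|y - x| <= dl / 8 ->
  \sum_(k <- iota 0 N) lam k `^ (- p) * (f k x - f k y) ^+ 2 <=
  C * `|x - y| `^ (2 * gm).
Proof.
move=> dl0 /andP[gm0 gm1] dp; have p0 : 0 < p.
  by have := le_lt_trans (_ : 0 <= d%:R + 2 * gm) dp; rewrite pmulr_rgt0//; apply;
     rewrite addr_ge0// mulr_ge0// ltW.
have [C C0 H] := dyadic_sum p0 dp.
pose W := 8 / dl + Num.sqrt (lam 0%N).
have W0 : 0 < W by rewrite ltr_pwDl ?divr_gt0// sqrtr_ge0.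
have K0 := @interior_constant_gt0 R d d0.
pose q : R := d%:R * (d%:R + 1) * W.
have q0 : 0 < q by rewrite mulr_gt0// mulr_gt0 ?ltr0n// addr_gt0 ?ltr0n.
pose KW := 4 * interior_constant (R := R) (d := d) * W ^+ d.
have KW0 : 0 < KW by rewrite mulr_gt0 ?exprn_gt0// mulr_gt0.
exists (C * (KW * q `^ (2 * gm))).
  by rewrite mulr_gt0// mulr_gt0// powR_gt0.
move=> N x y QD yx; rewrite -mulrA; apply: H => [k||j]; first exact: sqr_ge0.
  by rewrite mulr_ge0 ?powR_ge0// mulr_ge0 ?powR_ge0 ?(ltW KW0).
rewrite filter_spectral_sum.
have L0 : 0 <= lam 0%N * 4 ^+ j by rewrite mulr_ge0 ?(ltW (lam0 0))// exprn_ge0.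
set r := [seq k <- _ | _].
have rL k : k \in r -> lam k <= lam 0%N * 4 ^+ j by rewrite mem_filter => /andP[].
have ur : uniq r by rewrite filter_uniq// iota_uniq.
have := @spectral_difference_interior R d D lam f d0 oD bD E r x y dl _ ur rL L0 dl0 QD yx.
rewrite sqrt_dyadic; set w := 8 / dl + _; set T := spectral_difference _ _ _ => -[T1 T2].
have tj0 : 0 < 2 ^+ j :> R by rewrite exprn_gt0.
have w0 : 0 <= w by rewrite addr_ge0 ?divr_ge0 ?mulr_ge0
    ?sqrtr_ge0 ?(ltW dl0) ?(ltW tj0).
have wW : w <= W * 2 ^+ j by rewrite dyadic_weight ?sqrtr_ge0// divr_ge0// ltW.
pose B := KW * (2 ^+ j) ^+ d.
have B0 : 0 <= B by rewrite mulr_ge0 ?(ltW KW0)// exprn_ge0// ltW.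
have KwB : 4 * interior_constant (R := R) (d := d) * w ^+ d <= B.
  rewrite /B /KW -[leRHS]mulrA ler_wpM2l ?mulr_ge0 ?(ltW K0)// -exprMn.
  by rewrite lerXn2r ?nnegrE// (le_trans w0).
have zz : d%:R * (d%:R + 1) * `|x - y| * w <= q * `|x - y| * 2 ^+ j.
  have -> : q * `|x - y| * 2 ^+ j = d%:R * (d%:R + 1) * `|x - y| * (W * 2 ^+ j).
    by rewrite /q; ring.
  by rewrite ler_wpM2l// !mulr_ge0// addr_ge0.
have qxy0 : 0 <= q * `|x - y| by rewrite (mulr_ge0 (ltW q0)).
have z0 : 0 <= q * `|x - y| * 2 ^+ j by rewrite (mulr_ge0 qxy0) ?(ltW tj0).
have : T <= B * (q * `|x - y| * 2 ^+ j) `^ (2 * gm).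
  apply: min1_sqr_le_powR => //.
  - by rewrite mulr_ge0 ?(ltW gm0)//= ler_piMr.
  - exact: le_trans T1 KwB.
  - apply: le_trans T2 _; apply: ler_pM => //.
    + by rewrite mulr_ge0 ?exprn_ge0// mulr_ge0 ?(ltW K0).
    + exact: sqr_ge0.
    + by rewrite lerXn2r ?nnegrE// !mulr_ge0// addr_ge0.
move=> /le_trans; apply.
rewrite (powRM _ qxy0 (ltW tj0)) (powRM _ (ltW q0) (normr_ge0 _)).
have -> : (2 ^+ j) `^ (d%:R + 2 * gm) = (2 ^+ j) ^+ d * (2 ^+ j) `^ (2 * gm) :> R.
  by rewrite powRD ?(gt_eqF tj0) ?implybT// (powR_mulrn d (ltW tj0)).
rewrite /B; set u := _ `^ _; set v := _ `^ _; set w' := _ `^ _.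
by rewrite le_eqVlt; apply/orP; left; apply/eqP; ring.
Qed.

End dyadic_sums.

(** * The mild integrand *)

Lemma EFin_series (R : realType) (u : nat -> R) :
  cvgn (series u) -> (\sum_(n <oo) (u n)%:E)%E = (limn (series u))%:E.
Proof.
move=> cu; rewrite -EFin_lim//; congr (limn _); apply/funext => n /=.
by rewrite sumEFin seriesEnat.
Qed.

Section completion.
Context {R : realType} {d : nat} {D : set 'rV[R]_d} {lam : nat -> R}
  {f : nat -> 'rV[R]_d -> R} {alpha : R} {H : completeNormedModType R}
  {ip : H -> H -> R} {J : ('rV[R]_d -> R) -> H}.
Hypotheses (d0 : (0 < d)%N) (oD : open D) (bD : bounded_set D)
  (bdD : C2_boundary D) (E : dirichlet_eigensystem D lam f)
  (alpha0 : 0 < alpha) (comp : alpha_completion D alpha lam f ip J).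
Implicit Types (x y : 'rV[R]_d) (a b : nat -> R).

Let lam0 n : 0 < lam n. Proof. exact: eigenvalue_gt0 E n. Qed.

(** Elements of the abstract completion that come from test functions are handled through their
    coefficients, which turns norms and distances into series. *)
Definition represents (v : H) (a : nat -> R) : Prop :=
  exists phi, [/\ test_function D f phi, J phi = v & forall n, L2_inner D phi (f n) = a n].

(** One power of n suffices: the product of two such sequences is dominated by [inv_sq]. *)
Lemma represents_decay v a : represents v a ->
  exists2 B : R, 0 < B & forall n, `|a n| <= B * n.+1%:R^-1.
Proof.
move=> [phi [[_ /(_ 1%N) tphi] _ aE]].
have [M [_ HM]] := cvg_seq_bounded (cvgP _ tphi).
exists (`|M| + 1); first by rewrite ltr_wpDl.
move=> n; have := HM (`|M| + 1) _ n I; rewrite (le_lt_trans (ler_norm M)) ?ltrDl// => /(_ isT).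
rewrite /= expr1 normrM normr_id (ger0_norm (ler0n _ _)) aE => h.
by rewrite ler_pdivlMr// mulrC.
Qed.

Lemma weight_le n : lam n `^ (- alpha) <= lam 0%N `^ (- alpha).
Proof.
rewrite !powRN lef_pV2 ?posrE ?powR_gt0//.
by rewrite ge0_ler_powR ?nnegrE ?(ltW alpha0) ?(ltW (lam0 _))// (eigenvalue_le E).
Qed.

Lemma represents_product_decay u v a b : represents u a -> represents v b ->
  exists B : R, forall n, `|lam n `^ (- alpha) * a n * b n| <= B * inv_sq n.
Proof.
move=> /represents_decay[A A0 HA] /represents_decay[B B0 HB].
exists (lam 0%N `^ (- alpha) * A * B) => n; rewrite !normrM ger0_norm ?powR_ge0//.
have -> : lam 0%N `^ (- alpha) * A * B * inv_sq n =
    lam 0%N `^ (- alpha) * (A * n.+1%:R^-1) * (B * n.+1%:R^-1).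
  by rewrite /inv_sq; field; rewrite ?pnatr_eq0.
rewrite ler_pM ?mulr_ge0 ?powR_ge0//.
by rewrite ler_pM ?powR_ge0// weight_le.
Qed.

Lemma represents_ip u v a b : represents u a -> represents v b ->
  cvgn (series (fun n => lam n `^ (- alpha) * a n * b n)) /\
  ip u v = limn (series (fun n => lam n `^ (- alpha) * a n * b n)).
Proof.
move=> ua vb; have [B HB] := represents_product_decay ua vb.
split; first exact: dominated_series_cvg HB.
move: ua vb => [phi [tphi <- aE]] [psi [tpsi <- bE]].
rewrite (embedding_isometry comp)// /inner_alpha; congr (limn (series _)).
by apply/funext => n; rewrite aE bE.
Qed.

Lemma ip_sub u v : ip (u - v) (u - v) = ip u u - 2 * ip u v + ip v v.
Proof.
have l w : ip (u - v) w = ip u w - ip v w.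
  by rewrite addrC -scaleN1r (ip_linear comp) mulN1r addrC.
rewrite l ![ip _ (u - v)](ip_sym comp) !l (ip_sym comp v u); ring.
Qed.

Lemma represents_dist u v a b : represents u a -> represents v b ->
  cvgn (series (fun n => lam n `^ (- alpha) * (a n - b n) ^+ 2)) /\
  `|u - v| ^+ 2 = limn (series (fun n => lam n `^ (- alpha) * (a n - b n) ^+ 2)).
Proof.
move=> ua vb; have [c1 e1] := represents_ip ua ua; have [c2 e2] := represents_ip ua vb.
have [c3 e3] := represents_ip vb vb.
have c : (fun N => series (fun n => lam n `^ (- alpha) * a n * a n) N -
   2 * series (fun n => lam n `^ (- alpha) * a n * b n) N +
   series (fun n => lam n `^ (- alpha) * b n * b n) N) @ \oo --> `|u - v| ^+ 2.
  rewrite -(ip_norm comp) ip_sub e1 e2 e3.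
  exact: cvgD (cvgB c1 (cvgM (cvg_cst _) c2)) c3.
have -> : series (fun n => lam n `^ (- alpha) * (a n - b n) ^+ 2) =
  (fun N => series (fun n => lam n `^ (- alpha) * a n * a n) N -
   2 * series (fun n => lam n `^ (- alpha) * a n * b n) N +
   series (fun n => lam n `^ (- alpha) * b n * b n) N).
  apply/funext => N; rewrite !series_iota mulr_sumr -sumrB -big_split/=.
  by apply: eq_bigr => n _; ring.
by split; [exact: cvgP c|rewrite (cvg_lim _ c)].
Qed.

(** J of the zero function is 0 because additivity gives J 0 = J 0 + J 0; this covers the times at
    which the mild integrand is cut off. *)
Lemma represents0 : represents 0 (fun=> 0).
Proof.
have c0 : continuous (fun _ : 'rV[R]_d => 0 : R) by exact: cst_continuous.
have L0 n : L2_inner D (fun=> 0) (f n) = 0.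
  rewrite /L2_inner -[RHS](mul0r (fine (lebesgue_tuple d (@rv_of_tuple R d @^-1` D)))).
  rewrite -Rintegral_cst; last exact: measurable_row_open.
  by apply: eq_Rintegral => z _ /=; rewrite mul0r.
have t0 : test_function D f (fun=> 0).
  split; first by split.
  move=> k; rewrite (_ : (fun _ => _) = fun=> 0); first exact: cvg_cst.
  by apply/funext => n; rewrite L0 normr0 mulr0.
exists (fun=> 0); split => //.
have := embedding_linear comp 1 t0 t0.
rewrite (_ : (fun x => 1 * 0 + 0) = fun=> 0); last first.
  by apply/funext => x; rewrite mulr0 addr0.
by rewrite scale1r => /esym/eqP; rewrite -subr_eq0 addrK => /eqP.
Qed.

Definition time_factor (l t r : R) : R := if 0 < r < t then expR (- l * (t - r)) else 0.

Lemma represents_mild t x r : represents (mild_integrand lam f J t x r)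
  (fun n => time_factor (lam n) t r * f n x).
Proof.
rewrite /mild_integrand /time_factor; case: ifP => [/andP[r0 rt]|_]; last first.
  have -> : (fun n => 0 * f n x) = fun=> 0 by apply/funext => n; rewrite mul0r.
  exact: represents0.
have tr : 0 < t - r by rewrite subr_gt0.
exists (heat_kernel lam f (t - r) x); split => //.
  exact: (heat_kernel_test d0 oD bD bdD E).
by move=> n; rewrite (heat_kernel_coef d0 oD bD bdD E).
Qed.

(* A left approximation of r by a grid of mesh 2^-n keeps t - r bounded below,
   where the heat semigroup is continuous. *)
Lemma heat_kernel_embedding_cvg t x r (rn : nat -> R) : r < t ->
  rn @ \oo --> r -> (forall n, rn n <= r) ->
  J (heat_kernel lam f (t - rn n) x) @[n --> \oo] --> J (heat_kernel lam f (t - r) x).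
Proof.
move=> rt crn rnr; have tr : 0 < t - r by rewrite subr_gt0.
have trn n : 0 < t - rn n by apply: lt_le_trans tr _; rewrite lerD2l lerN2.
have rep s : 0 < s -> represents (J (heat_kernel lam f s x)) (fun n => expR (- lam n * s) * f n x).
  move=> s0; exists (heat_kernel lam f s x); split => //.
    exact: (heat_kernel_test d0 oD bD bdD E).
  by move=> n; rewrite (heat_kernel_coef d0 oD bD bdD E).
have [C C0 HC] := eigenfun_bound d0 oD bD bdD E.
(* The exponent d + 1 pays d powers for the eigenfunction and one for 1 - exp(- lam k (r - rn n)) <=
   lam k (r - rn n). *)
have [B B0 HB] := spectral_decay d0 oD bD bdD E 1 d.+1 tr.
pose A := lam 0%N `^ (- alpha).
have A0 : 0 < A by rewrite powR_gt0.
pose K := A * (C * B) ^+ 2 * inv_sq_tail (R := R) 0.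
have key n : `|J (heat_kernel lam f (t - rn n) x) - J (heat_kernel lam f (t - r) x)| ^+ 2 <=
    (r - rn n) ^+ 2 * K.
  have [_ ->] := represents_dist (rep _ (trn n)) (rep _ tr).
  set u := fun n : nat => _.
  have uB k : `|u k| <= ((r - rn n) ^+ 2 * (A * (C * B) ^+ 2)) * inv_sq k.
    rewrite /u normrM (ger0_norm (powR_ge0 _ _)) normrX.
    have -> : (r - rn n) ^+ 2 * (A * (C * B) ^+ 2) * inv_sq k =
      A * ((r - rn n) * (C * B) * k.+1%:R^-1) ^+ 2.
      by rewrite /inv_sq; field; rewrite ?pnatr_eq0.
    apply: ler_pM; rewrite ?powR_ge0 ?exprn_ge0//; first exact: weight_le.
    have rr : 0 <= r - rn n by rewrite subr_ge0.
    have CB : 0 <= C * B by rewrite mulr_ge0 ?(ltW C0) ?(ltW B0).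
    rewrite lerXn2r ?nnegrE ?divr_ge0 ?(mulr_ge0 rr CB)//.
    rewrite /= -mulrBl normrM.
    have -> : - lam k * (t - rn n) = - lam k * (t - r) - lam k * (r - rn n) by ring.
    rewrite expRD distrC -[X in X - _]mulr1 -mulrBr normrM (ger0_norm (expR_ge0 _)).
    have e1 : `|1 - expR (- (lam k * (r - rn n)))| <= lam k * (r - rn n).
      rewrite ger0_norm; last first.
        by rewrite subr_ge0 expR_le1 oppr_le0 mulr_ge0// ltW.
      by rewrite lerBlDr -lerBlDl; apply: le_trans (expR_ge1Dx _).
    apply: (@le_trans _ _ (expR (- lam k * (t - r)) * (lam k * (r - rn n)) *
        (C * (1 + lam k) ^+ d))).
      apply: ler_pM; rewrite ?mulr_ge0 ?expR_ge0//.
      by rewrite ler_wpM2l ?expR_ge0.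
    rewrite ler_pdivlMr//.
    apply: (@le_trans _ _ ((r - rn n) * C * (k.+1%:R ^+ 1 *
       ((1 + lam k) ^+ d.+1 * expR (- lam k * (t - r)))))).
      rewrite expr1 exprS.
      have p1 : 0 <= (r - rn n) * C * (k.+1%:R * ((1 + lam k) ^+ d * expR (- lam k * (t - r)))).
        have l1 : 0 <= (1 + lam k) ^+ d by rewrite exprn_ge0// addr_ge0// ltW.
        exact: (mulr_ge0 (mulr_ge0 rr (ltW C0)) (mulr_ge0 (ler0n _ _) (mulr_ge0 l1 (expR_ge0 _)))).
      rewrite -subr_ge0; apply: le_trans p1 _; rewrite le_eqVlt; apply/orP; left; apply/eqP.
      ring.
    by rewrite -mulrA ler_wpM2l// ler_wpM2l ?(ltW C0).
  have := dominated_series_tail 0 uB; rewrite series_iota big_nil subr0.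
  by move=> h; apply: le_trans (ler_norm _) (le_trans h _); rewrite /K !mulrA.
have tail0 : 0 <= inv_sq_tail (R := R) 0.
  have h n : 0 <= series (@inv_sq R) n.
    by rewrite series_iota sumr_ge0// => i _; exact/ltW/inv_sq_gt0.
  rewrite /inv_sq_tail series_iota big_nil subr0.
  by apply: limr_ge; [exact: inv_sq_cvg|exact: nearW].
have K0 : 0 <= K by rewrite mulr_ge0// mulr_ge0 ?sqr_ge0// ltW.
have key' n : `|J (heat_kernel lam f (t - rn n) x) - J (heat_kernel lam f (t - r) x)| <=
    (r - rn n) * Num.sqrt K.
  have rr : 0 <= r - rn n by rewrite subr_ge0.
  rewrite -[leLHS]ger0_norm//; apply: norm_le_of_sqr; first by rewrite mulr_ge0 ?sqrtr_ge0.
  by rewrite exprMn sqr_sqrtr.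
have c0 : (fun n => (r - rn n) * Num.sqrt K) @ \oo --> (0 : R).
  rewrite -(mul0r (Num.sqrt K)) -(subrr r).
  exact: cvgM (cvgB (cvg_cst _) crn) (cvg_cst _).
apply/cvgrPdist_lt => e e0.
have /cvgrPdist_lt/(_ _ e0) := c0; apply: filterS => n /=.
rewrite sub0r normrN => h; rewrite distrC; apply: le_lt_trans (key' n) _.
exact: le_lt_trans (ler_norm _) h.
Qed.

End completion.

(** * Time integrals of the semigroup factors *)

Section time_integrals.
Context {R : realType}.
Local Notation mu := (@lebesgue_measure R).

Lemma one_minus_exp_le (z gm : R) : 0 <= z -> 0 < gm <= 1 -> 1 - expR (- z) <= z `^ gm.
Proof.
move=> z0 /andP[gm0 gm1]; have [z1|z1] := leP 1 z.
  apply: (@le_trans _ _ 1); first by rewrite gerBl expR_ge0.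
  by rewrite -(powRr0 z) ler_powR// ltW.
apply: (@le_trans _ _ z); first by rewrite lerBlDr -lerBlDl; exact: expR_ge1Dx.
move: z0; rewrite le_eqVlt => /orP[/eqP <-|z0]; first exact: powR_ge0.
by rewrite ger1_powR// z0 ltW.
Qed.

Lemma exp_integral (l a t : R) : 0 < l -> a <= t ->
  (\int[mu]_(r in `[a, t]) (expR (- l * (t - r)) ^+ 2)%:E =
  ((1 - expR (- (2 * l * (t - a)))) / (2 * l))%:E)%E.
Proof.
move=> l0; rewrite le_eqVlt => /orP[/eqP ->|at_].
  by rewrite set_itv1 integral_set1 subrr mulr0 oppr0 expR0 subrr mul0r.
pose F r := expR (- (2 * l * (t - r))) / (2 * l).
have dF (r : R) : is_derive r 1 F (expR (- l * (t - r)) ^+ 2).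
  have dlin : is_derive r 1 (fun r : R => - (2 * l * (t - r))) (2 * l).
    have -> : (fun r : R => - (2 * l * (t - r))) = (2 * l) \*: (@id R) - cst (2 * l * t).
      by apply/funext => y; transitivity (2 * l * y - 2 * l * t); [ring|].
    by apply: is_derive_eq; rewrite subr0 /GRing.scale/= mulr1.
  have de := @is_derive1_comp R expR _ r _ _ (is_derive_expR (- (2 * l * (t - r)))) dlin.
  have -> : F = (2 * l)^-1 \*: (expR \o (fun r : R => - (2 * l * (t - r)))).
    by apply/funext => y; rewrite /F /GRing.scale/= mulrC.
  apply: is_derive_eq; rewrite /GRing.scale/= -expRM_natl.
  have -> : 2 * (- l * (t - r)) = - (2 * l * (t - r)) by ring.
  by field; rewrite gt_eqF.
have cF : continuous F.
  by move=> r; apply/differentiable_continuous/derivable1_diffP; have [] := dF r.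
have cf : continuous (fun r : R => expR (- l * (t - r)) ^+ 2).
  move=> r; apply: (@continuous_comp _ _ _ (fun r : R => expR (- l * (t - r)))
    (fun v : R => v ^+ 2)).
    apply: (@continuous_comp _ _ _ (fun r : R => - l * (t - r)) expR).
      exact: cvgM (cvg_cst _) (cvgB (cvg_cst _) (@cvg_id _ (nbhs r))).
    exact: continuous_expR.
  exact: exprn_continuous.
rewrite (@continuous_FTC2 _ _ F _ _ at_).
- rewrite -EFinB /F subrr mulr0 oppr0 expR0; congr (_%:E); ring.
- exact: continuous_subspaceT.
- split; first by move=> r _; have [] := dF r.
  + by apply: cvg_at_right_filter; exact: cF.
  + by apply: cvg_at_left_filter; exact: cF.
- by move=> r _; rewrite derive1E; have [] := dF r.
Qed.

Definition decay_window (l a t r : R) : R := \1_(`[a, t]%classic) r * expR (- l * (t - r)) ^+ 2.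

Lemma decay_window_ge0 l a t r : 0 <= decay_window l a t r.
Proof. by rewrite mulr_ge0 ?exprn_ge0 ?expR_ge0. Qed.

Lemma measurable_decay_window l a t : measurable_fun setT (decay_window l a t).
Proof.
apply: measurable_funM; first exact: measurable_indic.
apply: measurable_funX; apply: measurableT_comp => //.
by apply: measurable_funM => //; apply: measurable_funB.
Qed.

Lemma decay_window_integral l a t : 0 < l -> a <= t ->
  (\int[mu]_(r in `]0%R, +oo[) (decay_window l a t r)%:E <=
  ((1 - expR (- (2 * l * (t - a)))) / (2 * l))%:E)%E.
Proof.
move=> l0 at_; rewrite -exp_integral// [leRHS]integral_mkcond.
apply: (@le_trans _ _ (\int[mu]_r (decay_window l a t r)%:E)%E).
  apply: ge0_subset_integral => //.
    by apply/measurable_EFinP; exact: measurable_decay_window.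
  by move=> r _; rewrite lee_fin decay_window_ge0.
rewrite le_eqVlt; apply/orP; left; apply/eqP; apply: eq_integral => r _.
rewrite patchE /decay_window indicE; case: ifP => _; first by rewrite mul1r.
by rewrite mul0r.
Qed.

Lemma time_factorE (l t r : R) :
  time_factor l t r = \1_(`]0, t[%classic) r * expR (- l * (t - r)).
Proof.
rewrite /time_factor indicE; case: ifP => h.
  by rewrite mem_set ?mul1r//= in_itv.
by rewrite memNset ?mul0r//= in_itv/= h.
Qed.

Lemma measurable_time_factor (l t : R) : measurable_fun setT (time_factor l t).
Proof.
rewrite (_ : time_factor l t = fun r => \1_(`]0, t[%classic) r * expR (- l * (t - r))).
  apply: measurable_funM; first exact: measurable_indic.
  by apply: measurableT_comp => //; apply: measurable_funM => //; apply: measurable_funB.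
by apply/funext => r; rewrite time_factorE.
Qed.

Lemma time_factor_le (l t r : R) : 0 <= t -> time_factor l t r ^+ 2 <= decay_window l 0 t r.
Proof.
move=> t0; rewrite /time_factor /decay_window; case: ifP => h; last first.
  by rewrite expr0n/= decay_window_ge0.
rewrite indicE mem_set ?mul1r//= in_itv/=.
by move/andP : h => [h1 h2]; rewrite !ltW.
Qed.

Lemma time_factor_integral (l t : R) : 0 < l -> 0 <= t ->
  (\int[mu]_(r in `]0%R, +oo[) (time_factor l t r ^+ 2)%:E <= (l^-1)%:E)%E.
Proof.
move=> l0 t0; apply: (@le_trans _ _ (\int[mu]_(r in `]0%R, +oo[) (decay_window l 0 t r)%:E)%E).
  apply: ge0_le_integral => //.
  - by move=> r _; rewrite lee_fin sqr_ge0.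
  - apply/measurable_EFinP/measurable_funTS/measurable_funX.
    exact: measurable_time_factor.
  - by apply/measurable_EFinP/measurable_funTS; exact: measurable_decay_window.
  - by move=> r _; rewrite lee_fin time_factor_le.
apply: le_trans (decay_window_integral l0 t0) _; rewrite lee_fin.
rewrite ler_pdivrMr ?mulr_gt0// mulrCA mulVf ?gt_eqF// mulr1.
by apply: (@le_trans _ _ 1); [rewrite gerBl expR_ge0|rewrite ler1n].
Qed.

(** Before time s the difference is the earlier factor times 1 - exp(- l (t - s)), which lies in
    [0, 1], so its square is at most the value itself and hence at most (l (t - s))^gm. Between s
    and t only the later factor is present. *)
Lemma time_factor_difference_le (l s t r gm : R) : 0 < l -> 0 <= s <= t -> 0 < gm <= 1 ->
  (time_factor l t r - time_factor l s r) ^+ 2 <=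
  (l * (t - s)) `^ gm * time_factor l s r ^+ 2 + decay_window l s t r.
Proof.
move=> l0 /andP[s0 st] gm01; have z0 : 0 <= l * (t - s) by rewrite mulr_ge0 ?subr_ge0// ltW.
have rhs : 0 <= (l * (t - s)) `^ gm * time_factor l s r ^+ 2 + decay_window l s t r.
  by rewrite addr_ge0 ?decay_window_ge0// mulr_ge0 ?powR_ge0 ?sqr_ge0.
move: rhs; rewrite /time_factor; have [r0|r0] := ltP 0 r; last by rewrite /= subrr expr0n.
rewrite /= => _; have [rs|sr] := ltP r s.
  rewrite (lt_le_trans rs st).
  have -> : expR (- l * (t - r)) = expR (- l * (s - r)) * expR (- (l * (t - s))).
    by rewrite -expRD; congr expR; ring.
  rewrite -[X in _ - X]mulr1 -mulrBr exprMn mulrC ler_wpDr ?decay_window_ge0//.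
  rewrite ler_wpM2r ?sqr_ge0// -sqrrN opprB.
  have e0 : 0 <= 1 - expR (- (l * (t - s))) by rewrite subr_ge0 expR_le1 oppr_le0.
  have e1 : 1 - expR (- (l * (t - s))) <= 1 by rewrite gerBl expR_ge0.
  apply: le_trans (one_minus_exp_le z0 gm01); rewrite expr2; exact: ler_piMr.
rewrite expr0n/= mulr0 add0r subr0; have [rt|tr] := ltP r t; last first.
  by rewrite expr0n/= decay_window_ge0.
by rewrite /decay_window indicE mem_set ?mul1r//= in_itv/= sr ltW.
Qed.

Lemma time_factor_difference_integral (l s t gm : R) : 0 < l -> 0 <= s -> 0 <= t ->
  0 < gm <= 1 ->
  (\int[mu]_(r in `]0%R, +oo[) ((time_factor l t r - time_factor l s r) ^+ 2)%:E <=
  (2 * (l * `|t - s|) `^ gm / l)%:E)%E.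
Proof.
move=> l0; wlog st : s t / s <= t => [hw s0 t0 gm01|s0 t0 gm01].
  have [st|/ltW ts] := leP s t; first exact: hw.
  rewrite distrC; have := hw _ _ ts t0 s0 gm01; apply: le_trans.
  by rewrite le_eqVlt; apply/orP; left; apply/eqP; apply: eq_integral => r _; rewrite -sqrrN opprB.
rewrite ger0_norm ?subr_ge0//; set z := l * (t - s).
have z0 : 0 <= z by rewrite mulr_ge0 ?subr_ge0// ltW.
have m1 : measurable_fun (`]0%R, +oo[%classic : set R) (EFin \o (fun r => time_factor l s r ^+ 2)).
  apply/measurable_EFinP/measurable_funTS/measurable_funX.
  exact: measurable_time_factor.
have m2 : measurable_fun (`]0%R, +oo[%classic : set R) (EFin \o decay_window l s t).
  by apply/measurable_EFinP/measurable_funTS; exact: measurable_decay_window.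
have m3 : measurable_fun (`]0%R, +oo[%classic : set R)
    (EFin \o (fun r => z `^ gm * time_factor l s r ^+ 2)).
  apply/measurable_EFinP/measurable_funTS/measurable_funM => //.
  by apply: measurable_funX; exact: measurable_time_factor.
apply: (@le_trans _ _ (\int[mu]_(r in `]0%R, +oo[)
    ((z `^ gm * time_factor l s r ^+ 2)%:E + (decay_window l s t r)%:E))%E).
  apply: ge0_le_integral => //.
  - by move=> r _; rewrite lee_fin sqr_ge0.
  - apply/measurable_EFinP/measurable_funTS/measurable_funX.
    by apply: measurable_funB; exact: measurable_time_factor.
  - exact: emeasurable_funD.
  - by move=> r _; rewrite -EFinD lee_fin time_factor_difference_le// s0.
rewrite ge0_integralD//; last 2 first.
- by move=> r _; rewrite lee_fin mulr_ge0 ?powR_ge0 ?sqr_ge0.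
- by move=> r _; rewrite lee_fin decay_window_ge0.
rewrite (_ : 2 * z `^ gm / l = z `^ gm / l + z `^ gm / l); last by ring.
rewrite EFinD; apply: leeD.
  under eq_integral do rewrite EFinM.
  rewrite ge0_integralZl_EFin ?powR_ge0//; last by move=> r _; rewrite lee_fin sqr_ge0.
  by rewrite EFinM lee_wpmul2l ?lee_fin ?powR_ge0// time_factor_integral.
apply: le_trans (decay_window_integral l0 st) _; rewrite lee_fin.
rewrite ler_pdivrMr ?mulr_gt0//.
have -> : z `^ gm / l * (2 * l) = 2 * z `^ gm by field; rewrite gt_eqF.
have h := one_minus_exp_le z0 gm01.
have e0 : 0 <= 1 - expR (- z) by rewrite subr_ge0 expR_le1 oppr_le0.
apply: (@le_trans _ _ (2 * (1 - expR (- z)))); last by rewrite ler_wpM2l.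
have -> : 2 * l * (t - s) = z + z by rewrite /z; ring.
rewrite opprD expRD -subr_ge0.
have -> : 2 * (1 - expR (- z)) - (1 - expR (- z) * expR (- z)) = (1 - expR (- z)) ^+ 2 by ring.
exact: sqr_ge0.
Qed.

End time_integrals.

(** * Truncation to a grid *)

Section truncation_grid.
Context {R : realType}.
Implicit Types h r : R.

Definition trunc_grid h r : R := (Num.truncn (r / h))%:R * h.

Lemma trunc_grid_itv h r : 0 < h -> 0 <= r -> trunc_grid h r <= r < trunc_grid h r + h.
Proof.
move=> h0 r0; have := @truncn_itv R (r / h) (divr_ge0 r0 (ltW h0)).
rewrite ler_pdivlMr// ltr_pdivrMr// /trunc_grid => /andP[-> /=].
by rewrite -natr1 mulrDl mul1r.
Qed.

Lemma trunc_grid_ge0 h r : 0 < h -> 0 <= trunc_grid h r.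
Proof. by move=> h0; rewrite mulr_ge0// ltW. Qed.

Lemma trunc_grid_dist h r : 0 < h -> 0 <= r -> `|r - trunc_grid h r| <= h.
Proof.
move=> h0 r0; have /andP[h1 h2] := trunc_grid_itv h0 r0.
by rewrite ger0_norm ?subr_ge0// lerBlDl ltW.
Qed.

Definition mesh n : R := (2 ^+ n)^-1.

Lemma mesh_gt0 n : 0 < mesh n. Proof. by rewrite invr_gt0 exprn_gt0. Qed.

Lemma mesh_cvg0 : mesh @ \oo --> (0 : R).
Proof.
have : geometric 1 (2^-1 : R) @ \oo --> (0 : R).
  by apply: cvg_geometric; rewrite ger0_norm// invf_lt1// ltr1n.
by apply: cvg_trans; apply: near_eq_cvg; apply: nearW => n; rewrite /geometric/= mul1r exprVn.
Qed.

Lemma trunc_grid_cvg r : 0 <= r -> trunc_grid (mesh n) r @[n --> \oo] --> r.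
Proof.
move=> r0; apply/cvgrPdist_le => e e0.
have /cvgrPdist_le/(_ _ e0) := mesh_cvg0; apply: filterS => n; rewrite sub0r normrN => h.
by apply: le_trans (trunc_grid_dist (mesh_gt0 n) r0) (le_trans (ler_norm _) h).
Qed.

(** On [0, +oo[ the truncation takes countably many values, each on an interval, so F and Y may be
    arbitrary. *)
Lemma preimage_trunc_grid (V : Type) (F : R -> V) h (Y : set V) : 0 < h ->
  measurable ((`[0, +oo[%classic : set R) `&` [set r | Y (F (trunc_grid h r))]).
Proof.
move=> h0.
rewrite (_ : _ `&` _ = \bigcup_(k in [set k : nat | Y (F (k%:R * h))])
   (`[k%:R * h, k.+1%:R * h[%classic : set R)).
  by apply: bigcup_measurable => k _; exact: measurable_itv.
apply/seteqP; split => r /=.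
  rewrite in_itv/= andbT => -[r0 Yr]; exists (Num.truncn (r / h)) => //=.
  have := trunc_grid_itv h0 r0; rewrite in_itv/= /trunc_grid.
  by rewrite -natr1 mulrDl mul1r.
move=> [k /= Yk]; rewrite !in_itv/= => /andP[kr rk].
have r0 : 0 <= r by apply: le_trans kr; rewrite mulr_ge0// ltW.
rewrite andbT r0; split => //; rewrite /trunc_grid.
have -> : Num.truncn (r / h) = k by apply: truncn_def; rewrite ler_pdivlMr// ltr_pdivrMr// kr.
exact: Yk.
Qed.

End truncation_grid.

(** * Bochner integrability and the variance of increments *)

Section bochner.
Context {R : realType} {d : nat} {D : set 'rV[R]_d} {lam : nat -> R}
  {f : nat -> 'rV[R]_d -> R} {alpha : R} {H : completeNormedModType R}
  {ip : H -> H -> R} {J : ('rV[R]_d -> R) -> H}.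
Hypotheses (d0 : (0 < d)%N) (oD : open D) (bD : bounded_set D)
  (bdD : C2_boundary D) (E : dirichlet_eigensystem D lam f)
  (alpha0 : 0 < alpha) (comp : alpha_completion D alpha lam f ip J).
Implicit Types (x y : 'rV[R]_d) (a b : nat -> R).
Local Notation mild := (mild_integrand lam f J).
Local Notation mu := (@lebesgue_measure R).

Let lam0 n : 0 < lam n. Proof. exact: eigenvalue_gt0 E n. Qed.

(** The cutoff tests r itself and only the kernel is evaluated at the grid point, so off ]0, t[
    there is no approximation error. *)
Definition mild_step t x n (r : R) : H :=
  if 0 < r < t then J (heat_kernel lam f (t - trunc_grid (mesh n) r) x) else 0.

Lemma mild_step_simple t x n : simple_map (mild_step t x n).
Proof.
have m0 := @mesh_gt0 R n; split.
  pose K := Num.bound (t / mesh n).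
  apply: (@sub_finite_set _ _ ([set 0] `|`
    ((fun k : nat => J (heat_kernel lam f (t - k%:R * mesh n) x)) @` `I_K))).
    move=> _ [r _ <-]; rewrite /mild_step; case: ifP => [/andP[r0 rt]|_]; last by left.
    right; exists (Num.truncn (r / mesh n)) => //=.
    have r1 : 0 <= r / mesh n by rewrite divr_ge0 ?(ltW r0) ?(ltW m0).
    rewrite truncn_lt_nat//; apply: (@lt_trans _ _ (t / mesh n)).
      by rewrite ltr_pM2r ?invr_gt0.
    by apply: archi_boundP; rewrite divr_ge0 ?(ltW m0)// ltW// (lt_trans r0).
  by rewrite finite_setU; split; [exact: finite_set1|apply: finite_image; exact: finite_II].
(* Off ]0, t[ the step function is 0, whence the additional piece when y = 0. *)
move=> y.
have -> : mild_step t x n @^-1` [set y] =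
  ((`]0, t[%classic : set R) `&` ((`[0, +oo[%classic : set R) `&`
     [set r | [set y] (J (heat_kernel lam f (t - trunc_grid (mesh n) r) x))])) `|`
  (if `[< y = 0 >] then ~` (`]0, t[%classic : set R) else set0).
  apply/seteqP; split => r; rewrite /mild_step /=.
    case: ifP => [rt ry|rt /esym ry].
      by left; rewrite /= !in_itv/= rt; split => //; split => //; move/andP : rt => [/ltW ->].
    by right; rewrite asboolT//= in_itv/= rt.
  case=> [[]|]; first by rewrite !in_itv/= => -> [].
  by case: asboolP => [->|_//]; rewrite /= in_itv/=; case: ifP.
apply: measurableU.
  apply: measurableI; first exact: measurable_itv.
  exact: (preimage_trunc_grid (fun s => J (heat_kernel lam f (t - s) x)) _ m0).
by case: ifP => _ //; apply: measurableC; exact: measurable_itv.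
Qed.

Lemma mild_strongly_measurable t x : strongly_measurable `]0, +oo[ (mild t x).
Proof.
exists (mild_step t x); split; first exact: mild_step_simple.
apply: aeW => r /=; rewrite in_itv/= andbT => r0.
rewrite /mild_integrand /mild_step r0/=; case: ifP => rt; last exact: cvg_cst.
apply: (heat_kernel_embedding_cvg d0 oD bD bdD E alpha0 comp (x := x)
  (rn := fun n => trunc_grid (mesh n) r) rt).
  by apply: trunc_grid_cvg; exact: ltW.
by move=> n; have /andP[] := trunc_grid_itv (@mesh_gt0 R n) (ltW r0).
Qed.

Definition mild_dist2 t x s y (r : R) : R := `|mild t x r - mild s y r| ^+ 2.

Definition mild_term t x s y n (r : R) : R := lam n `^ (- alpha) *
  (time_factor (lam n) t r * f n x - time_factor (lam n) s r * f n y) ^+ 2.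

Lemma mild_term_ge0 t x s y n r : 0 <= mild_term t x s y n r.
Proof. by rewrite mulr_ge0 ?powR_ge0 ?sqr_ge0. Qed.

Lemma measurable_mild_term t x s y n : measurable_fun setT (mild_term t x s y n).
Proof.
apply: measurable_funM => //; apply: measurable_funX; apply: measurable_funB;
  apply: measurable_funM => //; exact: measurable_time_factor.
Qed.

Lemma mild_dist2_cvg t x s y r :
  series (fun n => mild_term t x s y n r) @ \oo --> mild_dist2 t x s y r.
Proof.
have rx := represents_mild d0 oD bD bdD E comp t x r.
have ry := represents_mild d0 oD bD bdD E comp s y r.
by have [c e] := represents_dist E alpha0 comp rx ry; rewrite /mild_dist2 e; exact: c.
Qed.

Lemma mild_dist2_esum t x s y r :
  ((mild_dist2 t x s y r)%:E = \sum_(n <oo) (mild_term t x s y n r)%:E)%E.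
Proof.
have c := @mild_dist2_cvg t x s y r; rewrite EFin_series; last exact: cvgP c.
by rewrite (cvg_lim _ c).
Qed.

Lemma measurable_mild_dist2 t x s y : measurable_fun setT (mild_dist2 t x s y).
Proof.
apply: (@measurable_fun_cvg _ _ _ _
  (fun N r => series (fun n => mild_term t x s y n r) N)); last first.
  by move=> r _; exact: mild_dist2_cvg.
move=> N; rewrite (_ : (fun r => _) = fun r => \sum_(n <- iota 0 N) mild_term t x s y n r).
  by apply: measurable_sum => n; exact: measurable_mild_term.
by apply/funext => r; rewrite series_iota.
Qed.

(** The increment splits as (p_t - p_s) f(x) + p_s (f(x) - f(y)). The time part costs (lam |t -
    s|)^gm / lam and the space part 1 / lam, which produces the exponents alpha + 1 - gm and alpha +
    1. *)
Lemma mild_term_integral t x s y n gm : 0 <= t -> 0 <= s -> 0 < gm <= 1 ->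
  (\int[mu]_(r in `]0%R, +oo[) (mild_term t x s y n r)%:E <=
   (4 * `|t - s| `^ gm * (lam n `^ (- (alpha + 1 - gm)) * f n x ^+ 2) +
    2 * (lam n `^ (- (alpha + 1)) * (f n x - f n y) ^+ 2))%:E)%E.
Proof.
move=> t0 s0 gm01; set l := lam n; have l0 : 0 < l by exact: lam0.
pose u r := (time_factor l t r - time_factor l s r) ^+ 2.
pose v r := time_factor l s r ^+ 2.
pose A := l `^ (- alpha) * 2 * f n x ^+ 2.
pose B := l `^ (- alpha) * 2 * (f n x - f n y) ^+ 2.
have A0 : 0 <= A by rewrite mulr_ge0 ?sqr_ge0// mulr_ge0 ?powR_ge0.
have B0 : 0 <= B by rewrite mulr_ge0 ?sqr_ge0// mulr_ge0 ?powR_ge0.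
have mu_ : measurable_fun (`]0%R, +oo[%classic : set R) (EFin \o u).
  apply/measurable_EFinP/measurable_funTS/measurable_funX.
  by apply: measurable_funB; exact: measurable_time_factor.
have mv : measurable_fun (`]0%R, +oo[%classic : set R) (EFin \o v).
  by apply/measurable_EFinP/measurable_funTS/measurable_funX; exact: measurable_time_factor.
have u0 r : (0 <= (u r)%:E)%E by rewrite lee_fin sqr_ge0.
have v0 r : (0 <= (v r)%:E)%E by rewrite lee_fin sqr_ge0.
have mAu : measurable_fun (`]0%R, +oo[%classic : set R) (fun r => A%:E * (u r)%:E)%E.
  exact: measurable_funeM.
have mBv : measurable_fun (`]0%R, +oo[%classic : set R) (fun r => B%:E * (v r)%:E)%E.
  exact: measurable_funeM.
apply: (@le_trans _ _ (\int[mu]_(r in `]0%R, +oo[) (A%:E * (u r)%:E + B%:E * (v r)%:E))%E).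
  apply: ge0_le_integral => //.
  - by move=> r _; rewrite lee_fin mild_term_ge0.
  - by apply/measurable_EFinP/measurable_funTS; exact: measurable_mild_term.
  - exact: emeasurable_funD.
  - move=> r _; rewrite -!EFinM -EFinD lee_fin /mild_term -/l -subr_ge0.
    (* The slack in (a + b)^2 <= 2 a^2 + 2 b^2 is (a - b)^2. *)
    have -> : A * u r + B * v r - l `^ (- alpha) *
       (time_factor l t r * f n x - time_factor l s r * f n y) ^+ 2 =
      l `^ (- alpha) * ((time_factor l t r - time_factor l s r) * f n x -
         time_factor l s r * (f n x - f n y)) ^+ 2.
      by rewrite /A /B /u /v; ring.
    by rewrite mulr_ge0 ?powR_ge0 ?sqr_ge0.
rewrite ge0_integralD//; last 2 first.
- by move=> r _; rewrite mule_ge0.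
- by move=> r _; rewrite mule_ge0.
rewrite !ge0_integralZl_EFin// EFinD; apply: leeD.
  apply: (@le_trans _ _ (A%:E * (2 * (l * `|t - s|) `^ gm / l)%:E)%E).
    by rewrite lee_wpmul2l ?lee_fin// time_factor_difference_integral.
  rewrite -EFinM lee_fin le_eqVlt; apply/orP; left; apply/eqP.
  have -> : l `^ (- (alpha + 1 - gm)) = l `^ (- alpha) * l `^ gm / l.
    have -> : - (alpha + 1 - gm) = - alpha + (gm - 1) by ring.
    have ln0 (c : bool) : c ==> (l != 0) by rewrite gt_eqF ?implybT.
    by rewrite (@powRD _ l (- alpha) (gm - 1) (ln0 _)) (@powRB _ l gm 1 (ln0 _))
      powRr1 ?(ltW l0)// mulrA.
  rewrite (powRM _ (ltW l0) (normr_ge0 _)) /A.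
  by set p := _ `^ _; set q := l `^ gm; set w := _ `^ gm; field; rewrite gt_eqF.
apply: (@le_trans _ _ (B%:E * (l^-1)%:E)%E).
  by rewrite lee_wpmul2l ?lee_fin// time_factor_integral.
rewrite -EFinM lee_fin le_eqVlt; apply/orP; left; apply/eqP.
have -> : l `^ (- (alpha + 1)) = l `^ (- alpha) / l.
  have ln0 (c : bool) : c ==> (l != 0) by rewrite gt_eqF ?implybT.
  by rewrite opprD (@powRD _ l (- alpha) (- 1) (ln0 _)) powR_inv1 ?ltW.
by rewrite /B; set p := _ `^ _; field; rewrite gt_eqF.
Qed.

(** Both series demand the same thing: d < 2 (alpha + 1 - gm) in time and d + 2 gm < 2 (alpha + 1)
    in space each amount to gm < alpha - d/2 + 1. *)
Lemma variance_integral (dl gm : R) : 0 < dl -> 0 < gm < 1 ->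
  gm < alpha - d%:R / 2 + 1 -> exists2 C : R, 0 < C & forall t s x y,
  0 <= t -> 0 <= s -> (forall z, `|z - x| <= dl -> D z) -> `|y - x| <= dl / 8 ->
  (\int[mu]_(r in `]0%R, +oo[) (mild_dist2 t x s y r)%:E <=
   (C * (`|t - s| `^ gm + `|x - y| `^ (2 * gm)))%:E)%E.
Proof.
move=> dl0 /andP[gm0 gm1] gmt.
have gm01 : 0 < gm <= 1 by rewrite gm0 ltW.
have p1 : d%:R < 2 * (alpha + 1 - gm) by lra.
have p2 : d%:R + 2 * gm < 2 * (alpha + 1) by lra.
have [C1 C10 H1] := potential_bound d0 oD bD E dl0 p1.
have [C2 C20 H2] := potential_difference d0 oD bD E dl0 gm01 p2.
exists (4 * C1 + 2 * C2); first by rewrite addr_gt0// mulr_gt0.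
move=> t s x y t0 s0 QD yx.
under eq_integral do rewrite mild_dist2_esum.
rewrite integral_nneseries//; last 2 first.
- by move=> n; apply/measurable_EFinP/measurable_funTS; exact: measurable_mild_term.
- by move=> n r _; rewrite lee_fin mild_term_ge0.
pose w n := 4 * `|t - s| `^ gm * (lam n `^ (- (alpha + 1 - gm)) * f n x ^+ 2) +
    2 * (lam n `^ (- (alpha + 1)) * (f n x - f n y) ^+ 2).
have h n : (\int[mu]_(r in `]0%R, +oo[) (mild_term t x s y n r)%:E <= (w n)%:E)%E.
  exact: (@mild_term_integral t x s y n gm t0 s0 gm01).
apply: (@le_trans _ _ (\sum_(n <oo) (w n)%:E)%E).
  apply: lee_nneseries => [n _ _|n _]; last exact: h.
  by apply: integral_ge0 => r _; rewrite lee_fin mild_term_ge0.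
have w0 n : 0 <= w n.
  exact: (addr_ge0
    (mulr_ge0 (mulr_ge0 (ler0n _ 4) (powR_ge0 _ _)) (mulr_ge0 (powR_ge0 _ _) (sqr_ge0 _)))
    (mulr_ge0 (ler0n _ 2) (mulr_ge0 (powR_ge0 _ _) (sqr_ge0 _)))).
apply: lime_le.
  by apply: is_cvg_nneseries => n _ _; rewrite lee_fin.
apply: nearW => N /=; rewrite sumEFin lee_fin /index_iota subn0 /w.
rewrite big_split/= -!mulr_sumr.
have e1 := H1 N x QD; have e2 := H2 N x y QD yx.
have T0 : 0 <= `|t - s| `^ gm by exact: powR_ge0.
have X0 : 0 <= `|x - y| `^ (2 * gm) by exact: powR_ge0.
apply: (@le_trans _ _ (4 * `|t - s| `^ gm * C1 + 2 * (C2 * `|x - y| `^ (2 * gm)))).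
  by rewrite lerD// ler_wpM2l// mulr_ge0.
rewrite -subr_ge0; set T := _ `^ gm in T0 *; set X := _ `^ (2 * gm) in X0 *.
have -> : (4 * C1 + 2 * C2) * (T + X) - (4 * T * C1 + 2 * (C2 * X)) =
  4 * (C1 * X) + 2 * (C2 * T) by ring.
by rewrite addr_ge0// mulr_ge0// mulr_ge0// ltW.
Qed.

Lemma mild_integrand0 x : mild 0 x = fun=> 0.
Proof.
apply/funext => r; rewrite /mild_integrand; case: ifP => // /andP[r0 r1].
by have := lt_trans r0 r1; rewrite ltxx.
Qed.

Lemma mild_bochner t x : d%:R / 2 - 1 < alpha -> 0 <= t -> D x -> bochner_L2 (mild t x).
Proof.
move=> ad t0 Dx; split; first exact: mild_strongly_measurable.
have [dl dl0 QD] : exists2 dl, 0 < dl & forall z, `|z - x| <= dl -> D z.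
  have [r r0 rD] := nbhs_row_cube (open_nbhs_nbhs (conj oD Dx)).
  exists (r / 2); first by rewrite divr_gt0.
  by move=> z zx; apply: rD; apply: le_lt_trans zx _; rewrite ltr_pdivrMr// ltr_pMr// ltr1n.
pose theta := alpha - d%:R / 2 + 1.
have th0 : 0 < theta by rewrite /theta; lra.
pose gm := Num.min (theta / 2) (1 / 2).
have gm0 : 0 < gm by rewrite lt_min !divr_gt0.
have gm1 : gm < 1 by rewrite gt_min orbC ltr_pdivrMr// mul1r ltr1n.
have gmt : gm < alpha - d%:R / 2 + 1.
  by rewrite -/theta gt_min ltr_pdivrMr// ltr_pMr// ltr1n.
have gm01 : 0 < gm < 1 by rewrite gm0.
have [C C0 HC] := variance_integral dl0 gm01 gmt.
have yx : `|x - x| <= dl / 8 by rewrite subrr normr0 divr_ge0// ltW.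
(* At s = 0 the mild integrand vanishes, so the squared norm is a squared distance already
   estimated. *)
have h := HC t 0 x x t0 (lexx _) QD yx; apply: le_lt_trans (le_trans _ h) (ltry _).
rewrite le_eqVlt; apply/orP; left; apply/eqP; apply: eq_integral => r _.
by rewrite /mild_dist2 mild_integrand0 subr0.
Qed.

End bochner.

(** * Gaussian tails and the isonormal process *)

Section gaussian_tail.
Context {R : realType}.
Local Notation mu := (@lebesgue_measure R).

Lemma measurable_norm_ge (a : R) : measurable [set x : R | a <= `|x|].
Proof.
rewrite (_ : [set x | _] = (fun x : R => `|x|) @^-1` `[a, +oo[%classic).
  by rewrite -[X in measurable X]setTI; apply: normr_measurable => //; exact: measurable_itv.
by apply/seteqP; split => x /=; rewrite in_itv/= andbT.
Qed.

(** Doubling the standard deviation frees 3 x^2 / (8 s^2) in the exponent, more than a^2 / (4 s^2)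
    when |x| >= a; the factor 2 is the ratio of the peaks. The tail is then bounded by the total
    mass of the wider law. *)
Lemma normal_pdf_double (s a x : R) : s != 0 -> 0 <= a -> a <= `|x| ->
  normal_pdf 0 s x <= 2 * expR (- (a ^+ 2 / (4 * s ^+ 2))) * normal_pdf 0 (2 * s) x.
Proof.
move=> s0 a0 ax.
have s20 : 2 * s != 0 by rewrite mulf_neq0.
have s2 : 0 < s ^+ 2 by rewrite exprn_even_gt0.
rewrite !normal_pdfE// /normal_peak /normal_fun !subr0.
have -> : Num.sqrt ((2 * s) ^+ 2 * pi *+ 2) = 2 * Num.sqrt (s ^+ 2 * pi *+ 2).
  rewrite exprMn -mulrA -mulrnAr sqrtrM ?sqr_ge0// sqrtr_sqr ger0_norm//.
set p := Num.sqrt _; have p0 : 0 < p.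
  by rewrite sqrtr_gt0 mulrn_wgt0// mulr_gt0// pi_gt0.
have -> : 2 * expR (- (a ^+ 2 / (4 * s ^+ 2))) *
   ((2 * p)^-1 * expR (- x ^+ 2 / ((2 * s) ^+ 2 *+ 2))) =
  p^-1 * (expR (- (a ^+ 2 / (4 * s ^+ 2))) * expR (- x ^+ 2 / ((2 * s) ^+ 2 *+ 2))).
  by field; rewrite gt_eqF.
rewrite ler_wpM2l ?invr_ge0 ?(ltW p0)// -expRD ler_expR.
have ax2 : a ^+ 2 <= x ^+ 2.
  by rewrite -(real_normK (num_real x)) lerXn2r ?nnegrE.
rewrite -subr_ge0.
have -> : - (a ^+ 2 / (4 * s ^+ 2)) + - x ^+ 2 / ((2 * s) ^+ 2 *+ 2) - - x ^+ 2 / (s ^+ 2 *+ 2) =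
  ((x ^+ 2 - a ^+ 2) * 2 + x ^+ 2) / (8 * s ^+ 2) by field; rewrite s0.
apply: divr_ge0; last by rewrite mulr_ge0 ?(ltW s2).
by rewrite addr_ge0 ?sqr_ge0// mulr_ge0// subr_ge0.
Qed.

Lemma normal_prob_tail (s a : R) : s != 0 -> 0 <= a ->
  (normal_prob 0 s [set x : R | (a <= `|x|)%R] <=
   (2 * expR (- (a ^+ 2 / (4 * s ^+ 2))))%:E)%E.
Proof.
move=> s0 a0; have s20 : 2 * s != 0 by rewrite mulf_neq0.
set c := 2 * expR _; have c0 : 0 <= c by rewrite mulr_ge0 ?expR_ge0.
have mp (m : R) : measurable_fun setT (EFin \o normal_pdf 0 m).
  by apply/measurable_EFinP; exact: measurable_normal_pdf.
apply: (@le_trans _ _ (\int[mu]_(x in [set x : R | (a <= `|x|)%R])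
    (c%:E * (normal_pdf 0 (2 * s) x)%:E))%E).
  rewrite /normal_prob; apply: ge0_le_integral => //.
  - exact: measurable_norm_ge.
  - by move=> x _; rewrite lee_fin normal_pdf_ge0.
  - by apply: measurable_funTS; exact: mp.
  - by apply: measurable_funTS; apply: measurable_funeM; exact: mp.
  - by move=> x ax; rewrite -EFinM lee_fin normal_pdf_double.
apply: (@le_trans _ _ (\int[mu]_x (c%:E * (normal_pdf 0 (2 * s) x)%:E))%E).
  apply: ge0_subset_integral => //.
  - exact: measurable_norm_ge.
  - by apply: measurable_funeM; exact: mp.
  - by move=> x _; rewrite mule_ge0 ?lee_fin ?normal_pdf_ge0.
rewrite ge0_integralZl_EFin//; last 2 first.
- by move=> x _; rewrite lee_fin normal_pdf_ge0.
- exact: mp.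
by rewrite integral_normal_pdf// mule1.
Qed.

(** The density is at most its peak on an interval of length |s|, and pi >= 2. It serves to recover
    s^2, up to a factor, from a bound on the second moment. *)
Lemma normal_prob_center (s : R) : s != 0 ->
  (normal_prob 0 s (~` [set x : R | (`|s| / 2 <= `|x|)%R]) <= (2^-1)%:E)%E.
Proof.
move=> s0; have sn : 0 < `|s| by rewrite normr_gt0.
have -> : ~` [set x : R | `|s| / 2 <= `|x|] = `](- (`|s| / 2)), (`|s| / 2)[%classic.
  by apply/seteqP; split => x /=; rewrite in_itv/= -ltr_norml ltNge => /negP.
apply: (@le_trans _ _ (\int[mu]_(x in `](- (`|s| / 2))%R, (`|s| / 2)%R[) (normal_peak s)%:E)%E).
  apply: ge0_le_integral => //.
  - by move=> x _; rewrite lee_fin normal_pdf_ge0.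
  - by apply: measurable_funTS; apply/measurable_EFinP; exact: measurable_normal_pdf.
  - by move=> x _; rewrite lee_fin normal_pdf_ub.
rewrite integral_cst//= lebesgue_measure_itv/= lte_fin ifT; last first.
  by rewrite -subr_gt0 opprK -splitr.
rewrite -EFinD -EFinM lee_fin opprK -splitr /normal_peak.
have p : 2 * `|s| <= Num.sqrt (s ^+ 2 * pi *+ 2).
  apply: le_trans (ler_norm _) _; apply: norm_le_of_sqr; first exact: sqrtr_ge0.
  rewrite sqr_sqrtr; last by rewrite mulrn_wge0// mulr_ge0 ?sqr_ge0 ?pi_ge0.
  rewrite exprMn real_normK ?num_real// -subr_ge0.
  have -> : s ^+ 2 * pi *+ 2 - 2 ^+ 2 * s ^+ 2 = s ^+ 2 * (2 * (pi - 2)) by ring.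
  by apply: mulr_ge0; rewrite ?sqr_ge0//; apply: mulr_ge0 => //; rewrite subr_ge0 pi_ge2.
have p0 : 0 < Num.sqrt (s ^+ 2 * pi *+ 2) by apply: lt_le_trans p; rewrite mulr_gt0.
by rewrite ler_pdivrMl// ler_pdivlMr// mulrC.
Qed.

Context {dO : measure_display} {Omega : measurableType dO} {P : probability Omega R}.

(** |X| >= |s| / 2 has probability at least 1/2, so the second moment is at least s^2 / 8. Thus s^2
    <= 8 q, and the 4 s^2 of [normal_prob_tail] becomes 32 q. *)
Lemma gaussian_tail (X : Omega -> R) (q a : R) : measurable_fun setT X ->
  centered_gaussian P X -> (\int[P]_w (X w ^+ 2)%:E <= q%:E)%E -> 0 < q -> 0 < a ->
  (P [set w | (a <= `|X w|)%R] <= (2 * expR (- (a ^+ 2 / (32 * q))))%:E)%E.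
Proof.
move=> mX [s sP] EX q0 a0.
have -> : [set w | a <= `|X w|] = X @^-1` [set x : R | a <= `|x|] by [].
rewrite sP; last exact: measurable_norm_ge.
case: eqVneq => [_|s0].
  rewrite diracE memNset; first by rewrite lee_fin mulr_ge0 ?expR_ge0.
  by rewrite /= normr0 leNgt a0.
apply: le_trans (normal_prob_tail s0 (ltW a0)) _.
have s2 : 0 < s ^+ 2 by rewrite exprn_even_gt0.
rewrite lee_fin ler_wpM2l// ler_expR lerN2 ler_wpM2l ?sqr_ge0//.
rewrite lef_pV2 ?posrE; [|exact: mulr_gt0|exact: mulr_gt0].
suff sq : s ^+ 2 <= 8 * q.
  have -> : 32 * q = 4 * (8 * q) by ring.
  by rewrite ler_wpM2l.
set B := [set x : R | `|s| / 2 <= `|x|].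
have mB : measurable B by exact: measurable_norm_ge.
have mXB : measurable (X @^-1` B) by rewrite -[X in measurable X]setTI; exact: mX.
have PB : ((2^-1)%:E <= P (X @^-1` B))%E.
  have PC : (P (~` (X @^-1` B)) <= (2^-1)%:E)%E.
    rewrite preimage_setC sP; last exact: measurableC.
    by rewrite (negPf s0); exact: normal_prob_center.
  have := probability_setC P mXB.
  move: PC => /[swap] ->; have /fineK <- := fin_num_measure P _ mXB.
  by rewrite -EFinB !lee_fin; lra.
have h : ((s ^+ 2 / 4)%:E * P (X @^-1` B) <= q%:E)%E.
  rewrite -integral_cst//; apply: le_trans EX.
  apply: (@le_trans _ _ (\int[P]_(w in X @^-1` B) (X w ^+ 2)%:E)%E).
    apply: ge0_le_integral => //.
    - by move=> w _; rewrite lee_fin divr_ge0 ?sqr_ge0.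
    - by apply/measurable_EFinP/measurable_funTS/measurable_funX.
    - move=> w /= sX; rewrite lee_fin -(real_normK (num_real (X w))).
      have -> : s ^+ 2 / 4 = (`|s| / 2) ^+ 2.
        by rewrite expr_div_n (real_normK (num_real s)); field.
      by rewrite lerXn2r ?nnegrE// divr_ge0.
  apply: ge0_subset_integral => //.
  - by apply/measurable_EFinP/measurable_funX.
  - by move=> w _; rewrite lee_fin sqr_ge0.
have : ((s ^+ 2 / 4)%:E * (2^-1)%:E <= q%:E)%E.
  by apply: le_trans h; rewrite lee_wpmul2l// lee_fin divr_ge0 ?sqr_ge0.
by rewrite -EFinM lee_fin; lra.
Qed.

End gaussian_tail.

(** * The isometry for differences *)

Section isonormal_difference.
Context {R : realType} {H : completeNormedModType R} {ip : H -> H -> R}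
  {dO : measure_display} {Omega : measurableType dO} {P : probability Omega R}
  {W : (R -> H) -> {RV P >-> R}}.
Local Notation mu := (@lebesgue_measure R).
Local Notation Ioo := (`]0%R, +oo[%classic : set R).
Hypothesis isoW : isonormal ip W.
Hypothesis ip_polar : forall u v, `|u - v| ^+ 2 = `|u| ^+ 2 - 2 * ip u v + `|v| ^+ 2.
Hypothesis ip_norm' : forall u, ip u u = `|u| ^+ 2.
Variables g h : R -> H.
Hypotheses (bg : bochner_L2 g) (bh : bochner_L2 h).
Hypothesis m1 : measurable_fun setT (fun r => `|g r| ^+ 2).
Hypothesis m2 : measurable_fun setT (fun r => `|h r| ^+ 2).
Hypothesis m3 : measurable_fun setT (fun r => `|g r - h r| ^+ 2).

(** [isonormal] speaks of finite combinations and does not assert that W is linear, so the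
    difference is taken as the combination with coefficients 1 and -1. *)
Lemma gaussian_difference : centered_gaussian P (fun w => W g w - W h w).
Proof.
have [G _] := isoW.
have b2 (i : 'I_2) : bochner_L2 ((fun i : 'I_2 => if i == ord0 then g else h) i).
  by case: ifP.
have := G 2%N _ (fun i : 'I_2 => if i == ord0 then 1 else -1) b2.
congr centered_gaussian; apply/funext => w.
by rewrite !big_ord_recl big_ord0/= addr0 mul1r mulN1r.
Qed.

(** Only mixed moments are given: the square is expanded into three of them and reassembled in H by
    polarisation. *)
Lemma isonormal_difference :
  (\int[P]_w ((W g w - W h w) ^+ 2)%:E = \int[mu]_(r in Ioo) (`|g r - h r| ^+ 2)%:E)%E.
Proof.
have [_ G] := isoW.
have mO : measurable (Ioo : set (measurableTypeR R)) by exact: measurable_itv.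
have sq_int (k : R -> H) : measurable_fun setT (fun r => `|k r| ^+ 2) -> bochner_L2 k ->
    mu.-integrable Ioo (EFin \o (fun r => `|k r| ^+ 2)).
  move=> mk [_ kfin]; apply/integrableP; split.
    by apply/measurable_EFinP/measurable_funTS.
  apply: le_lt_trans kfin; rewrite le_eqVlt; apply/orP; left; apply/eqP.
  by apply: eq_integral => r _ /=; rewrite ger0_norm// sqr_ge0.
have i1 := sq_int _ m1 bg; have i2 := sq_int _ m2 bh.
have i3 : mu.-integrable Ioo (EFin \o (fun r => `|g r - h r| ^+ 2)).
  have i12 := integrableD mO (integrableZl mO 2 i1) (integrableZl mO 2 i2).
  apply: le_integrable i12 => //; first by apply/measurable_EFinP/measurable_funTS.
  move=> r _ /=; rewrite lee_fin ger0_norm ?sqr_ge0//.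
  rewrite ger0_norm; last by rewrite addr_ge0// mulr_ge0 ?sqr_ge0.
  apply: (@le_trans _ _ ((`|g r| + `|h r|) ^+ 2)).
    by rewrite lerXn2r ?nnegrE ?addr_ge0//; exact: ler_normB.
  rewrite -subr_ge0; have -> : 2 * `|g r| ^+ 2 + 2 * `|h r| ^+ 2 - (`|g r| + `|h r|) ^+ 2 =
    (`|g r| - `|h r|) ^+ 2 by ring.
  exact: sqr_ge0.
pose I1 := \int[mu]_(r in Ioo) (`|g r| ^+ 2).
pose I2 := \int[mu]_(r in Ioo) (`|h r| ^+ 2).
pose I3 := \int[mu]_(r in Ioo) (`|g r - h r| ^+ 2).
have EI (k : R -> R) : mu.-integrable Ioo (EFin \o k) ->
    (\int[mu]_(r in Ioo) (k r)%:E = (\int[mu]_(r in Ioo) k r)%:E)%E.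
  by move=> ik; rewrite /Rintegral fineK//; exact: integrable_fin_num.
have ipE r : ip (g r) (h r) = 2^-1 * (`|g r| ^+ 2 + `|h r| ^+ 2 - `|g r - h r| ^+ 2).
  by rewrite ip_polar; field.
have i12 : mu.-integrable Ioo (EFin \o (fun r => `|g r| ^+ 2 + `|h r| ^+ 2)).
  by have := integrableD mO i1 i2; apply: eq_integrable.
have i123 : mu.-integrable Ioo (EFin \o (fun r => `|g r| ^+ 2 + `|h r| ^+ 2 - `|g r - h r| ^+ 2)).
  by have := integrableB mO i12 i3; apply: eq_integrable.
have iip : mu.-integrable Ioo (EFin \o (fun r => ip (g r) (h r))).
  by have := integrableZl mO 2^-1 i123; apply: eq_integrable => // r _ /=; rewrite ipE.
have I12 : \int[mu]_(r in Ioo) ip (g r) (h r) = 2^-1 * (I1 + I2 - I3).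
  rewrite -RintegralD// -RintegralB// -RintegralZl//.
  by apply: eq_Rintegral => r _; exact: ipE.
have EW (a b : R -> H) : bochner_L2 a -> bochner_L2 b ->
    mu.-integrable Ioo (EFin \o (fun r => ip (a r) (b r))) ->
    (\int[P]_w (W a w * W b w)%:E = (\int[mu]_(r in Ioo) ip (a r) (b r))%:E)%E.
  by move=> ba bb iab; have := G a b ba bb; rewrite -EI// unlock.
have mW (a b : R -> H) : measurable_fun setT (fun w => W a w * W b w).
  by apply: measurable_funM.
have Wsq (a : R -> H) : bochner_L2 a -> mu.-integrable Ioo (EFin \o (fun r => `|a r| ^+ 2)) ->
    (\int[P]_w (W a w * W a w)%:E = (\int[mu]_(r in Ioo) (`|a r| ^+ 2))%:E)%E.
  move=> ba ia; rewrite EW//; last first.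
    by apply: eq_integrable ia => // r _ /=; rewrite ip_norm'.
  by congr (_%:E); apply: eq_Rintegral => r _; rewrite ip_norm'.
have Wint (a : R -> H) : bochner_L2 a -> mu.-integrable Ioo (EFin \o (fun r => `|a r| ^+ 2)) ->
    P.-integrable setT (EFin \o (fun w => W a w * W a w)).
  move=> ba ia; apply/integrableP; split; first by apply/measurable_EFinP; exact: mW.
  under eq_integral => w _ do rewrite /= ger0_norm -?expr2 ?sqr_ge0//.
  by under eq_integral do rewrite expr2; rewrite Wsq// ltry.
have j1 := Wint _ bg i1; have j2 := Wint _ bh i2.
have j12 : P.-integrable setT (EFin \o (fun w => W g w * W h w)).
  have j := integrableD measurableT j1 j2.
  apply: le_integrable j => //; first by apply/measurable_EFinP; exact: mW.
  move=> w _ /=; rewrite lee_fin.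
  have sq0 (u : R) : 0 <= u * u by rewrite -expr2 sqr_ge0.
  rewrite [leRHS]ger0_norm ?addr_ge0// normrM.
  have gg : W g w * W g w = `|W g w| ^+ 2 by rewrite real_normK ?num_real// expr2.
  have hh : W h w * W h w = `|W h w| ^+ 2 by rewrite real_normK ?num_real// expr2.
  rewrite gg hh; set u := `|W g w|; set v := `|W h w|.
  have u0 : 0 <= u * v by apply: mulr_ge0; exact: normr_ge0.
  have := sqr_ge0 (u - v); have -> : (u - v) ^+ 2 = u ^+ 2 + v ^+ 2 - 2 * (u * v) by ring.
  by move: u0; set p := u * v; set q := u ^+ 2; set q' := v ^+ 2; lra.
have EP (k : Omega -> R) : P.-integrable setT (EFin \o k) ->
    (\int[P]_w (k w)%:E = (\int[P]_w k w)%:E)%E.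
  by move=> ik; rewrite /Rintegral fineK//; exact: integrable_fin_num.
have e1 : \int[P]_w (W g w * W g w) = I1 by have := Wsq _ bg i1; rewrite EP// => -[].
have e2 : \int[P]_w (W h w * W h w) = I2 by have := Wsq _ bh i2; rewrite EP// => -[].
have e12 : \int[P]_w (W g w * W h w) = 2^-1 * (I1 + I2 - I3).
  by have := EW _ _ bg bh iip; rewrite EP// I12 => -[].
have jm2 : P.-integrable setT (EFin \o (fun w => 2 * (W g w * W h w))).
  by have := integrableZl measurableT 2 j12; apply: eq_integrable.
have js : P.-integrable setT (EFin \o (fun w => W g w * W g w + W h w * W h w)).
  by have := integrableD measurableT j1 j2; apply: eq_integrable.
have jf : P.-integrable setT (EFin \o
    (fun w => W g w * W g w + W h w * W h w - 2 * (W g w * W h w))).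
  by have := integrableB measurableT js jm2; apply: eq_integrable.
rewrite EI// -/I3.
transitivity (\int[P]_w (W g w * W g w + W h w * W h w - 2 * (W g w * W h w))%:E)%E.
  by apply: eq_integral => w _; congr (_%:E); ring.
rewrite EP//; congr (_%:E); rewrite RintegralB// RintegralD// RintegralZl// e1 e2 e12.
by field.
Qed.

End isonormal_difference.

(** * Chaining along dyadic grids *)

Section chaining_estimates.
Context {R : realType}.
Local Notation ms := (@mesh R).

Lemma mesh_le1 n : ms n <= 1.
Proof. by rewrite invf_le1 ?exprn_gt0// exprn_ege1// ler1n. Qed.

Lemma meshS n : ms n = 2 * ms n.+1.
Proof. by rewrite /mesh exprS; field; rewrite expf_neq0. Qed.

Lemma le_mesh m n : (m <= n)%N -> ms n <= ms m.
Proof. by move=> mn; rewrite lef_pV2 ?posrE ?exprn_gt0// ler_weXn2l// ler1n. Qed.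

Lemma mesh_double n : ms (2 * n) = ms n ^+ 2.
Proof. by rewrite /mesh mulnC exprM exprVn. Qed.

Lemma powR_mesh (g : R) n : ms n `^ g = ((2^-1) `^ g) ^+ n.
Proof. by rewrite -powR_exprn// /mesh exprVn. Qed.

Lemma mesh_small (e : R) : 0 < e -> exists n, ms n < e.
Proof.
move=> e0; have /cvgrPdist_lt/(_ _ e0)[N _ h] := @mesh_cvg0 R.
by exists N; have := h N (leqnn N); rewrite sub0r normrN; apply: le_lt_trans; exact: ler_norm.
Qed.

Lemma gaussian_tail_decay (c dl : R) (b : nat) : 0 < c -> 0 < dl ->
  exists2 C : R, 0 < C &
    forall n, 2 * expR (- (c * ms n `^ (- dl))) <= C * ms n ^+ b.
Proof.
(* exp(-y) <= k! / y^k, with k dl >= b so that the power of the mesh reaches b. *)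
move=> c0 dl0; pose k := (Num.truncn (b%:R / dl)).+1.
have bk : b%:R <= dl * k%:R.
  have /andP[_] := @truncn_itv R (b%:R / dl) (divr_ge0 (ler0n _ _) (ltW dl0)).
  by rewrite ltr_pdivrMr// mulrC => /ltW.
exists (2 * (k`!%:R / c ^+ k)).
  by apply: mulr_gt0 => //; apply: divr_gt0; rewrite ?ltr0n ?fact_gt0 ?exprn_gt0.
move=> n; rewrite -mulrA; apply: ler_wpM2l => //.
have p0 : 0 < ms n `^ (- dl) by rewrite powR_gt0// mesh_gt0.
set y := c * _; have y0 : 0 < y by exact: mulr_gt0.
have yk : y ^+ k / k`!%:R <= expR y.
  by apply: le_trans (expR_ge1Dxn k.-1 (ltW y0)); rewrite lerDr.
rewrite expRN; apply: (@le_trans _ _ (y ^+ k / k`!%:R)^-1).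
  rewrite lef_pV2 ?posrE ?expR_gt0//.
  by apply: divr_gt0; rewrite ?ltr0n ?fact_gt0 ?exprn_gt0.
have -> : (y ^+ k / k`!%:R)^-1 = k`!%:R / c ^+ k * ((ms n `^ (- dl)) ^+ k)^-1.
  rewrite /y exprMn; field.
  by rewrite !expf_neq0 ?gt_eqF//= ltr0n fact_gt0.
apply: ler_wpM2l; first by apply: divr_ge0; rewrite ?ler0n ?exprn_ge0 ?(ltW c0).
rewrite powRN exprVn invrK -(powR_mulrn k (powR_ge0 _ _)) -powRrM
  -(powR_mulrn b (ltW (@mesh_gt0 R n))).
by rewrite ger_powR// mesh_gt0 mesh_le1.
Qed.

Lemma geometric_chain (a : nat -> R) (q : R) N : 0 < q < 1 ->
  (forall n, (N <= n)%N -> `|a n.+1 - a n| <= q ^+ n) ->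
  cvgn a /\ forall n, (N <= n)%N -> `|limn a - a n| <= q ^+ n / (1 - q).
Proof.
move=> /andP[q0 q1] aq; have q10 : 0 < 1 - q by rewrite subr_gt0.
(* Keeping the subtracted tail makes the induction on k close. *)
have step n k : (N <= n)%N -> `|a (n + k)%N - a n| <= q ^+ n / (1 - q) - q ^+ (n + k) / (1 - q).
  move=> Nn; elim: k => [|k IH]; first by rewrite addn0 !subrr normr0.
  have -> : a (n + k.+1)%N - a n = (a (n + k).+1 - a (n + k)%N) + (a (n + k)%N - a n).
    by rewrite addnS; ring.
  apply: le_trans (ler_normD _ _) (le_trans (lerD (aq _ _) IH) _).
    by rewrite (leq_trans Nn)// leq_addr.
  rewrite addnS exprS le_eqVlt; apply/orP; left; apply/eqP.
  by field; rewrite gt_eqF.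
have step' n k : (N <= n)%N -> `|a (n + k)%N - a n| <= q ^+ n / (1 - q).
  move=> Nn; apply: le_trans (step n k Nn) _.
  by rewrite gerBl divr_ge0 ?exprn_ge0 ?(ltW q0) ?(ltW q10).
have q_cvg : (fun n => q ^+ n / (1 - q)) @ \oo --> (0 : R).
  rewrite -[X in _ --> X](mul0r (1 - q)^-1).
  have c : (fun n => q ^+ n) @ \oo --> (0 : R).
    by apply: cvg_expr; rewrite ger0_norm ?(ltW q0).
  exact: (cvgM c (cvg_cst _)).
have ca : cvgn a.
  apply/cauchy_cvgP/cauchy_ballP => e e0; rewrite near_map2.
  have e2 : 0 < e / 2 by rewrite divr_gt0.
  have /cvgrPdist_lt/(_ _ e2)[M _ h] := q_cvg.
  have tail n : (maxn M N <= n)%N -> `|a n - a (maxn M N)| < e / 2.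
    move=> hn; rewrite -(subnKC hn); apply: le_lt_trans (step' _ _ (leq_maxr _ _)) _.
    by have := h (maxn M N) (leq_maxl _ _); rewrite sub0r normrN; apply: le_lt_trans;
      exact: ler_norm.
  exists ([set n | (maxn M N <= n)%N], [set n | (maxn M N <= n)%N]).
    by split; exists (maxn M N).
  move=> [i j] /= [hi hj]; rewrite /ball/= (splitr e).
  have -> : a i - a j = (a i - a (maxn M N)) - (a j - a (maxn M N)) by ring.
  by apply: le_lt_trans (ler_normB _ _) (ltrD (tail i hi) (tail j hj)).
split=> // n Nn.
have c : (fun k => `|a k - a n|) @ \oo --> `|limn a - a n|.
  exact: (cvg_norm (cvgB ca (cvg_cst _))).
rewrite -(cvg_lim _ c)//; apply: limr_le; first exact: cvgP c.
by exists n => // k /= nk; rewrite -(subnKC nk); exact: step'.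
Qed.

(** Borel-Cantelli; the sets are shifted by N so that the summable bound holds from the first
    term. *)
Lemma eventually_not {dO : measure_display} {Omega : measurableType dO}
    (P : probability Omega R) (F : nat -> set Omega) (C : R) N :
  (forall n, measurable (F n)) ->
  (forall n, (N <= n)%N -> (P (F n) <= (C * ms n)%:E)%E) ->
  {ae P, forall w, exists M, forall n, (M <= n)%N -> ~ F n w}.
Proof.
move=> mF PF; pose G n := F (n + N)%N.
have mG n : measurable (G n) by exact: mF.
have C0 : 0 <= C.
  have := le_trans (measure_ge0 _ _) (PF N (leqnn N)).
  by rewrite lee_fin pmulr_lge0// mesh_gt0.
have G0 : P (lim_sup_set G) = 0%E.
  apply: lim_sup_set_cvg0 => //.
  apply: (@le_lt_trans _ _ (\sum_(n <oo) (C * ms n)%:E)%E).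
    apply: lee_nneseries => [n _ _|n _]; first exact: measure_ge0.
    apply: le_trans (PF _ (leq_addl _ _)) _.
    by rewrite lee_fin ler_wpM2l// le_mesh// leq_addr.
  have cm : cvgn (series (fun n => C * ms n)).
    have := @is_cvg_geometric_series R C 2^-1.
    rewrite ger0_norm// invf_lt1// ltr1n => /(_ isT).
    suff -> : geometric C 2^-1 = (fun n => C * ms n) by [].
    by apply/funext => n; rewrite /geometric/= /mesh exprVn.
  by rewrite EFin_series ?ltry.
exists (lim_sup_set G); split => //.
  by apply: bigcap_measurable => // k _; apply: bigcup_measurable => j _.
move=> w /= nw k _; apply: contrapT => h; apply: nw; exists (k + N)%N => n kn Fn.
apply: h; exists (n - N)%N; first by move: kn => /=; lia.
by rewrite /G subnK//; move: kn => /=; lia.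
Qed.

End chaining_estimates.

(** * Pathwise chaining *)

Section grid_chaining.
Context {R : realType} {d : nat} (D : set 'rV[R]_d) (A m : nat).
Local Notation ms := (@mesh R).

Definition grid_time n (t : R) : R := trunc_grid (ms (2 * n)) t.

(** The shift by A makes the coordinates of points of D nonnegative, as truncation requires. *)
Definition grid_space n (x : 'rV[R]_d) : 'rV[R]_d :=
  \row_i (trunc_grid (ms n) (x ord0 i + A%:R) - A%:R).

Definition deep k (x : 'rV[R]_d) : Prop := forall y, `|y - x| <= ms k -> D y.

(* Large enough for both levels n and n + 1 of the grid on [0, m] x D. *)
Definition grid_size n := ((m + 2 * A) * 4 ^ n.+1).+1.

Definition grid_index n : finType := ('I_(grid_size n) * {ffun 'I_d -> 'I_(grid_size n)})%type.

Definition grid_point n l (i : grid_index n) : R * 'rV[R]_d :=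
  ((i.1)%:R * ms (2 * l), \row_j ((i.2 j)%:R * ms l - A%:R)).

(** Points within one mesh of each other, rounded at level n or n + 1, end up within three meshes,
    hence within four. *)
Definition close_points n (p q : R * 'rV[R]_d) : Prop :=
  `|p.1 - q.1| <= 4 * ms (2 * n) /\ `|p.2 - q.2| <= 4 * ms n.

Hypothesis DA : forall x, D x -> `|x| <= A%:R.

Lemma deep_D k x : deep k x -> D x.
Proof. by apply; rewrite subrr normr0 ltW// mesh_gt0. Qed.

Lemma grid_space_dist n x : D x -> `|x - grid_space n x| <= ms n.
Proof.
move=> /DA xA; have m0 := @mesh_gt0 R n; apply: row_norm_le; first exact: ltW.
move=> i; rewrite !mxE.
have -> : x ord0 i - (trunc_grid (ms n) (x ord0 i + A%:R) - A%:R) =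
  (x ord0 i + A%:R) - trunc_grid (ms n) (x ord0 i + A%:R) by ring.
apply: trunc_grid_dist => //; rewrite -lerBlDr sub0r.
have := le_trans (coord_le_norm x i) xA; by rewrite ler_norml => /andP[].
Qed.

Lemma grid_time_dist n t : 0 <= t -> `|t - grid_time n t| <= ms (2 * n).
Proof. by move=> t0; apply: trunc_grid_dist => //; exact: mesh_gt0. Qed.

Lemma grid_time_ge0 n t : 0 <= grid_time n t.
Proof. by apply: trunc_grid_ge0; exact: mesh_gt0. Qed.

(** Rounding uses up at most half of the depth, which is one level. *)
Lemma deep_grid k n x : (k < n)%N -> deep k x -> deep k.+1 (grid_space n x).
Proof.
move=> kn kx y yx; apply: (kx); rewrite meshS.
have -> : y - x = (y - grid_space n x) - (x - grid_space n x).
  by rewrite opprB addrA subrK.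
apply: le_trans (ler_normB _ _) _; rewrite mulr_natl mulr2n; apply: lerD => //.
by apply: le_trans (grid_space_dist n (deep_D kx)) _; exact: le_mesh.
Qed.

Lemma grid_point_index n (e : bool) t x : 0 <= t <= m%:R -> D x ->
  exists i : grid_index n, grid_point (n + e) i = (grid_time (n + e) t, grid_space (n + e) x).
Proof.
move=> /andP[t0 tm] Dx; set l := (n + e)%N.
have e4 : 4 = 2 ^+ 2 :> R by ring.
have ln : (l <= n.+1)%N by rewrite /l; case: (e); lia.
have small (r : R) k (B : nat) : 0 <= r <= B%:R -> (k <= 2 * n.+1)%N -> (B <= m + 2 * A)%N ->
    (Num.truncn (r / ms k) < grid_size n)%N.
  move=> /andP[r0 rB] kn Bm; rewrite ltnS truncn_le_nat.
  apply: (@le_lt_trans _ _ (((m + 2 * A) * 4 ^ n.+1)%:R : R)); last by rewrite ltr_nat.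
  rewrite natrM natrX e4 -exprM /mesh invrK.
  apply: ler_pM; [exact: r0|exact: exprn_ge0|by apply: le_trans rB _; rewrite ler_nat|].
  by rewrite ler_weXn2l// ler1n.
have ht : (Num.truncn (t / ms (2 * l)) < grid_size n)%N.
  by apply: (small _ _ m); rewrite ?t0 ?tm//; lia.
have hx j : (Num.truncn ((x ord0 j + A%:R) / ms l) < grid_size n)%N.
  apply: (small _ _ (2 * A)%N); [|lia|lia].
  have := le_trans (coord_le_norm x j) (DA Dx); rewrite ler_norml natrM => /andP[h1 h2].
  by apply/andP; split; lra.
exists (Ordinal ht, [ffun j => Ordinal (hx j)]); congr (_, _).
by apply/rowP => j; rewrite !mxE ffunE.
Qed.

Variables (u : R -> 'rV[R]_d -> R) (g : R).
Hypothesis g0 : 0 < g.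

(** e = false compares neighbours on level n, e = true compares levels n and n + 1: these are the
    increments that chaining uses. *)
Definition grid_bound n : Prop := forall (e : bool) (i j : grid_index n),
  let p := grid_point n i in let q := grid_point (n + e) j in
  deep m.+1 p.2 -> deep m.+1 q.2 -> close_points n p q ->
  `|u p.1 p.2 - u q.1 q.2| <= ms n `^ g.

Variable N : nat.
Hypotheses (mN : (m < N)%N) (uN : forall n, (N <= n)%N -> grid_bound n).

Local Notation un n t x := (u (grid_time n t) (grid_space n x)).
Local Notation v t x := (limn (fun n => un n t x)).
Local Notation q := ((2^-1 : R) `^ g).

Lemma grid_close n (e : bool) t x s y : (N <= n)%N -> 0 <= t <= m%:R -> 0 <= s <= m%:R ->
  deep m x -> deep m y -> `|t - s| <= ms (2 * n) -> `|x - y| <= ms n ->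
  `|un n t x - un (n + e) s y| <= ms n `^ g.
Proof.
move=> Nn tm sm kx ky ts xy.
have [i ip] := grid_point_index n false tm (deep_D kx).
have [j jp] := grid_point_index n e sm (deep_D ky).
rewrite addn0 in ip.
have := uN Nn (e := e) (i := i) (j := j); cbv zeta; rewrite ip jp; apply.
- by apply: deep_grid => //; exact: leq_trans Nn.
- by apply: deep_grid => //; rewrite (leq_trans (leq_trans mN Nn))// leq_addr.
have /andP[t0 _] := tm; have /andP[s0 _] := sm.
have le1 : ms (n + e) <= ms n by apply: le_mesh; rewrite leq_addr.
have le2 : ms (2 * (n + e)) <= ms (2 * n) by apply: le_mesh; rewrite leq_mul2l leq_addr.
have p1 := @mesh_gt0 R n; have p2 := @mesh_gt0 R (2 * n).
split=> /=.
  have := grid_time_dist n t0; have := grid_time_dist (n + e) s0.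
  move: ts le2 p2; rewrite !ler_norml => /andP[? ?] ? ? /andP[? ?] /andP[? ?].
  by apply/andP; split; lra.
have h1 := grid_space_dist n (deep_D kx); have h2 := grid_space_dist (n + e) (deep_D ky).
have -> : grid_space n x - grid_space (n + e) y =
    (x - y) + (y - grid_space (n + e) y) - (x - grid_space n x).
  by apply/rowP => k; rewrite !mxE; ring.
apply: le_trans (ler_normB _ _) (le_trans (lerD (ler_normD _ _) (lexx _)) _).
by move: xy le1 p1 h1 h2; lra.
Qed.

Lemma q_itv : 0 < q < 1.
Proof.
rewrite powR_gt0//=; have e1 : 1 = (1 : R) `^ g by rewrite powR1.
rewrite [X in _ < X]e1.
by apply: gt0_ltr_powR; rewrite ?nnegrE ?invr_ge0 ?ler0n ?ler01//; lra.
Qed.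

Lemma grid_limit t x : 0 <= t <= m%:R -> deep m x -> cvgn (fun n => un n t x) /\
  forall n, (N <= n)%N -> `|v t x - un n t x| <= ms n `^ g / (1 - q).
Proof.
move=> tm kx.
have [] := @geometric_chain R (fun n => un n t x) q N q_itv.
  move=> n Nn; rewrite -powR_mesh distrC -[in n.+1]addn1.
  by apply: (grid_close true) => //; rewrite subrr normr0 ltW// mesh_gt0.
by move=> c h; split => // n Nn; rewrite powR_mesh; exact: h.
Qed.

Lemma limit_close n t x s y : (N <= n)%N -> 0 <= t <= m%:R -> 0 <= s <= m%:R ->
  deep m x -> deep m y -> `|t - s| <= ms (2 * n) -> `|x - y| <= ms n ->
  `|v t x - v s y| <= (2 / (1 - q) + 1) * ms n `^ g.
Proof.
move=> Nn tm sm kx ky ts xy.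
have [_ /(_ _ Nn) h1] := grid_limit tm kx; have [_ /(_ _ Nn) h2] := grid_limit sm ky.
have := grid_close false Nn tm sm kx ky ts xy; rewrite addn0 => h3.
have -> : v t x - v s y =
  (v t x - un n t x) - (v s y - un n s y) + (un n t x - un n s y) by ring.
apply: le_trans (ler_normD _ _) (le_trans (lerD (ler_normB _ _) (lexx _)) _).
apply: le_trans (lerD (lerD h1 h2) h3) _.
by rewrite le_eqVlt; apply/orP; left; apply/eqP; ring.
Qed.

(** For points more than a mesh of level N apart, where chaining says nothing; level N has finitely
    many grid points. *)
Lemma limit_bounded : exists2 M : R, 0 < M &
  forall t x, 0 <= t <= m%:R -> deep m x -> `|v t x| <= M.
Proof.
have /andP[q0 q1] := q_itv; have q10 : 0 < 1 - q by rewrite subr_gt0.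
have e0 : 0 < ms N `^ g / (1 - q) by rewrite divr_gt0// powR_gt0// mesh_gt0.
pose S := \sum_(i : grid_index N) `|u (grid_point N i).1 (grid_point N i).2|.
have S0 : 0 <= S by apply: sumr_ge0.
exists (S + ms N `^ g / (1 - q)); first by rewrite ltr_wpDl.
move=> t x tm kx; have [_ /(_ _ (leqnn N)) h] := grid_limit tm kx.
have [i] := grid_point_index N false tm (deep_D kx); rewrite addn0 => ip.
rewrite -(subrK (un N t x) (v t x)) addrC; apply: le_trans (ler_normD _ _) (lerD _ h).
rewrite /S (bigD1 i)// ip lerDl; exact: sumr_ge0.
Qed.

(** Let k be the last level, from N on, with |t - s| <= 4^-k and |x - y| <= 2^-k. One of the two
    fails at k + 1, so that distance controls the mesh at level k, up to the factor 4 or 2 appearing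
    in C3 and C4. *)
Lemma limit_holder (b0 b1 : R) : 0 < b0 -> 0 < b1 -> 2 * b0 <= g -> b1 <= g ->
  exists C : R, forall t x s y, 0 <= t <= m%:R -> 0 <= s <= m%:R -> deep m x -> deep m y ->
    `|v t x - v s y| <= C * (`|t - s| `^ b0 + `|x - y| `^ b1).
Proof.
move=> b00 b10 b0g b1g; have [M M0 HM] := limit_bounded.
have /andP[q0 q1] := q_itv; have q10 : 0 < 1 - q by rewrite subr_gt0.
pose c := 2 / (1 - q) + 1; have c0 : 0 < c by rewrite addr_gt0// divr_gt0.
pose C1 := 2 * M / ms (2 * N) `^ b0; pose C2 := 2 * M / ms N `^ b1.
pose C3 := c * 4 `^ b0; pose C4 := c * 2 `^ b1.
have C10 : 0 < C1 by apply: divr_gt0; [exact: mulr_gt0|rewrite powR_gt0// mesh_gt0].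
have C20 : 0 < C2 by apply: divr_gt0; [exact: mulr_gt0|rewrite powR_gt0// mesh_gt0].
have C30 : 0 < C3 by apply: mulr_gt0 => //; rewrite powR_gt0.
have C40 : 0 < C4 by apply: mulr_gt0 => //; rewrite powR_gt0.
exists (C1 + C2 + C3 + C4) => t x s y tm sm kx ky.
have a0 : 0 <= `|t - s| `^ b0 by exact: powR_ge0.
have a1 : 0 <= `|x - y| `^ b1 by exact: powR_ge0.
set a := `|t - s| `^ b0 in a0 *; set b := `|x - y| `^ b1 in a1 *.
have by_a (k : R) : k <= C1 + C2 + C3 + C4 -> `|v t x - v s y| <= k * a ->
    `|v t x - v s y| <= (C1 + C2 + C3 + C4) * (a + b).
  move=> kC h; apply: le_trans h _; apply: (@le_trans _ _ ((C1 + C2 + C3 + C4) * a)).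
    exact: ler_wpM2r.
  by apply: ler_wpM2l; rewrite ?lerDl// ltW// !addr_gt0.
have by_b (k : R) : k <= C1 + C2 + C3 + C4 -> `|v t x - v s y| <= k * b ->
    `|v t x - v s y| <= (C1 + C2 + C3 + C4) * (a + b).
  move=> kC h; apply: le_trans h _; apply: (@le_trans _ _ ((C1 + C2 + C3 + C4) * b)).
    exact: ler_wpM2r.
  by apply: ler_wpM2l; rewrite ?lerDr// ltW// !addr_gt0.
have dM : `|v t x - v s y| <= 2 * M.
  apply: le_trans (ler_normB _ _) _; rewrite mulr_natl mulr2n.
  by apply: lerD; exact: HM.
pose Q n := (`|t - s| <= ms (2 * n)) && (`|x - y| <= ms n).
have [tN|tN] := leP `|t - s| (ms (2 * N)); last first.
  apply: (by_a C1); first by rewrite -!addrA lerDl !addr_ge0// ltW.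
  apply: le_trans dM _; rewrite /C1 mulrAC ler_pdivlMr ?powR_gt0 ?mesh_gt0//.
  apply: ler_wpM2l; first by rewrite mulr_ge0// ltW.
  by rewrite ge0_ler_powR ?nnegrE ?(ltW b00)// ltW// mesh_gt0.
have [xN|xN] := leP `|x - y| (ms N); last first.
  apply: (by_b C2).
    by rewrite -!addrA addrCA lerDl !addr_ge0// ltW.
  apply: le_trans dM _; rewrite /C2 mulrAC ler_pdivlMr ?powR_gt0 ?mesh_gt0//.
  apply: ler_wpM2l; first by rewrite mulr_ge0// ltW.
  by rewrite ge0_ler_powR ?nnegrE ?(ltW b10)// ltW// mesh_gt0.
have QN : Q N by rewrite /Q tN xN.
(* Equal points satisfy the conditions at every level and are treated apart. *)
have [/andP[/eqP ts /eqP xy]|] := boolP ((t == s) && (x == y)).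
  rewrite ts xy subrr normr0; apply: mulr_ge0; last exact: addr_ge0.
  by rewrite !addr_ge0// ltW.
move=> ne.
have ex : exists n, (N <= n)%N && ~~ Q n.
  have small (r : R) : 0 < r -> exists n, forall k, (n <= k)%N -> ms k < r.
    move=> r0; have [n hn] := mesh_small r0; exists n => k nk.
    by apply: le_lt_trans hn; exact: le_mesh.
  move: ne; rewrite negb_and => /orP[ts|xy].
    have r0 : 0 < `|t - s| by rewrite normr_gt0 subr_eq0.
    have [n hn] := small _ r0; exists (maxn n N); rewrite leq_maxr/= negb_and.
    by rewrite -!ltNge hn// (leq_trans (leq_maxl n N))// leq_pmull.
  have r0 : 0 < `|x - y| by rewrite normr_gt0 subr_eq0.
  have [n hn] := small _ r0; exists (maxn n N); rewrite leq_maxr/= negb_and.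
  by rewrite -!ltNge (hn (maxn n N)) ?orbT// leq_maxl.
have [k /andP[Nk nQ] kmin] := ex_minnP ex.
have kN : (N < k)%N by rewrite ltn_neqAle Nk andbT; apply: contraNneq nQ => <-.
case: k kN Nk nQ kmin => [|k]//; rewrite ltnS => Nk _ nQ kmin.
have /andP[tk xk] : Q k.
  by apply: contraT => nk; have := kmin k; rewrite Nk nk ltnn => /(_ isT).
have h := limit_close Nk tm sm kx ky tk xk.
have m0 := @mesh_gt0 R k; have m1 := @mesh_le1 R k.
move: nQ; rewrite negb_and -!ltNge => /orP[nt|nx].
  apply: (by_a C3); first by rewrite [leRHS]addrAC lerDr !addr_ge0// ltW.
  apply: le_trans h _; rewrite /C3 -mulrA; apply: ler_wpM2l; first exact: ltW.
  apply: (@le_trans _ _ (ms k `^ (2 * b0))); first by rewrite ger_powR// m0.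
  rewrite powRrM -powRM//; apply: ge0_ler_powR; rewrite ?nnegrE ?powR_ge0 ?(ltW b00)//.
  rewrite powR_mulrn ?(ltW m0)// -mesh_double.
  have -> : ms (2 * k) = 4 * ms (2 * k.+1) by rewrite !mesh_double (meshS k); ring.
  by rewrite ler_wpM2l// ltW.
apply: (by_b C4); first by rewrite lerDr !addr_ge0// ltW.
apply: le_trans h _; rewrite /C4 -mulrA; apply: ler_wpM2l; first exact: ltW.
apply: (@le_trans _ _ (ms k `^ b1)); first by rewrite ger_powR// m0.
rewrite -powRM//; apply: ge0_ler_powR; rewrite ?nnegrE ?(ltW b10) ?(ltW m0)//.
by rewrite meshS ler_wpM2l// ltW.
Qed.

End grid_chaining.

Lemma probability_bigsetU {R : realType} {dO : measure_display} {Omega : measurableType dO}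
    (P : probability Omega R) (I : Type) (s : seq I) (c : pred I) (F : I -> set Omega) (b : R) :
  (forall i, c i -> measurable (F i)) -> (forall i, c i -> (P (F i) <= b%:E)%E) -> 0 <= b ->
  measurable (\big[setU/set0]_(i <- s | c i) F i) /\
  (P (\big[setU/set0]_(i <- s | c i) F i) <= ((size s)%:R * b)%:E)%E.
Proof.
move=> mF PF b0; elim: s => [|i s [IH1 IH2]].
  by rewrite big_nil measure0 mul0r.
rewrite big_cons; case: ifP => ci; split => //.
- by apply: measurableU => //; exact: mF.
- apply: (@le_trans _ _ (P (F i) + P (\big[setU/set0]_(j <- s | c j) F j))%E).
    by apply: measureU2 => //; exact: mF.
  rewrite /= -natr1 mulrDl mul1r addrC EFinD.
  by apply: leeD => //; exact: PF.
- by apply: le_trans IH2 _; rewrite lee_fin ler_wpM2r// ler_nat.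
Qed.

(** * The stochastic integral along the grids *)

Section stochastic_integral.
Context {R : realType} {d : nat} {D : set 'rV[R]_d} {lam : nat -> R}
  {f : nat -> 'rV[R]_d -> R} {alpha : R} {H : completeNormedModType R}
  {ip : H -> H -> R} {J : ('rV[R]_d -> R) -> H}
  {dO : measure_display} {Omega : measurableType dO} {P : probability Omega R}
  {W : (R -> H) -> {RV P >-> R}}.
Hypotheses (d0 : (0 < d)%N) (oD : open D) (bD : bounded_set D)
  (bdD : C2_boundary D) (E : dirichlet_eigensystem D lam f) (alpha0 : 0 < alpha)
  (comp : alpha_completion D alpha lam f ip J) (alphad : d%:R / 2 - 1 < alpha)
  (isoW : isonormal ip W).
Local Notation ms := (@mesh R).
Local Notation mild := (mild_integrand lam f J).
Local Notation dist2 := (@mild_dist2 R d lam f H J).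

(* At t = 0, where mild_solution is 0, this is 0 only almost surely. *)
Definition mild_value (t : R) (x : 'rV[R]_d) (w : Omega) : R := W (mild t x) w.

Lemma measurable_mild_value t x : measurable_fun setT (mild_value t x).
Proof. exact: measurable_funPT. Qed.

Lemma measurable_difference (u v : Omega -> R) (a : R) : measurable_fun setT u ->
  measurable_fun setT v -> measurable [set w | a <= `|u w - v w|].
Proof.
move=> mu mv; have m : measurable_fun setT (fun w => u w - v w) by exact: measurable_funB.
have -> : [set w | a <= `|u w - v w|] =
  (fun w => u w - v w) @^-1` [set x : R | a <= `|x|] by [].
by rewrite -[X in measurable X]setTI; apply: m => //; exact: measurable_norm_ge.
Qed.

Lemma mild_gaussian t x s y : 0 <= t -> 0 <= s -> D x -> D y ->
  centered_gaussian P (fun w => mild_value t x w - mild_value s y w).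
Proof.
move=> t0 s0 Dx Dy; apply: (gaussian_difference isoW).
  exact: (mild_bochner d0 oD bD bdD E alpha0 comp alphad t0 Dx).
exact: (mild_bochner d0 oD bD bdD E alpha0 comp alphad s0 Dy).
Qed.

Lemma mild_variance t x s y : 0 <= t -> 0 <= s -> D x -> D y ->
  (\int[P]_w ((mild_value t x w - mild_value s y w) ^+ 2)%:E =
   \int[lebesgue_measure]_(r in `]0%R, +oo[) (dist2 t x s y r)%:E)%E.
Proof.
move=> t0 s0 Dx Dy.
have bx := mild_bochner d0 oD bD bdD E alpha0 comp alphad t0 Dx.
have by' := mild_bochner d0 oD bD bdD E alpha0 comp alphad s0 Dy.
have polar u v : `|u - v| ^+ 2 = `|u| ^+ 2 - 2 * ip u v + `|v| ^+ 2.
  by rewrite -!(ip_norm comp) (ip_sub comp).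
have m1 t' x' : measurable_fun setT (fun r => `|mild t' x' r| ^+ 2).
  have := measurable_mild_dist2 d0 oD bD bdD E alpha0 comp t' x' 0 x'.
  suff -> : dist2 t' x' 0 x' = (fun r => `|mild t' x' r| ^+ 2) by [].
  by apply/funext => r; rewrite /mild_dist2 mild_integrand0 subr0.
have m3 := measurable_mild_dist2 d0 oD bD bdD E alpha0 comp t x s y.
exact: (isonormal_difference isoW polar (ip_norm comp) bx by' (m1 t x) (m1 s y) m3).
Qed.

Local Notation Theta := (Num.min (alpha - d%:R / 2 + 1) 1).

(** With gm strictly between g and Theta, the variance is of order 2^(-2 gm n) and the squared
    threshold 2^(-2 g n). Their ratio grows like a power of 2^n, so the Gaussian tail beats any
    prescribed power of the mesh. *)
Lemma close_points_tail (k b : nat) (g : R) : 0 < g < Theta -> exists2 C : R, 0 < C &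
  forall n (p q : R * 'rV[R]_d), (k + 5 <= n)%N -> 0 <= p.1 -> 0 <= q.1 -> deep D k p.2 ->
    close_points n p q ->
    (P [set w | (ms n `^ g <= `|mild_value p.1 p.2 w - mild_value q.1 q.2 w|)%R]
      <= (C * ms n ^+ b)%:E)%E.
Proof.
move=> /andP[g0 gT]; pose gm := (g + Theta) / 2.
have ggm : g < gm by rewrite /gm; move: gT; set T := Num.min _ _; lra.
have gmT : gm < Theta by rewrite /gm; move: gT; set T := Num.min _ _; lra.
have gm0 : 0 < gm by exact: lt_trans ggm.
have [gm1 gm2] : gm < alpha - d%:R / 2 + 1 /\ gm < 1 by move: gmT; rewrite lt_min => /andP[].
have gm01 : 0 < gm < 1 by rewrite gm0.
have [C C0 HC] := variance_integral d0 oD bD bdD E alpha0 comp (@mesh_gt0 R k) gm01 gm1.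
pose C1 := C * (4 `^ gm + 4 `^ (2 * gm)).
have C10 : 0 < C1 by apply: mulr_gt0 => //; rewrite addr_gt0// powR_gt0.
have c0 : 0 < (32 * C1)^-1 by rewrite invr_gt0 mulr_gt0.
have dl0 : 0 < 2 * (gm - g) by rewrite mulr_gt0// subr_gt0.
have [C' C'0 HC'] := gaussian_tail_decay b c0 dl0.
exists C' => // n [t x] [s y] /= kn t0 s0 kx [/= ts xy].
have m0 := @mesh_gt0 R n.
(* The five levels of k + 5 provide the factor 32 = 4 * 8, from 4 meshes to an eighth of the
   depth. *)
have xy8 : `|y - x| <= ms k / 8.
  rewrite distrC; apply: le_trans xy _.
  have := @le_mesh R _ _ kn; have -> : ms k = 32 * ms (k + 5).
    by rewrite addnS 4!addnS addn0 5!meshS; ring.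
  by lra.
have Dx := deep_D kx; have Dy : D y.
  by apply: kx; apply: le_trans xy8 _; have := @mesh_gt0 R k; lra.
have q0 : 0 < C1 * ms n `^ (2 * gm) by apply: mulr_gt0 => //; rewrite powR_gt0.
have a0 : 0 < ms n `^ g by rewrite powR_gt0.
have m : measurable_fun setT (fun w => mild_value t x w - mild_value s y w).
  by apply: measurable_funB; exact: measurable_mild_value.
apply: le_trans (gaussian_tail m (mild_gaussian t0 s0 Dx Dy) _ q0 a0) _.
  rewrite mild_variance//; apply: le_trans (HC t s x y t0 s0 kx xy8) _.
  rewrite lee_fin /C1 -mulrA ler_wpM2l ?(ltW C0)// [leRHS]mulrDl; apply: lerD.
    have -> : ms n `^ (2 * gm) = ms (2 * n) `^ gm.
      by rewrite powRrM powR_mulrn ?(ltW m0)// mesh_double.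
    have m2 := @mesh_gt0 R (2 * n).
    rewrite -powRM ?(ltW m2)//; apply: ge0_ler_powR; rewrite ?nnegrE ?normr_ge0 ?(ltW gm0)//.
    by apply: mulr_ge0 => //; exact: ltW.
  have gm20 : 0 <= 2 * gm by apply: mulr_ge0 => //; exact: ltW.
  rewrite -powRM ?(ltW m0)//; apply: ge0_ler_powR; rewrite ?nnegrE ?normr_ge0//.
  by apply: mulr_ge0 => //; exact: ltW.
rewrite lee_fin; apply: le_trans (HC' n); rewrite le_eqVlt; apply/orP; left; apply/eqP.
congr (2 * expR (- _)).
have -> : - (2 * (gm - g)) = 2 * g - 2 * gm by ring.
rewrite powRB; last by rewrite (gt_eqF m0) implybT.
have -> : ms n `^ (2 * g) = (ms n `^ g) ^+ 2.
  by rewrite mulrC powRrM powR_mulrn// ltW.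
have q1 : ms n `^ (2 * gm) != 0 by rewrite gt_eqF// powR_gt0.
by field; rewrite q1 gt_eqF.
Qed.

Lemma cvg_of_tails (g : R) (X : nat -> Omega -> R) (Y : Omega -> R) (C : R) (N : nat) :
  0 < g -> (forall n, measurable_fun setT (X n)) -> measurable_fun setT Y ->
  (forall n, (N <= n)%N -> (P [set w | (ms n `^ g <= `|Y w - X n w|)%R] <= (C * ms n)%:E)%E) ->
  {ae P, forall w, X n w @[n --> \oo] --> Y w}.
Proof.
move=> g0 mX mY h.
have := @eventually_not _ _ _ P (fun n => [set w | ms n `^ g <= `|Y w - X n w|]) C N.
move=> /(_ _ h); case.
  by move=> n; exact: measurable_difference.
move=> Z [mZ PZ ZP]; exists Z; split => // w nw; apply: ZP => /= -[M HM]; apply: nw => /=.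
apply/cvgrPdist_lt => e e0.
have /andP[q0 q1] := q_itv g0.
have : (fun n => ((2^-1 : R) `^ g) ^+ n) @ \oo --> (0 : R).
  by apply: cvg_expr; rewrite ger0_norm ?(ltW q0).
move=> /cvgrPdist_lt/(_ _ e0)[M' _ HM'].
exists (maxn M M') => // n /= hn.
have := HM n (leq_trans (leq_maxl _ _) hn); move/negP; rewrite -ltNge => h1.
apply: lt_trans h1 _; have := HM' n (leq_trans (leq_maxr _ _) hn).
by rewrite sub0r normrN powR_mesh; apply: le_lt_trans; exact: ler_norm.
Qed.

Variable A : nat.
Hypothesis DA : forall x, D x -> `|x| <= A%:R.

(** Identifies the limit along the grids with the stochastic integral at a fixed point, which is
    what makes the limit a version. *)
Lemma mild_grid_cvg t x : 0 <= t -> D x ->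
  {ae P, forall w, mild_value (grid_time n t) (grid_space A n x) w @[n --> \oo] -->
    mild_value t x w}.
Proof.
move=> t0 Dx.
have [k kx] : exists k, deep D k x.
  have /nbhs_ballP[e /= e0 he] := oD Dx.
  have [k ke] := mesh_small e0; exists k => y yx; apply: he.
  by rewrite -ball_normE/= distrC; exact: le_lt_trans ke.
pose g := Theta / 2.
have T0 : 0 < Theta by rewrite lt_min ltr01 andbT; move: alphad; set z := d%:R / 2; lra.
have gT : 0 < g < Theta by rewrite /g; move: T0; set T := Num.min _ _; lra.
have [g0 _] := andP gT.
have [C C0 HC] := close_points_tail k 1 gT.
apply: (@cvg_of_tails g _ _ C (k + 5) g0) => [n||n kn]; [exact: measurable_mild_value..|].
have := HC n (t, x) (grid_time n t, grid_space A n x) kn t0 (grid_time_ge0 n t) kx.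
rewrite expr1; apply; split=> /=.
  apply: le_trans (grid_time_dist n t0) _.
  by have := @mesh_gt0 R (2 * n); lra.
apply: le_trans (grid_space_dist DA n Dx) _.
by have := @mesh_gt0 R n; lra.
Qed.

(** Level n has of order 4^(n (d + 1)) grid points, hence 2^(n (4 d + 4)) pairs; one more power of
    the mesh is left to be summed. *)
Lemma card_grid_pairs m : exists C : R, forall n,
  (#|{: bool * @grid_index d A m n * @grid_index d A m n}|)%:R * ms n ^+ (4 * d + 5) <= C * ms n.
Proof.
pose B := (m + 2 * A + 1)%N; pose e := (d.+1 + d.+1)%N.
exists (2 * (B * 4)%:R ^+ e) => n.
have -> : (#|{: bool * @grid_index d A m n * @grid_index d A m n}| = 2 * (grid_size A m n) ^ e)%N.
  rewrite !card_prod !card_ffun !card_ord card_bool /e expnD !expnS; lia.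
have sz : (grid_size A m n <= B * 4 * 4 ^ n)%N.
  rewrite /grid_size /B expnS; have : (0 < 4 ^ n)%N by rewrite expn_gt0.
  set z := (4 ^ n)%N; lia.
have m0 := @mesh_gt0 R n.
apply: (@le_trans _ _ ((2 * (B * 4 * 4 ^ n) ^ e)%:R * ms n ^+ (4 * d + 5))).
  by rewrite ler_wpM2r ?exprn_ge0 ?(ltW m0)// ler_nat leq_mul2l/= leq_exp2r.
have -> : ((2 * (B * 4 * 4 ^ n) ^ e)%:R : R) = 2 * (B * 4)%:R ^+ e * (4 ^+ n) ^+ e.
  by rewrite natrM natrX natrM natrX exprMn mulrA.
have -> : ms n ^+ (4 * d + 5) = ms n * (ms n ^+ 2) ^+ e.
  by rewrite -exprM -exprS; congr (_ ^+ _); rewrite /e; lia.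
have e1 : (4 ^+ n) ^+ e * (ms n ^+ 2) ^+ e = 1.
  rewrite -exprMn /mesh exprVn -exprM mulnC exprM (_ : 2 ^+ 2 = 4 :> R); last by ring.
  by rewrite mulfV ?expr1n// expf_neq0.
by rewrite [ms n * _]mulrC mulrA -[X in X * ms n]mulrA e1 mulr1.
Qed.

Lemma mild_grid_bound m (g : R) : 0 < g < Theta ->
  {ae P, forall w, exists2 N, (m < N)%N & forall n, (N <= n)%N ->
    grid_bound D A m (fun t x => mild_value t x w) g n}.
Proof.
move=> gT; have [C C0 HC] := close_points_tail m.+1 (4 * d + 5) gT.
have [C' HC'] := card_grid_pairs m.
pose gp n (e : bool) (i : @grid_index d A m n) : R * 'rV[R]_d := grid_point (n + e) i.
(* Only deep, close pairs obey the tail bound, so the union is restricted to them. *)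
pose c n (z : bool * @grid_index d A m n * @grid_index d A m n) :=
  `[< [/\ deep D m.+1 (gp n false z.1.2).2, deep D m.+1 (gp n z.1.1 z.2).2 &
        close_points n (gp n false z.1.2) (gp n z.1.1 z.2)] >].
pose F n (z : bool * @grid_index d A m n * @grid_index d A m n) :=
  let p := gp n false z.1.2 in let q := gp n z.1.1 z.2 in
  [set w | ms n `^ g <= `|mild_value p.1 p.2 w - mild_value q.1 q.2 w|].
have mF n z : measurable (F n z).
  by apply: measurable_difference; exact: measurable_mild_value.
have time0 n e i : 0 <= (gp n e i).1 by rewrite mulr_ge0// ltW// mesh_gt0.
have PF n : (m.+1 + 5 <= n)%N -> forall z, c n z -> (P (F n z) <= (C * ms n ^+ (4 * d + 5))%:E)%E.
  move=> mn z /asboolP[h1 h2 h3].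
  exact: (HC n _ _ mn (time0 n false z.1.2) (time0 n z.1.1 z.2) h1 h3).
pose G n := \big[setU/set0]_(z | c n z) F n z.
have mG n : measurable (G n).
  by apply: bigsetU_measurable => z _; exact: mF.
have := @eventually_not _ _ _ P G (C' * C) (m.+1 + 5) mG.
case.
  move=> n mn; have b0 : 0 <= C * ms n ^+ (4 * d + 5).
    by rewrite mulr_ge0 ?(ltW C0)// exprn_ge0// ltW// mesh_gt0.
  have [_] := probability_bigsetU
    (index_enum (bool * @grid_index d A m n * @grid_index d A m n)%type)
    (fun z _ => mF n z) (PF n mn) b0.
  rewrite (_ : size _ = #|{: bool * @grid_index d A m n * @grid_index d A m n}|); last first.
    by rewrite cardT enumT [index_enum _]unlock.
  move=> h; apply: le_trans h _.
  rewrite lee_fin mulrCA [leRHS]mulrAC [leRHS]mulrC ler_wpM2l ?(ltW C0)//; exact: HC'.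
move=> Z [mZ PZ ZP]; exists Z; split => // w nw; apply: ZP => /= -[M HM]; apply: nw => /=.
exists (maxn M m.+1); first by rewrite leq_max leqnn orbT.
move=> n hn e i j; cbv zeta; have -> : grid_point n i = gp n false i by rewrite /gp addn0.
move=> h1 h2 h3; rewrite leNgt; apply/negP => h.
apply: (HM n (leq_trans (leq_maxl _ _) hn)); rewrite /G (bigD1 (e, i, j))/=.
  by left; exact: ltW.
exact/asboolP.
Qed.

End stochastic_integral.

(** * The version *)

(** Both conditions, with one m as time horizon and as depth, hold near each point for all large m,
    so compactness gives a common m. *)
Lemma compact_deep {R : realType} {d : nat} (D : set 'rV[R]_d) (K : set (R * 'rV[R]_d)) :
  open D -> compact K -> K `<=` [set p | 0 <= p.1 /\ D p.2] ->
  exists m, forall t x, K (t, x) -> 0 <= t <= m%:R /\ deep D m x.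
Proof.
move=> oD cK KD.
have /compact_near_coveringP/(_ nat \oo
  (fun m p => p.1 <= m%:R /\ deep D m p.2)) := cK.
case=> [[t x] Ktx|m _ Hm].
  have [_ /= Dx] := KD _ Ktx.
  have /nbhs_ballP[e /= e0 he] := oD _ Dx.
  have e2 : 0 < e / 2 by rewrite divr_gt0.
  have [k ke] := mesh_small e2.
  pose M := maxn k (Num.bound (`|t| + 1)).
  exists ((fun p : R * 'rV[R]_d => ball t 1 p.1 /\ ball x (e / 2) p.2), [set n | (M <= n)%N]).
    split; last by exists M.
    exists (ball t 1, ball x (e / 2)); last by move=> [].
    by split; apply: nbhsx_ballx.
  move=> [[s y] n] /= [[ts xy] Mn]; split.
    have t1 : `|t| + 1 <= n%:R.
      apply: (@le_trans _ _ (Num.bound (`|t| + 1))%:R).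
        by apply/ltW/archi_boundP; exact: addr_ge0.
      by rewrite ler_nat (leq_trans (leq_maxr _ _) Mn).
    apply: le_trans t1; move: ts; rewrite /ball/= distrC => ts.
    have := ler_normD (s - t) t; rewrite subrK => h; have := ler_norm s; lra.
  move=> z zy; apply: he; rewrite -ball_normE/=; move: xy; rewrite -ball_normE/= => xy.
  have kn : mesh n <= mesh k :> R by apply: le_mesh; exact: leq_trans (leq_maxl _ _) Mn.
  have -> : x - z = (x - y) - (z - y) by rewrite opprB addrA subrK.
  by apply: le_lt_trans (ler_normB _ _) _; lra.
exists m => t x Ktx; have [t1 x1] := Hm m (leqnn m) _ Ktx; have [/= t0 _] := KD _ Ktx.
by rewrite t0.
Qed.

(** * Construction of the version and its regularity *)

Section continuous_version.
Context {R : realType} {d : nat} {D : set 'rV[R]_d} {lam : nat -> R}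
  {f : nat -> 'rV[R]_d -> R} {alpha : R} {H : completeNormedModType R}
  {ip : H -> H -> R} {J : ('rV[R]_d -> R) -> H}
  {dO : measure_display} {Omega : measurableType dO} {P : probability Omega R}
  {W : (R -> H) -> {RV P >-> R}}.
Hypotheses (d0 : (0 < d)%N) (oD : open D) (bD : bounded_set D)
  (bdD : C2_boundary D) (E : dirichlet_eigensystem D lam f) (alpha0 : 0 < alpha)
  (comp : alpha_completion D alpha lam f ip J) (alphad : d%:R / 2 - 1 < alpha)
  (isoW : isonormal ip W).
Variable A : nat.
Hypothesis DA : forall x, D x -> `|x| <= A%:R.
Local Notation ms := (@mesh R).
Local Notation Theta := (Num.min (alpha - d%:R / 2 + 1) 1).
Local Notation value := (@mild_value R d lam f H J dO Omega P W).

Lemma Theta_gt0 : 0 < Theta.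
Proof. by rewrite lt_min ltr01 andbT; move: alphad; set z := d%:R / 2; lra. Qed.

(** A sequence increasing to Theta: countably many exponents give one null set for all b0 and b1. *)
Definition exponent (j : nat) : R := Theta * (1 - ms j.+1).

Lemma exponent_itv j : 0 < exponent j < Theta.
Proof.
have T0 := Theta_gt0; have m0 := @mesh_gt0 R j.+1.
have m1 : ms j.+1 <= 2^-1 by have := @mesh_le1 R j; rewrite meshS; lra.
apply/andP; split; first by apply: mulr_gt0 => //; lra.
by rewrite gtr_pMr//; lra.
Qed.

Lemma exponent_ge (b : R) : b < Theta -> exists j, b <= exponent j.
Proof.
move=> bT; have T0 := Theta_gt0.
have e0 : 0 < (Theta - b) / Theta by rewrite divr_gt0// subr_gt0.
have [j je] := mesh_small e0; exists j; rewrite /exponent mulrBr mulr1.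
have h : Theta * ms j.+1 <= Theta - b.
  rewrite mulrC -ler_pdivlMr//; apply: le_trans (ltW je); exact: le_mesh.
by move: h; set T := Num.min _ _; lra.
Qed.

Definition regular (w : Omega) : Prop := forall m j, exists2 N, (m < N)%N &
  forall n, (N <= n)%N -> grid_bound D A m (fun t x => value t x w) (exponent j) n.

Lemma ae_regular : {ae P, forall w, regular w}.
Proof.
apply: ae_foralln => m; apply: ae_foralln => j.
exact: (mild_grid_bound d0 oD bD bdD E alpha0 comp alphad isoW A m (exponent_itv j)).
Qed.

Lemma regular_cvg w t x : regular w -> 0 <= t -> D x ->
  cvgn (fun n => value (grid_time n t) (grid_space A n x) w).
Proof.
move=> rw t0 Dx.
have [m Hm] : exists m, forall s y, [set (t, x)] (s, y) -> 0 <= s <= m%:R /\ deep D m y.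
  by apply: compact_deep => //; [exact: compact_set1|move=> _ ->].
have [tm kx] := Hm t x erefl.
have [N mN HN] := rw m 0%N; have [g0 _] := andP (exponent_itv 0).
by have [c _] := grid_limit DA g0 mN HN tm kx; exact: c.
Qed.

Variable Z : set Omega.
Hypotheses (mZ : measurable Z) (regularZ : forall w, ~ Z w -> regular w).

(** Killing the values on the measurable null set Z makes the sequence converge for every w, so its
    limit is measurable although [regular] itself is not shown to be a measurable event. *)
Definition grid_value t x n (w : Omega) : R :=
  \1_(~` Z) w * value (grid_time n t) (grid_space A n x) w.

Definition limit_value t x (w : Omega) : R :=
  if `[< 0 <= t /\ D x >] then limn (fun n => grid_value t x n w) else 0.

Lemma grid_valueE t x w : ~ Z w ->
  (fun n => grid_value t x n w) = (fun n => value (grid_time n t) (grid_space A n x) w).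
Proof.
by move=> nw; apply/funext => n; rewrite /grid_value indicE mem_set// mul1r.
Qed.

Lemma grid_value_cvg t x w : 0 <= t -> D x -> cvgn (fun n => grid_value t x n w).
Proof.
move=> t0 Dx; have [nw|/contrapT zw] := pselect (~ Z w).
  by rewrite grid_valueE//; exact: (regular_cvg (regularZ nw) t0 Dx).
suff -> : (fun n => grid_value t x n w) = (fun=> 0) by exact: is_cvg_cst.
by apply/funext => n; rewrite /grid_value indicE memNset ?mul0r//; exact.
Qed.

Lemma measurable_limit_value t x : measurable_fun setT (limit_value t x).
Proof.
rewrite /limit_value; case: asboolP => [[t0 Dx]|_]; last exact: measurable_cst.
apply: (@measurable_fun_cvg _ _ _ setT (fun n => grid_value t x n)).
  move=> n; apply: measurable_funM; last exact: measurable_mild_value.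
  by apply: measurable_indic; exact: measurableC.
by move=> w _ /=; have c := grid_value_cvg (w := w) t0 Dx; exact: c.
Qed.

HB.instance Definition _ t x :=
  isMeasurableFun.Build _ _ _ _ (limit_value t x) (measurable_limit_value t x).

Definition continuous_version t x : {RV P >-> R} := limit_value t x.

Lemma continuous_versionE t x w : ~ Z w -> 0 <= t -> D x ->
  continuous_version t x w = limn (fun n => value (grid_time n t) (grid_space A n x) w).
Proof.
move=> nw t0 Dx; rewrite /continuous_version/= /limit_value asboolT// grid_valueE//.
Qed.

Hypothesis PZ : P Z = 0%E.

Lemma ae_not_Z (Q : Omega -> Prop) : (forall w, ~ Z w -> Q w) -> {ae P, forall w, Q w}.
Proof.
move=> ZQ; exists Z; split => // w nQ; apply: contrapT => nw; exact: nQ (ZQ _ nw).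
Qed.

(** The integrand at time 0 is the zero function, so the isometry gives W of it a zero second
    moment. *)
Lemma mild_value_initial x : D x -> {ae P, forall w, value 0 x w = 0}.
Proof.
move=> Dx; have [_ G] := isoW; set g := mild_integrand lam f J 0 x.
have gE r : g r = 0 by rewrite /g mild_integrand0.
have bg : bochner_L2 g := mild_bochner d0 oD bD bdD E alpha0 comp alphad (lexx 0) Dx.
have m2 : measurable_fun setT (fun w => W g w * W g w) by exact: measurable_funM.
have int0 : (\int[P]_w `|(W g w * W g w)%:E| = 0)%E.
  have := G g g bg bg; rewrite unlock.
  under [X in _ = X]eq_integral => r _ do rewrite gE (ip_norm comp) normr0 expr0n.
  rewrite integral0 => <-; apply: eq_integral => w _.
  by rewrite abse_EFin ger0_norm// -expr2 sqr_ge0.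
have /(ae_eq_integral_abs P measurableT) h : measurable_fun setT (fun w => (W g w * W g w)%:E).
  by apply/measurable_EFinP.
move/h : int0; apply: filterS => w /(_ I) [] /eqP; rewrite mulf_eq0 orbb => /eqP.
exact.
Qed.

Lemma continuous_version_is_version :
  is_version D (mild_solution lam f J (fun h => W h)) continuous_version.
Proof.
move=> t x t0 Dx.
have h1 := mild_grid_cvg d0 oD bD bdD E alpha0 comp alphad isoW DA t0 Dx.
have h2 := @ae_not_Z (fun w => ~ Z w) (fun w nw => nw).
have h3 : {ae P, forall w, value t x w = mild_solution lam f J (fun h => W h) t x w}.
  rewrite /mild_solution; case: ifPn => [_|]; first by apply: aeW.
  rewrite -leNgt => t0'; have -> : t = 0 by apply/eqP; rewrite eq_le t0'.
  exact: mild_value_initial.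
apply: filterS3 h1 h2 h3 => w c nw e.
rewrite continuous_versionE// -e; exact: (cvg_lim _ c).
Qed.

Lemma continuous_version_holder b0 b1 : 0 < b0 < Theta / 2 -> 0 < b1 < Theta ->
  locally_holder D continuous_version b0 b1.
Proof.
move=> /andP[b00 b0T] /andP[b10 b1T]; apply: ae_not_Z => w nw K cK KD.
have [m Hm] := compact_deep oD cK KD.
(* Time is measured in meshes 4^-n, so b0 counts twice. *)
have bT : Num.max (2 * b0) b1 < Theta.
  by rewrite gt_max b1T andbT; move: b0T; set T := Num.min _ _; lra.
have [j jb] := exponent_ge bT; move: jb; rewrite ge_max => /andP[jb0 jb1].
have [g0 _] := andP (exponent_itv j).
have [N mN HN] := regularZ nw m j.
have [C HC] := limit_holder DA g0 mN HN b00 b10 jb0 jb1.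
(* A nonnegative constant is needed to replace the sup norm by the larger Euclidean norm. *)
exists `|C| => t x s y Kt Ks.
have [tm kx] := Hm _ _ Kt; have [sm ky] := Hm _ _ Ks.
have [t0 _] := andP tm; have [s0 _] := andP sm.
rewrite !continuous_versionE//; [|exact: deep_D ky|exact: deep_D kx].
apply: le_trans (HC t x s y tm sm kx ky) _.
apply: (@le_trans _ _ (`|C| * (`|t - s| `^ b0 + `|x - y| `^ b1))).
  by apply: ler_wpM2r (ler_norm C); rewrite addr_ge0// powR_ge0.
apply: ler_wpM2l => //; rewrite lerD2l; apply: ge0_ler_powR; rewrite ?nnegrE ?(ltW b10)//.
  exact: sqrtr_ge0.
exact: norm_le_enorm.
Qed.

End continuous_version.

Theorem theorem1p2 (R : realType) (d : nat) (D : set 'rV[R]_d) (alpha : R)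
    (lam : nat -> R) (f : nat -> 'rV[R]_d -> R)
    (H : completeNormedModType R) (ip : H -> H -> R)
    (J : ('rV[R]_d -> R) -> H)
    (dO : measure_display) (Omega : measurableType dO)
    (P : probability Omega R) (W : (R -> H) -> {RV P >-> R}) :
  (0 < d)%N -> 0 < alpha ->
  is_domain D -> bounded_set D -> C2_boundary D ->
  d%:R / 2 - 1 < alpha ->
  dirichlet_eigensystem D lam f ->
  alpha_completion D alpha lam f ip J ->
  measure_is_complete P ->
  isonormal ip W ->
  let theta := alpha - d%:R / 2 + 1 in
  exists v : R -> 'rV[R]_d -> {RV P >-> R},
    is_version D (mild_solution lam f J (fun h => W h)) v /\
    forall b0 b1 : R,
      0 < b0 < Num.min theta 1 / 2 -> 0 < b1 < Num.min theta 1 ->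
      locally_holder D v b0 b1.
Proof.
move=> d0 alpha0 [_ oD _] bD bdD alphad E comp _ isoW.
have [r r0 Dr] := bounded_cube bD.
have DA x : D x -> `|x| <= (Num.bound r)%:R.
  move=> /Dr; rewrite subr0 => xr; apply: le_trans xr _.
  by apply/ltW/archi_boundP/ltW.
have [Z [mZ PZ hZ]] := ae_regular d0 oD bD bdD E alpha0 comp alphad isoW (Num.bound r).
have regularZ w : ~ Z w -> regular (lam := lam) (f := f) (alpha := alpha) (J := J) (W := W)
    (D := D) (Num.bound r) w.
  by move=> nw; apply: contrapT => nr; exact: nw (hZ _ nr).
exists (continuous_version oD alphad DA mZ regularZ); split.
  exact: (continuous_version_is_version d0 oD bD bdD E alpha0 comp alphad isoW DA mZ regularZ PZ).
by move=> b0 b1 h0 h1; exact: (continuous_version_holder oD alphad DA mZ regularZ PZ h0 h1).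
Qed.
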